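(* Let $R$ and $r$ be positive radii with $R \geq \sqrt{1+3n}\, r$, and let $\Lambda$ be a positive real number. Let $M_t$, $t \in [-r^2,0]$, be an embedded solution of mean curvature flow in the ball $B_{3R}(0) \subset \mathbb{R}^{n+1}$ satisfying $R^{-1} \leq \Lambda H$ and $|A| \leq \Lambda H$ for all $t \in [-r^2,0]$ and all $x \in M_t \cap B_{\sqrt{1+3n}\, r}(0)$. Suppose moreover that $$\frac{1}{2}\, \Lambda\, H(x,-r^2)\, |x-y|^2 - \langle x-y,\nu(x,-r^2) \rangle \geq 0$$ for all $x \in M_{-r^2} \cap B_{\sqrt{1+3n}\, r}(0)$ and all $y \in M_{-r^2} \cap B_{3R}(0)$. Then $$\Lambda\, (2+6n)^{4}\, H(x,t)\, |x-y|^2 - \langle x-y,\nu(x,t) \rangle \geq 0$$ for all $t \in [-r^2,0]$, all $x \in M_t \cap B_{\frac{r}{2}}(0)$, and all $y \in M_t \cap B_{3R}(0)$.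
   Context: $B_\rho(0)$ denotes the open ball of radius $\rho$ centered at the origin in $\mathbb{R}^{n+1}$. $M_t$ is a smooth one-parameter family of $n$-dimensional hypersurfaces, each embedded as a proper hypersurface without boundary in $B_{3R}(0)$, smooth up to and including the initial and final times, and moving by mean curvature flow $\frac{\partial x}{\partial t} = -H\nu$. Here $\nu(x,t)$ is the (outward-pointing) unit normal to $M_t$ at $x$, $A$ is the second fundamental form of $M_t$, $|A|$ is its norm, and $H(x,t)$ is the mean curvature (the trace of $A$, i.e. the sum of the principal curvatures), with the sign convention that $-H\nu$ is the mean curvature vector, so that round spheres with outward normal have $H>0$. *)

(* Defs.v *)
From HB Require Import structures.
From mathcomp Require Import all_boot all_order all_algebra.
From mathcomp Require Import all_classical all_reals all_analysis.
Set Implicit Arguments.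
Unset Strict Implicit.
Unset Printing Implicit Defensive.
Import Order.TTheory GRing.Theory Num.Theory numFieldNormedType.Exports.

Local Open Scope classical_set_scope.
Local Open Scope ring_scope.

Section Euclidean.
Context {K : realType} {d : nat}.
Implicit Types u v x : 'rV[K]_d.

Definition dot u v : K := (u *m v^T) 0 0.

(* The library's norm on row vectors is the sup norm; it is only used here for
   the topology, never for distances. *)
Definition enorm u : K := Num.sqrt (dot u u).

Definition eball0 (rho : K) : set 'rV[K]_d := [set x | enorm x < rho].

End Euclidean.

Section Smooth.
Context {K : realType} {E E' : normedModType K}.

(* Meant for open U. *)
Fixpoint Ck (k : nat) (U : set E) (f : E -> E') : Prop :=
  if k is k'.+1 then
    (forall x, U x -> differentiable f x) /\ (forall v, Ck k' U ('D_v f))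
  else forall x, U x -> {for x, continuous f}.

Definition smooth_on (U : set E) (f : E -> E') : Prop := forall k, Ck k U f.

End Smooth.

Section Hypersurface.
Context {K : realType} {d : nat}.
Local Notation V := 'rV[K]_d.
Implicit Types (S : set V) (nu : V -> V) (x w : V) (c : K -> V).

Definition curve_through S x c : Prop :=
  c 0 = x /\ \forall s \near (0 : K), S (c s).

Definition tangent S x : set V :=
  [set v | exists2 c, curve_through S x c & is_derive (0 : K) (1 : K) c v].

Definition unit_normal S x w : Prop :=
  enorm w = 1 /\ forall v, tangent S x v -> dot w v = 0.

(* The second fundamental form A(u, v) = <D_u nu, v> on the tangent space,
   extended by zero on the normal line and stored as its d x d matrix, so that
   A(u, v) = dot (u *m A) v.  For the unit sphere with outward normal, A is the
   orthogonal projection onto the tangent space. *)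
Definition is_second_ff S nu x (A : 'M[K]_d) : Prop :=
  nu x *m A = 0 /\
  forall c v, curve_through S x c -> is_derive (0 : K) (1 : K) c v ->
    is_derive (0 : K) (1 : K) (nu \o c) (v *m A).

(* On a smooth hypersurface with smooth unit normal nu, such a matrix exists
   and is unique; elsewhere the value is junk. *)
Definition second_ff S nu x : 'M[K]_d := xget 0 (is_second_ff S nu x).

Definition mean_curv S nu x : K := \tr (second_ff S nu x).

Definition normA S nu x : K :=
  Num.sqrt (\sum_i \sum_j (second_ff S nu x) i j ^+ 2).

End Hypersurface.

Section Flow.
Context {K : realType} {n : nat}.
Local Notation V := 'rV[K]_n.+1.
Implicit Types (a b : K) (B : set V) (M : K -> set V) (nu : K -> V -> V).

Definition track a b M : set (V * K) :=
  [set z | a <= z.2 <= b /\ M z.2 z.1].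

(* F is a local parametrization, over W x (J `&` [a, b]), of the family M,
   moving by dx/dt = - H nu: each F(., t) is an immersion, and G is a
   homeomorphism onto a relatively open subset of the track, so that each slice
   is embedded without boundary and varies smoothly with t.  F and the normal are smooth
   on the open set W x J, which may stick out of the time interval [a, b]: this
   is smoothness up to and including the initial and final times. *)
Definition mcf_chart a b M nu (W : set 'rV[K]_n) (J : set K)
    (F : 'rV[K]_n * K -> V) : Prop :=
  let U := W `*` J in
  let G z := (F z, z.2) in
  let Uab := U `&` [set z | a <= z.2 <= b] in
  [/\ open W, open J & smooth_on U F] /\
  [/\ forall z, Uab z -> forall v, 'D_(v, 0) F z = 0 -> v = 0,
      set_inj Uab G /\
      (forall P, open P -> P `<=` U -> exists2 O, open O &
         G @` (P `&` Uab) = track a b M `&` O),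
      exists2 N : 'rV[K]_n * K -> V, smooth_on U N &
        forall z, Uab z -> nu z.2 (F z) = N z &
      forall z, Uab z ->
        'D_(0, 1) F z =
          - mean_curv (M z.2) (nu z.2) (F z) *: nu z.2 (F z)].

(* (M_t), t in [a, b], is a smooth family of properly embedded hypersurfaces
   without boundary in the open set B, with unit normal nu, moving by mean
   curvature flow.  Outside [a, b], M and nu are irrelevant. *)
Definition embedded_mcf a b B M nu : Prop :=
  [/\ forall t, a <= t <= b -> M t `<=` B,
      (* properness; for the whole family, so that no sheet of M_t may
         appear or disappear suddenly *)
      forall C : set V, compact C -> C `<=` B ->
        compact (track a b M `&` (C `*` setT)),
      forall t x, a <= t <= b -> M t x -> unit_normal (M t) x (nu t x) &
      forall t x, a <= t <= b -> M t x ->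
        exists W J F, mcf_chart a b M nu W J F /\
          exists p, [/\ W p, J t & F (p, t) = x]].

End Flow.

(* Main.v *)
Require Import Defs.
From mathcomp Require Import all_boot all_order all_algebra.
From mathcomp Require Import all_classical all_reals all_analysis.
From mathcomp Require Import ring lra.
Set Implicit Arguments.
Unset Strict Implicit.
Unset Printing Implicit Defensive.
Import Order.TTheory GRing.Theory Num.Theory numFieldNormedType.Exports.
Local Open Scope classical_set_scope.
Local Open Scope ring_scope.

(* The quotient of <x - y, nu(x,t)> cutoff(x,t)^4 by H(x,t) |x - y|^2, with
   cutoff = 7/8 - (3 n t + |x|^2) / r^2, is bounded by a two-point maximum
   principle.  At an interior maximum value m with x <> y, the ball of curvature
   Phi = 2 m H / cutoff^4 touching M_t at x also touches it at y.  Reflecting an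
   orthonormal frame of T_x in the hyperplane orthogonal to x - y gives a frame of
   T_y, and the second variation along both frames, combined with the Codazzi
   equations, yields
     d_t Phi - Laplacian Phi - |A|^2 Phi + 8/5 |grad Phi|^2 / Phi <= 0.
   This contradicts (d_t - Laplacian) H = |A|^2 H together with
   (d_t - Laplacian) cutoff = - n / r^2.  The pinching hypotheses control the
   quotient near the diagonal and for |x - y| comparable to R, so that a maximum
   exists; the time t = 0, where only one-sided information is available, follows
   by continuity. *)

(** Two obstacles shape the proof. First, [second_ff] is a pointwise choice, so its regularity is
    not given: charts identify it with an explicit shape operator, H is recovered as the smooth
    function - <d_t F, N>, and a mere bound on A, which pinching supplies, is enough to
    differentiate tr A. Second, no orthonormal basis is ever chosen: the n+1 rows of the tangential
    projection T satisfy T^T T = 1 - nu^T nu, which is all that a trace needs, and reflecting this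
    frame is one matrix product. The constant 8/5 is 2 / (5/4). A contact value m above 2 Lam
    (1+3n)^4 forces |A| <= Phi / 4, because the cutoff is at most 1 + 3n; hence 0 <= Phi - A <=
    (5/4) Phi, and the first-order conditions express grad Phi through Phi - A. *)

Section Calculus.
Context {K : realType}.

(** * Directional derivatives of matrix products, traces and scalar products *)

Section AnyDomain.
Context {V : normedModType K}.
Implicit Types (x v : V).

Lemma is_derive_mxP m n (A : V -> 'M[K]_(m, n)) x v dA :
  is_derive x v A dA <->
  forall i j, is_derive x v (fun z => A z i j : K) (dA i j).
Proof.
split=> [[dA1 <-] i j|h].
- have /derivable_mxP/(_ i j) d1 := dA1.
  by apply: DeriveDef => //; rewrite (derive_mx dA1) mxE.
- have dA1 : derivable A x v by apply/derivable_mxP => i j; case: (h i j).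
  apply: DeriveDef => //; rewrite (derive_mx dA1); apply/matrixP => i j.
  by rewrite mxE; case: (h i j).
Qed.

Lemma is_derive_mulmx m n p (A : V -> 'M[K]_(m, n)) (B : V -> 'M[K]_(n, p))
    x v dA dB :
  is_derive x v A dA -> is_derive x v B dB ->
  is_derive x v (fun z => A z *m B z) (dA *m B x + A x *m dB).
Proof.
move=> /is_derive_mxP hA /is_derive_mxP hB; apply/is_derive_mxP => i j.
rewrite (_ : (fun z => _) =
    \sum_(k < n) ((fun z => A z i k : K) * (fun z => B z k j : K))); last first.
  by apply/funext => z; rewrite mxE fct_sumE.
pose dAB k := A x i k *: dB k j + B x k j *: dA i k.
have h : is_derive x v
    (\sum_(k < n) ((fun z => A z i k : K) * (fun z => B z k j : K)))
    (\sum_(k < n) dAB k).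
  apply: is_derive_sum => k; exact: is_deriveM.
apply: is_derive_eq h _.
rewrite !mxE -big_split; apply: eq_bigr => k _ /=.
by rewrite /dAB /GRing.scale /= addrC [dA i k * _]mulrC.
Qed.

Lemma is_derive_trmx m n (A : V -> 'M[K]_(m, n)) x v dA :
  is_derive x v A dA -> is_derive x v (fun z => (A z)^T) dA^T.
Proof.
move=> /is_derive_mxP h; apply/is_derive_mxP => i j.
rewrite mxE (_ : (fun _ => _) = (fun z => A z j i)) //.
by apply/funext => z; rewrite mxE.
Qed.

Lemma is_derive_mxtrace n (A : V -> 'M[K]_n) x v dA :
  is_derive x v A dA -> is_derive x v (fun z => \tr (A z) : K) (\tr dA).
Proof.
move=> /is_derive_mxP h.
have -> : (fun z => \tr (A z)) = \sum_(k < n) (fun z => A z k k : K).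
  by apply/funext => z; rewrite fct_sumE.
by apply: (@is_derive_sum _ _ _ _ (fun k z => A z k k : K)).
Qed.

Lemma is_derive_dot n (f g : V -> 'rV[K]_n) x v df dg :
  is_derive x v f df -> is_derive x v g dg ->
  is_derive x v (fun z => dot (f z) (g z)) (dot df (g x) + dot (f x) dg).
Proof.
move=> hf hg; have := is_derive_mulmx hf (is_derive_trmx hg).
by move=> /is_derive_mxP/(_ 0 0); rewrite mxE.
Qed.

Lemma is_derive_row m n (f : 'I_m -> V -> 'rV[K]_n) x v df :
  (forall i, is_derive x v (f i) (df i)) ->
  is_derive x v (fun z => \matrix_i f i z) (\matrix_i df i).
Proof.
move=> h; apply/is_derive_mxP => i j.
have -> : (fun z => (\matrix_k f k z) i j) = (fun z => f i z 0 j).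
  by apply/funext => z; rewrite mxE.
by rewrite mxE; have /is_derive_mxP/(_ 0 j) := h i.
Qed.

Lemma is_derive_uniq (W : normedModType K) (f : V -> W) x v a b :
  is_derive x v f a -> is_derive x v f b -> a = b.
Proof. by move=> [_ <-] [_ <-]. Qed.

Lemma is_derive_differentiable (W : normedModType K) (f : V -> W) x v :
  differentiable f x -> is_derive x v f ('D_v f x).
Proof. by move=> h; apply/derivableP/diff_derivable. Qed.

Lemma deriveDl (W : normedModType K) (f : V -> W) x u v :
  differentiable f x -> 'D_(u + v) f x = 'D_u f x + 'D_v f x.
Proof. by move=> h; rewrite !deriveE // linearD. Qed.

Lemma deriveZl (W : normedModType K) (f : V -> W) x (a : K) v :
  differentiable f x -> 'D_(a *: v) f x = a *: 'D_v f x.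
Proof. by move=> h; rewrite !deriveE // linearZ. Qed.

Lemma derive_suml (W : normedModType K) (f : V -> W) x I (r : seq I) (F : I -> V) :
  differentiable f x -> 'D_(\sum_(i <- r) F i) f x = \sum_(i <- r) 'D_(F i) f x.
Proof.
move=> h; rewrite deriveE // linear_sum; apply: eq_bigr => i _.
by rewrite deriveE.
Qed.

Lemma is_derive_curve (W : normedModType K) (f : V -> W) (c : K -> V) (s : K) v :
  is_derive s (1 : K) c v -> differentiable f (c s) ->
  is_derive s (1 : K) (fun s => f (c s)) ('D_v f (c s)).
Proof.
move=> [dc <-] df.
have dc' : differentiable c s by apply/derivable1_diffP.
have dfc : differentiable (f \o c) s by exact: differentiable_comp.
apply: DeriveDef; first exact: diff_derivable.
by rewrite [LHS]deriveE // diff_comp //= -!deriveE.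
Qed.

Lemma is_derive_line x v (s : K) :
  is_derive s (1 : K) (fun s : K => x + s *: v) v.
Proof.
have h : is_derive s (1 : K) (fun s : K => s *: v) v.
  have := @is_diff_scalel _ _ s v; move=> h.
  have dh : differentiable (fun s : K => s *: v) s by [].
  apply: DeriveDef; first exact: diff_derivable.
  by rewrite deriveE // diff_val scale1r.
rewrite -[X in is_derive _ _ _ X]add0r.
exact: (@is_deriveD _ _ _ (cst x) (fun s : K => s *: v)).
Qed.

End AnyDomain.
End Calculus.

(** * Second-order jets of curves at parameter 0 *)

Section Jets.
Context {K : realType}.

Lemma is_derive_scalel (W : normedModType K) (k : K -> K) (s dk : K) (b : W) :
  is_derive s (1 : K) k dk -> is_derive s (1 : K) (fun s => k s *: b) (dk *: b).
Proof.
move=> hk; have h := @is_diff_scalel _ _ (k s) b.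
have d : differentiable (fun s : K => s *: b) (k s) by [].
have := is_derive_curve hk d.
by rewrite deriveE // diff_val.
Qed.

(** The difference quotient at 0 is [g s] itself, so continuity of [g] at 0 is enough. *)
Lemma is_derive_idscale (W : normedModType K) (g : K -> W) :
  {for 0, continuous g} -> is_derive (0 : K) (1 : K) (fun s => s *: g s) (g 0).
Proof.
move=> cg.
have h : (fun h : K => h^-1 *: (((fun s => s *: g s) \o shift 0) (h *: (1 : K)) -
   0 *: g 0)) @ 0^' --> g 0.
  have cg2 : g @ 0^' --> g 0 by exact: cvg_within_filter.
  apply: cvg_trans cg2.
  apply: near_eq_cvg; near=> s.
  rewrite /= scale0r subr0 addr0 [s *: 1]mulr1 scalerA mulVf ?scale1r //.
  by near: s; exact: nbhs_dnbhs_neq.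
apply: DeriveDef; first by apply/cvg_ex; exists (g 0).
exact: cvg_lim h.
Unshelve. all: by end_near. Qed.

(** A relation rather than iterated derivative operators, so that second derivatives of products and
    quotients are assembled by composing lemmas. The first derivative must exist near 0 for the
    second one to make sense at 0. *)
Definition jet2 (W : normedModType K) (f : K -> W) (f0 f1 f2 : W) : Prop :=
  exists df : K -> W, [/\ f 0 = f0, df 0 = f1,
    \forall s \near 0, is_derive s (1 : K) f (df s) &
    is_derive (0 : K) (1 : K) df f2].

Lemma jet2_eq (W : normedModType K) (f : K -> W) f0 f1 f2 g0 g1 g2 :
  jet2 f f0 f1 f2 -> f0 = g0 -> f1 = g1 -> f2 = g2 -> jet2 f g0 g1 g2.
Proof. by move=> h <- <- <-. Qed.

Lemma jet2D (W : normedModType K) (f g : K -> W) f0 f1 f2 g0 g1 g2 :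
  jet2 f f0 f1 f2 -> jet2 g g0 g1 g2 ->
  jet2 (fun s => f s + g s) (f0 + g0) (f1 + g1) (f2 + g2).
Proof.
move=> [df [<- <- nf h]] [dg [<- <- ng k]].
exists (fun s => df s + dg s); split=> //; last exact: is_deriveD.
by near=> s; apply: is_deriveD; near: s.
Unshelve. all: by end_near. Qed.

Lemma jet2N (W : normedModType K) (f : K -> W) f0 f1 f2 :
  jet2 f f0 f1 f2 -> jet2 (fun s => - f s) (- f0) (- f1) (- f2).
Proof.
move=> [df [<- <- nf h]].
exists (fun s => - df s); split=> //; last exact: is_deriveN.
by near=> s; apply: is_deriveN; near: s.
Unshelve. all: by end_near. Qed.

Lemma jet2B (W : normedModType K) (f g : K -> W) f0 f1 f2 g0 g1 g2 :
  jet2 f f0 f1 f2 -> jet2 g g0 g1 g2 ->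
  jet2 (fun s => f s - g s) (f0 - g0) (f1 - g1) (f2 - g2).
Proof. by move=> h k; apply: jet2D => //; exact: jet2N. Qed.

Lemma jet2_cst (W : normedModType K) (c : W) : jet2 (fun _ => c) c 0 0.
Proof.
exists (fun _ => 0); split=> //.
  by apply: filterE => s; exact: is_derive_cst.
exact: is_derive_cst.
Qed.

Lemma jet2_dot n (f g : K -> 'rV[K]_n) f0 f1 f2 g0 g1 g2 :
  jet2 f f0 f1 f2 -> jet2 g g0 g1 g2 ->
  jet2 (fun s => dot (f s) (g s) : K) (dot f0 g0) (dot f1 g0 + dot f0 g1)
    (dot f2 g0 + dot f1 g1 + (dot f1 g1 + dot f0 g2)).
Proof.
move=> [df [<- <- nf h]] [dg [<- <- ng k]].
exists (fun s => dot (df s) (g s) + dot (f s) (dg s)); split=> //.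
  by near=> s; apply: is_derive_dot; near: s.
have hf := nbhs_singleton nf; have hg := nbhs_singleton ng.
by apply: is_deriveD; apply: is_derive_dot.
Unshelve. all: by end_near. Qed.

Lemma jet2M (f g : K -> K) (f0 f1 f2 g0 g1 g2 : K) :
  jet2 f f0 f1 f2 -> jet2 g g0 g1 g2 ->
  jet2 (fun s => f s * g s) (f0 * g0) (f1 * g0 + f0 * g1)
    (f2 * g0 + f1 * g1 + (f1 * g1 + f0 * g2)).
Proof.
have der (u v : K -> K) (s u1 v1 : K) : is_derive s (1 : K) u u1 ->
    is_derive s (1 : K) v v1 ->
    is_derive s (1 : K) (fun s => u s * v s) (u1 * v s + u s * v1).
  move=> hu hv; apply: is_derive_eq (is_deriveM hu hv) _.
  by rewrite /GRing.scale /= addrC mulrC.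
move=> [df [<- <- nf h]] [dg [<- <- ng k]].
exists (fun s => df s * g s + f s * dg s); split=> //.
  by near=> s; apply: der; near: s.
have hf := nbhs_singleton nf; have hg := nbhs_singleton ng.
by apply: is_deriveD; apply: der.
Unshelve. all: by end_near. Qed.

Lemma is_deriveVK (f : K -> K) (s df : K) : f s != 0 ->
  is_derive s (1 : K) f df ->
  is_derive s (1 : K) (fun s => (f s)^-1) (- df * (f s) ^- 2).
Proof.
move=> f0 [d <-]; apply: DeriveDef; first exact: derivableV.
by rewrite deriveV // /GRing.scale /= mulNr mulrC mulNr.
Qed.

Lemma jet2V (f : K -> K) (f0 f1 f2 : K) :
  f0 != 0 -> jet2 f f0 f1 f2 ->
  jet2 (fun s => (f s)^-1) f0^-1 (- f1 * f0 ^- 2)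
    (- f2 * f0 ^- 2 + 2 * f1 ^+ 2 * f0 ^- 3).
Proof.
move=> nz0 [df [e <- nf h]]; rewrite -e in nz0 *.
have hf : is_derive (0 : K) (1 : K) f (df 0) by exact: nbhs_singleton nf.
have cf : {for 0, continuous f}.
  by apply/differentiable_continuous/derivable1_diffP; case: hf.
have nz : \forall s \near 0, f s != 0.
  exact: (cf _ (open_nbhs_nbhs (conj (@open_neq _ 0) nz0))).
exists (fun s => - df s * (f s) ^- 2); split=> //.
  by near=> s; apply: is_deriveVK; near: s.
have i1 := is_deriveVK nz0 hf.
have i2 := is_deriveM i1 i1.
have i3 := is_deriveM (is_deriveN h) i2.
rewrite (_ : (fun s => _) = - df * ((fun s => (f s)^-1) * (fun s => (f s)^-1))).
  apply: is_derive_eq i3 _; rewrite /GRing.scale /= !fctE.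
  by rewrite -!exprVn; field.
by apply/funext => s; rewrite !fctE -exprVn expr2.
Unshelve. all: by end_near. Qed.

Lemma continuous_line (E : normedModType K) (x v : E) :
  continuous (fun s : K => x + s *: v).
Proof.
move=> s; apply: differentiable_continuous; apply/derivable1_diffP.
by case: (is_derive_line x v s).
Qed.

End Jets.

(** * Derivative conditions at a minimum, two-sided and one-sided *)

Section SecondOrder.
Context {K : realType}.

Lemma MVT0 (f df : K -> K) (h : K) : 0 < h ->
  (forall s, 0 <= s <= h -> is_derive s (1 : K) f (df s)) ->
  exists2 s, 0 < s < h & f h - f 0 = df s * h.
Proof.
move=> h0 d.
have [||s sI] := @MVT _ f df 0 h h0.
- by move=> s; rewrite in_itv /= => /andP[s0 sh]; apply: d; rewrite !ltW.
- apply: continuous_in_subspaceT => s; rewrite inE /= in_itv /= => sI.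
  apply/differentiable_continuous/derivable1_diffP.
  by case: (d s sI).
- by rewrite subr0 => e; exists s => //; move: sI; rewrite in_itv.
Qed.

Lemma near_ballK (t : K) (P : K -> Prop) : (\forall s \near t, P s) ->
  exists2 e, 0 < e & forall s, `|s - t| < e -> P s.
Proof.
move=> h; have /nbhs_ballP[e /= e0 he] : nbhs t P by [].
by exists e => // s; rewrite distrC => hs; apply: he; rewrite -ball_normE.
Qed.

(** If [f2] were negative, the first derivative would be negative just to the right of 0, and the
    mean value theorem would push f below its value 0 there. *)
Lemma jet2_min (f : K -> K) f1 f2 : jet2 f 0 f1 f2 ->
  (\forall s \near 0, 0 <= f s) -> f1 = 0 /\ 0 <= f2.
Proof.
move=> [df [f00 <- nf h]] fpos.
have hf0 := nbhs_singleton nf.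
have df0 : df 0 = 0.
  have [e e0 he] := near_ballK (filterI nf fpos).
  have sube s : s \in `](- e), e[ -> `|s - 0| < e.
    by rewrite in_itv /= subr0 ltr_norml.
  have hm : is_derive (0 : K) (1 : K) f 0.
    apply: (@derive1_at_min _ f (- e) e 0).
    - by rewrite (le_trans (_ : _ <= 0)) ?oppr_le0 ?ltW.
    - by move=> s /sube /he[[]].
    - by rewrite in_itv /= oppr_lt0 e0.
    - by move=> s /sube /he[_]; rewrite f00.
  exact: is_derive_uniq hf0 hm.
split=> //; rewrite leNgt; apply/negP => f2lt.
have neg : \forall s \near 0, 0 < s -> df s < 0.
  have [dd df2] := h.
  have /cvgrPdist_lt/(_ (- f2)) : (fun k : K => k^-1 *: ((df \o shift 0) (k *: (1 : K)) - df 0)) @ 0^' --> f2.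
    by rewrite -df2; exact: dd.
  rewrite oppr_gt0 => /(_ f2lt); rewrite near_withinE.
  apply: filterS => s hs s0; move: hs => /(_ (lt0r_neq0 s0)).
  rewrite /= df0 subr0 addr0 [s *: 1]mulr1 ltr_distlC => /andP[_].
  by rewrite subrr /GRing.scale /= pmulr_rlt0 ?invr_gt0.
have [e e0 he] := near_ballK (filterI neg (filterI nf fpos)).
have he2 s : 0 <= s <= e / 2 -> `|s - 0| < e.
  move=> /andP[s0 se]; rewrite subr0 ger0_norm //.
  by apply: le_lt_trans se _; rewrite ltr_pdivrMr // ltr_pMr // ltr1n.
have e20 : 0 < e / 2 by rewrite divr_gt0.
have [s|s /andP[s0 se] E] := @MVT0 f df (e / 2) e20.
  by move=> /he2/he[_ []].
have /he2/he[/(_ s0) dfs _] : 0 <= s <= e / 2 by rewrite !ltW.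
have /he2/he[_ [_]] : 0 <= e / 2 <= e / 2 by rewrite lexx ltW.
by rewrite leNgt -[f _]subr0 -[X in _ - X]f00 E pmulr_llt0 // dfs.
Qed.

(** The form used in time: a contact is compared with earlier times only. *)
Lemma is_derive_left_le0 (f : K -> K) (t df : K) : is_derive t (1 : K) f df ->
  f t = 0 -> (\forall s \near t, s <= t -> 0 <= f s) -> df <= 0.
Proof.
move=> [dd <-] ft fpos; rewrite leNgt; apply/negP => dpos.
have /cvgrPdist_lt/(_ _ dpos) : (fun k : K => k^-1 *: ((f \o shift t) (k *: (1 : K)) - f t)) @ 0^' --> 'D_1 f t by exact: dd.
rewrite near_withinE => h1.
have [e1 e10 he1] := near_ballK h1.
have [e2 e20 he2] := near_ballK fpos.
pose e := Num.min e1 e2 / 2.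
have m0 : 0 < Num.min e1 e2 by rewrite lt_min e10.
have e0 : 0 < e by rewrite divr_gt0.
have em : e < Num.min e1 e2 by rewrite ltr_pdivrMr // ltr_pMr // ltr1n.
have en : - e < 0 by rewrite oppr_lt0.
have /he1/(_ (ltr0_neq0 en)) : `|- e - 0| < e1.
  by rewrite subr0 normrN gtr0_norm // (lt_le_trans em) // ge_min lexx.
rewrite /= ft subr0 [_ *: 1]mulr1 ltr_distlC => /andP[+ _].
rewrite subrr /GRing.scale /= nmulr_rgt0 ?invr_lt0 // => f1.
have /he2 : `|- e + t - t| < e2.
  by rewrite addrK normrN gtr0_norm // (lt_le_trans em) // ge_min lexx orbT.
by rewrite gerDr oppr_le0 ltW // => /(_ isT); rewrite leNgt f1.
Qed.

End SecondOrder.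

(** * Smooth maps: restriction to quadratic curves and algebraic closure *)

Section Smoothness.
Context {K : realType} {E : normedModType K}.

Lemma near_eq_differentiable (W : normedModType K) (f g : E -> W) x :
  (\forall y \near x, f y = g y) -> differentiable f x -> differentiable g x.
Proof.
move=> fg df; have fx := nbhs_singleton fg.
have nfg : \forall h \near 0, f (h + x) = g (h + x).
  have c : {for 0, continuous (fun h : E => h + x)}.
    by apply: continuousD; [exact: cvg_id|exact: cst_continuous].
  by apply: (c (fun y => f y = g y)); rewrite add0r.
have Eg : g \o shift x = cst (g x) + 'd f x +o_ 0 id.
  apply/eqaddoP => e e0; have /eqaddoP/(_ e e0) := diff_locally df.
  by apply: filterS2 nfg => h; rewrite !fctE /= fx => ->.
have cdf : continuous ('d f x) by exact: diff_continuous.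
by apply/diff_locallyP; rewrite (diff_unique cdf Eg).
Qed.

Lemma smooth_on_diff (W : normedModType K) (U : set E) (f : E -> W) x :
  smooth_on U f -> U x -> differentiable f x.
Proof. by move=> /(_ 1%N)[h _]; exact: h. Qed.

Lemma smooth_on_derive (W : normedModType K) (U : set E) (f : E -> W) v :
  smooth_on U f -> smooth_on U ('D_v f).
Proof. by move=> h k; have [_] := h k.+1; apply. Qed.

Lemma smooth_on_cont (W : normedModType K) (U : set E) (f : E -> W) x :
  smooth_on U f -> U x -> {for x, continuous f}.
Proof. by move=> h Ux; apply: (h 0%N). Qed.

Lemma is_derive_quad (z a b : E) (s : K) :
  is_derive s (1 : K) (fun s : K => z + s *: a + (s ^+ 2 / 2) *: b) (a + s *: b).
Proof.
have h1 := is_derive_line z a s.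
have h2 : is_derive s (1 : K) (fun s : K => s ^+ 2 / 2) s.
  have h := is_deriveM (is_derive_id s (1 : K)) (is_derive_id s (1 : K)).
  have := @is_deriveZ _ _ _ _ (2^-1) _ _ _ h.
  rewrite (_ : _ \*: _ = (fun s : K => s ^+ 2 / 2)); last first.
    by apply/funext => u; change (2^-1 * (u * u) = u ^+ 2 / 2); rewrite mulrC expr2.
  move/is_derive_eq; apply; rewrite /GRing.scale /=.
  by field.
exact: is_deriveD h1 (is_derive_scalel b h2).
Qed.

(** The acceleration [b] adds a first-order term to the second derivative; choosing it well later
    makes the image curve geodesic to second order. *)
Lemma jet2_curve (W : normedModType K) (U : set E) (f : E -> W) (z a b : E) :
  open U -> smooth_on U f -> U z ->
  jet2 (fun s : K => f (z + s *: a + (s ^+ 2 / 2) *: b))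
    (f z) ('D_a f z) ('D_a ('D_a f) z + 'D_b f z).
Proof.
move=> oU sf Uz; set c := fun s : K => _.
pose cc := fun s : K => z + s *: a + (s ^+ 2 / 2) *: b.
have cc0 : cc 0 = z by rewrite /cc scale0r expr0n mul0r scale0r !addr0.
have ccont : {for 0, continuous cc}.
  apply/differentiable_continuous/derivable1_diffP.
  by case: (is_derive_quad z a b 0).
have nU : \forall s \near 0, U (cc s).
  by apply: ccont; rewrite cc0; exact: open_nbhs_nbhs.
have d g s : smooth_on U g -> U (cc s) ->
    is_derive s (1 : K) (fun s => g (cc s)) ('D_a g (cc s) + s *: 'D_b g (cc s) : W).
  move=> sg Us; have dg := smooth_on_diff sg Us.
  by rewrite -deriveZl // -deriveDl //; apply: is_derive_curve => //; exact: is_derive_quad.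
exists (fun s => 'D_a f (cc s) + s *: 'D_b f (cc s)); split.
- by rewrite /c scale0r expr0n mul0r scale0r !addr0.
- by rewrite cc0 scale0r addr0.
- by apply: filterS nU => s Us; exact: d.
- have sa := smooth_on_derive a sf; have sb := smooth_on_derive b sf.
  apply: is_deriveD.
    have U0 : U (cc 0) by rewrite cc0.
    by have := d _ 0 sa U0; rewrite cc0 scale0r addr0.
  (* The factor s vanishes at 0, so only continuity of ['D_b f] along the curve is used. *)
  rewrite -[in X in is_derive _ _ _ X]cc0; apply: (@is_derive_idscale _ _ (fun s => 'D_b f (cc s))).
  apply: (@continuous_comp _ _ _ cc ('D_b f)) => //.
  by rewrite cc0; exact: smooth_on_cont sb Uz.
Qed.

End Smoothness.

Section SmoothAlgebra.
Context {K : realType} {E : normedModType K}.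
Implicit Types U : set E.

(** [Ck] iterates derivatives of functions defined on all of [E], while the sum and product rules
    hold only on U; openness of U makes agreement on U enough. *)
Lemma Ck_eq (W : normedModType K) U (f g : E -> W) k :
  open U -> (forall x, U x -> f x = g x) -> Ck k U f -> Ck k U g.
Proof.
move=> oU; elim: k f g => [|k IH] f g fg.
  move=> cf x Ux; have nx : \forall y \near x, f y = g y.
    exact: filterS fg (open_nbhs_nbhs (conj oU Ux)).
  change (g @ x --> g x); rewrite -(fg x Ux); apply: cvg_trans (cf x Ux).
  by apply: near_eq_cvg; apply: filterS nx => y ->.
have nx x : U x -> \forall y \near x, f y = g y.
  by move=> Ux; exact: filterS fg (open_nbhs_nbhs (conj oU Ux)).
move=> [df dk]; split=> [x Ux|v].
  exact: near_eq_differentiable (nx _ Ux) (df x Ux).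
apply: IH (dk v) => x Ux.
by apply: near_eq_derive; exact: nx.
Qed.

Lemma CkD (W : normedModType K) U (f g : E -> W) k :
  open U -> Ck k U f -> Ck k U g -> Ck k U (fun x => f x + g x).
Proof.
move=> oU; elim: k f g => [|k IH] f g.
  by move=> cf cg x Ux; apply: continuousD; [exact: cf|exact: cg].
move=> [df dkf] [dg dkg]; split=> [x Ux|v].
  by apply: differentiableD; [exact: df|exact: dg].
apply: Ck_eq (IH _ _ (dkf v) (dkg v)) => // x Ux.
by rewrite [RHS]deriveD //; apply/diff_derivable; [exact: df|exact: dg].
Qed.

Lemma CkN (W : normedModType K) U (f : E -> W) k :
  open U -> Ck k U f -> Ck k U (fun x => - f x).
Proof.
move=> oU; elim: k f => [|k IH] f.
  by move=> cf x Ux; apply: continuousN; exact: cf.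
move=> [df dkf]; split=> [x Ux|v].
  by apply: differentiableN; exact: df.
apply: Ck_eq (IH _ (dkf v)) => // x Ux.
by rewrite [RHS]deriveN //; apply/diff_derivable; exact: df.
Qed.

Lemma smooth_onN (W : normedModType K) U (f : E -> W) :
  open U -> smooth_on U f -> smooth_on U (fun x => - f x).
Proof. by move=> oU sf k; exact: CkN. Qed.

Lemma differentiable_mx_entry m n (f : E -> 'M[K]_(m, n)) x i j :
  differentiable f x -> differentiable (fun y => f y i j : K) x.
Proof.
move=> df.
apply: (@differentiable_comp _ _ _ _ f (fun A : 'M[K]_(m, n) => A i j : K)) => //.
exact: differentiable_coord.
Qed.

Lemma differentiable_dot n (f g : E -> 'rV[K]_n) x :
  differentiable f x -> differentiable g x ->
  differentiable (fun y => dot (f y) (g y) : K) x.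
Proof.
move=> df dg.
rewrite (_ : (fun y => _) =
    \sum_(k < n) ((fun y => f y 0 k : K) * (fun y => g y 0 k : K))); last first.
  by apply/funext => y; rewrite /dot mxE fct_sumE; apply: eq_bigr => k _; rewrite mxE.
apply: differentiable_sum => k; apply: differentiableM; exact: differentiable_mx_entry.
Qed.

Lemma smooth_on_dot n U (f g : E -> 'rV[K]_n) : open U ->
  smooth_on U f -> smooth_on U g -> smooth_on U (fun x => dot (f x) (g x) : K).
Proof.
move=> oU sf sg k; elim: k f g sf sg => [|k IH] f g sf sg.
  move=> x Ux; apply/differentiable_continuous.
  by apply: differentiable_dot; [exact: smooth_on_diff sf Ux|exact: smooth_on_diff sg Ux].
have der x v : U x ->
    is_derive x v (fun x => dot (f x) (g x) : K) (dot ('D_v f x) (g x) + dot (f x) ('D_v g x)).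
  move=> Ux; apply: is_derive_dot; apply: is_derive_differentiable.
    exact: smooth_on_diff sf Ux.
  exact: smooth_on_diff sg Ux.
split=> [x Ux|v].
  by apply: differentiable_dot; [exact: smooth_on_diff sf Ux|exact: smooth_on_diff sg Ux].
apply: (@Ck_eq _ _ (fun x => dot ('D_v f x) (g x) + dot (f x) ('D_v g x))) => //.
  by move=> x Ux; case: (der x v Ux).
apply: CkD => //; apply: IH => //; exact: smooth_on_derive.
Qed.

Lemma smooth_on_sub (W : normedModType K) U U' (f : E -> W) :
  U' `<=` U -> smooth_on U f -> smooth_on U' f.
Proof.
move=> UU sf k; elim: k f sf => [|k IH] f sf.
  by move=> x /UU; exact: smooth_on_cont.
split=> [x /UU|v]; first exact: smooth_on_diff.
by apply: IH; exact: smooth_on_derive.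
Qed.

End SmoothAlgebra.

(** * Symmetry of second derivatives *)

Section Schwarz.
Context {K : realType} {E : normedModType K}.
Implicit Types U : set E.

Lemma is_derive_offset (f : E -> K) x v (s : K) : differentiable f (x + s *: v) ->
  is_derive s (1 : K) (fun s => f (x + s *: v)) ('D_v f (x + s *: v)).
Proof. by move=> df; apply: is_derive_curve => //; exact: is_derive_line. Qed.

(** The mean value theorem is used twice: along u for the increment of f in the direction v, then
    along v for ['D_u f]. *)
Let second_difference (f : E -> K) x u v (h : K) : 0 < h ->
  (forall s t, 0 <= s <= h -> 0 <= t <= h ->
     differentiable f (x + s *: u + t *: v) /\
     differentiable ('D_u f) (x + s *: u + t *: v)) ->
  exists s t, [/\ 0 <= s <= h, 0 <= t <= h &
    f (x + h *: u + h *: v) - f (x + h *: u) - (f (x + h *: v) - f x) =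
    h ^+ 2 * 'D_v ('D_u f) (x + s *: u + t *: v)].
Proof.
move=> h0 d.
pose P s := f (x + h *: v + s *: u) - f (x + s *: u).
have [|s /andP[s0 sh] Es] := @MVT0 _ P (fun s => 'D_u f (x + h *: v + s *: u) - 'D_u f (x + s *: u)) h h0.
  move=> s sI; apply: is_deriveB; apply: is_derive_offset.
    rewrite addrAC; apply: (d s h sI _).1; by rewrite lexx ltW.
  by rewrite -[_ + _]addr0 -(scale0r v); apply: (d s 0 sI _).1; rewrite lexx ltW.
have sI : 0 <= s <= h by rewrite !ltW.
have [|t /andP[t0 th] Et] := @MVT0 _ (fun t => 'D_u f (x + s *: u + t *: v))
    (fun t => 'D_v ('D_u f) (x + s *: u + t *: v)) h h0.
  by move=> t tI; apply: is_derive_offset; apply: (d s t sI tI).2.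
exists s, t; split; rewrite ?ltW //.
have -> : f (x + h *: u + h *: v) - f (x + h *: u) - (f (x + h *: v) - f x) = P h - P 0.
  by rewrite /P scale0r !addr0 [x + h *: v + _]addrAC.
rewrite Es; move: Et; rewrite scale0r addr0 [x + s *: u + h *: v]addrAC => ->.
by move: ('D_v _ _) => D; ring.
Qed.

Let distK_split (e X A B : K) :
  `|A - B| < e / 2 -> `|X - B| < e / 2 -> `|X - A| <= e.
Proof. by rewrite !ltr_distl ler_distl; lra. Qed.

(** The second difference is symmetric in u and v, so the two mixed derivatives take a common value
    at points arbitrarily close to x; their continuity does the rest. *)
Lemma schwarz_scalar U (f : E -> K) x u v : open U -> smooth_on U f -> U x ->
  'D_v ('D_u f) x = 'D_u ('D_v f) x.
Proof.
move=> oU sf Ux; apply/eqP; rewrite -subr_eq0; apply/eqP.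
set D := 'D_v ('D_u f) x - _.
suff h (e : K) : 0 < e -> `|D : K| <= e.
  by apply/normr0_eq0/eqP; rewrite eq_le normr_ge0 andbT; apply/ler_addgt0Pr => e e0; rewrite add0r; exact: h.
move=> e0; have e20 : 0 < e / 2 by rewrite divr_gt0.
have cuv := smooth_on_cont (smooth_on_derive v (smooth_on_derive u sf)) Ux.
have cvu := smooth_on_cont (smooth_on_derive u (smooth_on_derive v sf)) Ux.
have n1 : \forall y \near x, `|'D_v ('D_u f) x - 'D_v ('D_u f) y| < e / 2.
  by move/cvgrPdist_lt : cuv => /(_ _ e20).
have n2 : \forall y \near x, `|'D_u ('D_v f) x - 'D_u ('D_v f) y| < e / 2.
  by move/cvgrPdist_lt : cvu => /(_ _ e20).
have n3 : \forall y \near x, U y := open_nbhs_nbhs (conj oU Ux).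
have /nbhs_ballP[d /= d0 hd] : nbhs x
    (fun y => [/\ `|'D_v ('D_u f) x - 'D_v ('D_u f) y| < e / 2,
      `|'D_u ('D_v f) x - 'D_u ('D_v f) y| < e / 2 & U y]).
  by apply: filterS3 n1 n2 n3 => y ? ? ?; split.
pose c := `|u| + `|v| + 1.
have c0 : 0 < c by rewrite ltr_wpDl // addr_ge0.
(* Small enough for the whole parallelogram spanned by [h *: u] and [h *: v] at x to lie in the ball
   of radius d. *)
pose h := d / (2 * c).
have h0 : 0 < h by rewrite divr_gt0 // mulr_gt0.
have inb s t : 0 <= s <= h -> 0 <= t <= h -> ball x d (x + s *: u + t *: v).
  move=> /andP[s0 sh] /andP[t0 th].
  rewrite -ball_normE /= -addrA opprD addrA subrr sub0r normrN.
  apply: le_lt_trans (ler_normD _ _) _; rewrite !normrZ !ger0_norm //.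
  apply: (@le_lt_trans _ _ (h * (`|u| + `|v|))).
    by rewrite mulrDr lerD // ler_wpM2r.
  apply: (@lt_le_trans _ _ (h * (2 * c))); last by rewrite /h divfK // mulf_neq0 // ?lt0r_neq0.
  rewrite ltr_pM2l // /c; have := normr_ge0 u; have := normr_ge0 v; lra.
have [s [t [sI tI E1]]] : exists s t, [/\ 0 <= s <= h, 0 <= t <= h &
    f (x + h *: u + h *: v) - f (x + h *: u) - (f (x + h *: v) - f x) =
    h ^+ 2 * 'D_v ('D_u f) (x + s *: u + t *: v)].
  apply: second_difference => // s t sI tI.
  have [_ _ Uy] := hd _ (inb s t sI tI).
  by split; [exact: smooth_on_diff sf Uy|exact: smooth_on_diff (smooth_on_derive u sf) Uy].
have [t' [s' [tI' sI' E2]]] : exists s t, [/\ 0 <= s <= h, 0 <= t <= h &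
    f (x + h *: v + h *: u) - f (x + h *: v) - (f (x + h *: u) - f x) =
    h ^+ 2 * 'D_u ('D_v f) (x + s *: v + t *: u)].
  apply: second_difference => // t' s' tI' sI'.
  have := hd _ (inb s' t' sI' tI'); rewrite addrAC => -[_ _ Uy].
  by split; [exact: smooth_on_diff sf Uy|exact: smooth_on_diff (smooth_on_derive v sf) Uy].
have E3 : 'D_v ('D_u f) (x + s *: u + t *: v) = 'D_u ('D_v f) (x + s' *: u + t' *: v).
  have hn : h ^+ 2 != 0 by rewrite expf_neq0 // lt0r_neq0.
  apply: (mulfI hn); rewrite (addrAC x (s' *: u) (t' *: v)).
  apply: etrans (esym E1) (etrans _ E2); rewrite (addrAC x (h *: v) (h *: u)).
  move: (f _) (f (x + h *: u)) (f (x + h *: v)) (f x) => ? ? ? ?; ring.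
have [a1 _ _] := hd _ (inb s t sI tI); have [_ a2 _] := hd _ (inb s' t' sI' tI').
by apply: distK_split a2 _; rewrite -E3.
Qed.

Lemma derive_entry n (f : E -> 'rV[K]_n) x v j : differentiable f x ->
  'D_v (fun y => f y 0 j : K) x = 'D_v f x 0 j.
Proof.
by move=> /(is_derive_differentiable v)/is_derive_mxP/(_ 0 j)[].
Qed.

Lemma smooth_on_entry n U (f : E -> 'rV[K]_n) j : open U -> smooth_on U f ->
  smooth_on U (fun y => f y 0 j : K).
Proof.
move=> oU sf k; elim: k f sf => [|k IH] f sf.
  move=> x Ux; apply/differentiable_continuous/differentiable_mx_entry.
  exact: smooth_on_diff sf Ux.
split=> [x Ux|v].
  by apply: differentiable_mx_entry; exact: smooth_on_diff sf Ux.
apply: Ck_eq (IH _ (smooth_on_derive v sf)) => // x Ux.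
by rewrite derive_entry //; exact: smooth_on_diff sf Ux.
Qed.

Lemma schwarz n U (f : E -> 'rV[K]_n) x u v : open U -> smooth_on U f -> U x ->
  'D_v ('D_u f) x = 'D_u ('D_v f) x.
Proof.
move=> oU sf Ux; apply/rowP => j.
have E1 a b : 'D_b ('D_a f) x 0 j = 'D_b ('D_a (fun y => f y 0 j : K)) x.
  rewrite -derive_entry; last exact: smooth_on_diff (smooth_on_derive a sf) Ux.
  apply: near_eq_derive; apply: filterS (open_nbhs_nbhs (conj oU Ux)) => y Uy.
  by rewrite derive_entry //; exact: smooth_on_diff sf Uy.
have S := @schwarz_scalar U (fun y => f y 0 j : K) x u v oU (smooth_on_entry j oU sf) Ux.
exact: etrans (E1 u v) (etrans S (esym (E1 v u))).
Qed.

End Schwarz.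

(** * Linear algebra of the scalar product, hyperplanes and tangential frames *)

Section DotAlgebra.
Context {K : realType} {d : nat}.
Implicit Types u v w : 'rV[K]_d.

Lemma dotE u v : dot u v = \sum_i u 0 i * v 0 i.
Proof. by rewrite /dot mxE; apply: eq_bigr => i _; rewrite mxE. Qed.

Lemma dotC u v : dot u v = dot v u.
Proof. by rewrite !dotE; apply: eq_bigr => i _; rewrite mulrC. Qed.

Lemma dotDl u v w : dot (u + v) w = dot u w + dot v w.
Proof. by rewrite /dot mulmxDl mxE. Qed.

Lemma dotDr u v w : dot u (v + w) = dot u v + dot u w.
Proof. by rewrite dotC dotDl !(dotC u). Qed.

Lemma dotZl a u v : dot (a *: u) v = a * dot u v.
Proof. by rewrite /dot -scalemxAl mxE. Qed.

Lemma dotZr a u v : dot u (a *: v) = a * dot u v.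
Proof. by rewrite dotC dotZl dotC. Qed.

Lemma dotNl u v : dot (- u) v = - dot u v.
Proof. by rewrite /dot mulNmx mxE. Qed.

Lemma dotNr u v : dot u (- v) = - dot u v.
Proof. by rewrite dotC dotNl dotC. Qed.

Lemma dotBl u v w : dot (u - v) w = dot u w - dot v w.
Proof. by rewrite dotDl dotNl. Qed.

Lemma dotBr u v w : dot u (v - w) = dot u v - dot u w.
Proof. by rewrite dotDr dotNr. Qed.

Lemma dot0l u : dot 0 u = 0.
Proof. by rewrite /dot mul0mx mxE. Qed.

Lemma dot0r u : dot u 0 = 0.
Proof. by rewrite dotC dot0l. Qed.

Lemma dot_suml I (r : seq I) (f : I -> 'rV[K]_d) v :
  dot (\sum_(i <- r) f i) v = \sum_(i <- r) dot (f i) v.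
Proof. by rewrite /dot mulmx_suml summxE. Qed.

Lemma dot_sumr I (r : seq I) (f : I -> 'rV[K]_d) v :
  dot v (\sum_(i <- r) f i) = \sum_(i <- r) dot v (f i).
Proof. by rewrite dotC dot_suml; apply: eq_bigr => i _; rewrite dotC. Qed.

Lemma dot_ge0 u : 0 <= dot u u.
Proof. by rewrite dotE; apply: sumr_ge0 => i _; rewrite -expr2 sqr_ge0. Qed.

Lemma dot_eq0 u : dot u u = 0 -> u = 0.
Proof.
rewrite dotE => /eqP; rewrite psumr_eq0 => [/allP h|i _]; last by rewrite -expr2 sqr_ge0.
apply/rowP => i; rewrite mxE; apply/eqP.
by have := h i (mem_index_enum i); rewrite /= mulf_eq0 orbb.
Qed.

Lemma dot_mulmx u v (A : 'M[K]_d) : dot u (v *m A) = dot (u *m A^T) v.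
Proof. by rewrite /dot trmx_mul mulmxA. Qed.

Lemma mulmx_trE u v : u *m v^T = (dot u v)%:M.
Proof. by rewrite [LHS]mx11_scalar. Qed.

Lemma mxtrace_tr_mul m (T Y : 'M[K]_(m, d)) :
  \tr (T^T *m Y) = \sum_i dot (row i Y) (row i T).
Proof.
rewrite mxtrace_mulC /mxtrace; apply: eq_bigr => i _.
by rewrite dotE mxE; apply: eq_bigr => j _; rewrite !mxE.
Qed.

Lemma mul_rVE (v u w : 'rV[K]_d) : v *m (u^T *m w) = dot v u *: w.
Proof. by rewrite mulmxA mulmx_trE mul_scalar_mx. Qed.

End DotAlgebra.

Section Hyperplane.
Context {K : realType} {n : nat}.
Variables (P : 'M[K]_(n, n.+1)) (nu : 'rV[K]_n.+1).
Hypotheses (nu1 : dot nu nu = 1) (Pnu : forall v, dot (v *m P) nu = 0)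
  (Pinj : forall v : 'rV_n, v *m P = 0 -> v = 0).

(** A dimension count: the row space of P lies in the orthogonal complement of nu, and both have
    rank n. *)
Lemma rowspace_normal u : dot u nu = 0 -> exists v, u = v *m P.
Proof.
move=> unu; apply/submxP.
have Pk : (P <= kermx nu^T)%MS.
  apply/row_subP => i; apply/sub_kermxP.
  by rewrite mulmx_trE rowE Pnu raddf0.
have rP : \rank P = n by apply/eqP; exact: inj_row_free Pinj.
have nun0 : nu != 0 by apply/eqP => e; move: nu1; rewrite e dot0l => /eqP; rewrite eq_sym oner_eq0.
have rk : \rank (kermx nu^T) = n.
  by rewrite mxrank_ker mxrank_tr rank_rV nun0 subn1.
have := mxrank_leqif_sup Pk; rewrite rP rk => -[_ /esym].
rewrite eqxx => kP; apply: submx_trans kP; apply/sub_kermxP.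
by rewrite mulmx_trE unu raddf0.
Qed.

Definition tproj : 'M[K]_n.+1 := 1%:M - nu^T *m nu.

Lemma mul_tproj u : u *m tproj = u - dot u nu *: nu.
Proof. by rewrite mulmxBr mulmx1 mul_rVE. Qed.

Lemma dot_tproj u : dot (u *m tproj) nu = 0.
Proof. by rewrite mul_tproj dotBl dotZl nu1 mulr1 subrr. Qed.

(** The n+1 rows of [tproj] thus form a Parseval frame of the hyperplane: redundant, but giving the
    same traces as an orthonormal basis. *)
Lemma tproj_gram : tproj^T *m tproj = tproj.
Proof.
have -> : tproj^T = tproj by rewrite [LHS]linearB /= trmx_mul trmxK trmx1.
by rewrite {1}/tproj mulmxBl mul1mx -mulmxA mul_tproj nu1 scale1r subrr mulmx0 subr0.
Qed.

Lemma tangent_normal_eq0 k (X : 'M[K]_(n.+1, k)) : P *m X = 0 -> nu *m X = 0 -> X = 0.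
Proof.
move=> PX nX; apply/row_matrixP => i; rewrite row0 rowE.
set u := delta_mx _ _; have [v Ev] := rowspace_normal (dot_tproj u).
have -> : u = v *m P + dot u nu *: nu by rewrite -Ev mul_tproj subrK.
by rewrite mulmxDl -mulmxA PX mulmx0 -scalemxAl nX scaler0 addr0.
Qed.

Lemma orthogonal_eq0 w : (forall v, dot w (v *m P) = 0) -> dot w nu = 0 -> w = 0.
Proof.
move=> wP wn; apply: dot_eq0.
have [v {1}->] := rowspace_normal wn; by rewrite dotC wP.
Qed.

Lemma normal_colinear w : (forall v, dot w (v *m P) = 0) -> w = dot w nu *: nu.
Proof.
move=> wP; apply/subr0_eq; apply: orthogonal_eq0 => [v|].
  by rewrite dotBl wP dotZl (dotC nu) Pnu mulr0 subrr.
by rewrite dotBl dotZl nu1 mulr1 subrr.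
Qed.

Lemma tangent_frame m (T : 'M[K]_(m, n.+1)) : (forall i, dot (row i T) nu = 0) ->
  exists a : 'I_m -> 'rV[K]_n, forall i, a i *m P = row i T.
Proof.
move=> Tn; have h i : exists v, v *m P = row i T.
  by have [v ->] := rowspace_normal (Tn i); exists v.
by exists (fun i => projT1 (cid (h i))) => i; case: cid.
Qed.

Lemma shape_operator_unique (A B : 'M[K]_n.+1) :
  P *m A = P *m B -> nu *m A = 0 -> nu *m B = 0 -> A = B.
Proof.
move=> PAB nA nB; apply/subr0_eq/tangent_normal_eq0; rewrite mulmxBr.
  by rewrite PAB subrr.
by rewrite nA nB subrr.
Qed.

(** Symmetry on tangent vectors extends to the ambient space because A kills nu and takes tangential
    values. *)
Lemma shape_operator_sym (A : 'M[K]_n.+1) : nu *m A = 0 ->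
  (forall v, dot (v *m P *m A) nu = 0) ->
  (forall v w, dot (v *m P *m A) (w *m P) = dot (w *m P *m A) (v *m P)) ->
  A^T = A.
Proof.
move=> nA An Asym.
have AnT : A *m nu^T = 0.
  apply: tangent_normal_eq0; last by rewrite mulmxA nA mul0mx.
  apply/row_matrixP => i; rewrite row0 rowE !mulmxA mulmx_trE An raddf0 //.
apply/esym; apply: shape_operator_unique => //.
- apply/row_matrixP => i; rewrite !row_mul !rowE; set v := delta_mx _ _.
  apply/subr0_eq; apply: orthogonal_eq0 => [w|].
    by rewrite dotBl -[dot (_ *m A^T) _]dot_mulmx Asym [X in _ - X]dotC subrr.
  by rewrite dotBl -[dot (_ *m A^T) _]dot_mulmx nA dot0r subr0 An.
- by rewrite -[nu *m _]trmxK trmx_mul trmxK AnT trmx0.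
Qed.

End Hyperplane.

Section FrameAlgebra.
Context {K : realType} {n : nat}.
Variables (nu : 'rV[K]_n) (A : 'M[K]_n).
Hypotheses (nuA : nu *m A = 0) (Asym : A^T = A).
Variables (m : nat) (T : 'M[K]_(m, n)).
Hypothesis TT : T^T *m T = 1%:M - nu^T *m nu.

Let tproj_shape : (1%:M - nu^T *m nu) *m A = A.
Proof. by rewrite mulmxBl mul1mx -mulmxA nuA mulmx0 subr0. Qed.

Lemma frame_trace : \sum_i dot (row i T *m A) (row i T) = \tr A.
Proof.
rewrite -[in RHS]tproj_shape -TT -mulmxA mxtrace_tr_mul.
by apply: eq_bigr => i _; rewrite row_mul.
Qed.

Lemma frame_trace2 : \sum_i dot (row i T *m A) (row i T *m A) =
  \sum_i \sum_j A i j ^+ 2.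
Proof.
transitivity (\tr (A *m A^T)); last first.
  by apply: eq_bigr => i _; rewrite mxE; apply: eq_bigr => j _; rewrite mxE expr2.
rewrite Asym -[X in X *m _]tproj_shape -TT -!mulmxA mxtrace_tr_mul.
by apply: eq_bigr => i _; rewrite dot_mulmx Asym row_mul mulmxA.
Qed.

(** The left side is what the product rule gives for tr (T^T Y) and for B = T^T X + nu^T N; the zero
    products come from the constant factors T^T and nu^T. *)
Lemma frame_trace_derive (X X0 Y Y0 : 'M[K]_(m, n)) (u u0 : 'rV[K]_n) :
  \tr (0 *m Y0 + T^T *m Y) -
    \tr ((0 *m X0 + T^T *m X + (0 *m u0 + nu^T *m u)) *m A) =
  \sum_i (dot (row i Y) (row i T) - dot (row i X) (row i T *m A)).
Proof.
rewrite !mul0mx !add0r mulmxDl mxtraceD -!mulmxA !(mxtrace_tr_mul T).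
rewrite [X in _ - (_ + X)]mxtrace_mulC -mulmxA.
rewrite -{2}Asym -trmx_mul nuA trmx0 mulmx0 mxtrace0.
rewrite addr0 -sumrB; apply: eq_bigr => i _; rewrite row_mul; congr (_ - _).
by rewrite dot_mulmx Asym.
Qed.

End FrameAlgebra.

Local Opaque derive.

(** * Structure and evolution equations on a smooth piece of the flow *)

Section Patch.
Context {K : realType} {n : nat}.
Local Notation E := ('rV[K]_n * K)%type.
Local Notation V := 'rV[K]_n.+1.
Local Notation sp v := ((v, 0) : E).
Local Notation dt := ((0, 1) : E).

(** The equations hold on an open set of space-time, hence on both sides in time. H is smooth, but A
    is constrained only pointwise. *)
Record mcf_patch (U : set E) (F N : E -> V) (H : E -> K) (A : E -> 'M[K]_n.+1)
    : Prop := McfPatch {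
  patch_open : open U;
  patch_F : smooth_on U F;
  patch_N : smooth_on U N;
  patch_H : smooth_on U H;
  patch_unit : forall z, U z -> dot (N z) (N z) = 1;
  patch_normal : forall z v, U z -> dot (N z) ('D_(sp v) F z) = 0;
  patch_immersion : forall z v, U z -> 'D_(sp v) F z = 0 -> v = 0;
  patch_flow : forall z, U z -> 'D_dt F z = - H z *: N z;
  patch_shape : forall z v, U z -> 'D_(sp v) F z *m A z = 'D_(sp v) N z;
  patch_shape_normal : forall z, U z -> N z *m A z = 0;
  patch_trace : forall z, U z -> H z = \tr (A z) }.

(** Takes the place of regularity of A when its trace is differentiated. *)
Definition shape_bounded (U : set E) (A : E -> 'M[K]_n.+1) : Prop :=
  exists C, forall z, U z -> forall i j, `|A z i j| <= C.

Definition tframe (F : E -> V) z : 'M[K]_(n, n.+1) :=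
  \matrix_i 'D_(sp (delta_mx 0 i)) F z.

Lemma mul_tframe (F : E -> V) z (v : 'rV_n) : differentiable F z ->
  v *m tframe F z = 'D_(sp v) F z.
Proof.
move=> dF; rewrite mulmx_sum_row.
have -> : sp v = \sum_i v 0 i *: sp (delta_mx 0 i).
  rewrite [v in LHS]row_sum_delta.
  elim/big_rec2 : _ => // i a b _ <-.
  by congr pair; rewrite /= scaler0 add0r.
rewrite derive_suml //; apply: eq_bigr => i _.
by rewrite rowK deriveZl.
Qed.

Lemma is_derive_vanish (W : normedModType K) (U : set E) (f : E -> W) z xi df :
  open U -> U z -> (forall y, U y -> f y = 0) -> is_derive z xi f df -> df = 0.
Proof.
move=> oU Uz f0 hf.
have nf : \forall y \near z, f y = (cst 0 : E -> W) y.
  exact: filterS f0 (open_nbhs_nbhs (conj oU Uz)).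
exact: is_derive_uniq (near_eq_is_derive nf hf) (is_derive_cst _ _ _).
Qed.

Lemma is_derive_scale (h : E -> K) (g : E -> V) z xi dh dg :
  is_derive z xi h dh -> is_derive z xi g dg ->
  is_derive z xi (fun y => h y *: g y) (dh *: g z + h z *: dg).
Proof.
move=> hh /is_derive_mxP hg; apply/is_derive_mxP => i j.
rewrite (_ : (fun y => _) = h * (fun y => g y i j : K)); last first.
  by apply/funext => y; rewrite mxE.
apply: is_derive_eq (is_deriveM hh (hg i j)) _.
by rewrite !mxE /GRing.scale /= addrC [g z i j * _]mulrC.
Qed.

Lemma continuous_mul_bounded (k a : K -> K) (C : K) : {for 0, continuous k} ->
  k 0 = 0 -> (\forall s \near 0, `|a s| <= C) ->
  (fun s => k s * a s) @ 0 --> (0 : K).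
Proof.
move=> ck k0 aC; apply/cvgrPdist_lt => e e0.
have C1 : 0 < `|C| + 1 by rewrite ltr_wpDl.
have nk : \forall s \near 0, `|k 0 - k s| < e / (`|C| + 1).
  by move/cvgrPdist_lt : ck; apply; rewrite divr_gt0.
apply: filterS2 nk aC => s; rewrite k0 !sub0r !normrN => ks as_.
rewrite normrM; apply: (@le_lt_trans _ _ (`|k s| * (`|C| + 1))).
  by rewrite ler_wpM2l // (le_trans as_) // (le_trans (ler_norm _)) // lerDl.
by rewrite -ltr_pdivlMr.
Qed.

Lemma is_derive_mul_vanish (k a : K -> K) (dk : K) : k 0 = 0 ->
  is_derive (0 : K) (1 : K) k dk -> {for 0, continuous a} ->
  is_derive (0 : K) (1 : K) (fun s => k s * a s) (dk * a 0).
Proof.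
move=> k0 [dd <-] ca.
have h : (fun h : K => h^-1 *: (((fun s => k s * a s) \o shift 0) (h *: (1 : K)) -
   k 0 * a 0)) @ 0^' --> 'D_1 k 0 * a 0.
  have c1 : (fun h : K => h^-1 *: ((k \o shift 0) (h *: (1 : K)) - k 0)) @ 0^' -->
      'D_1 k 0 by exact: dd.
  have c2 : a @ 0^' --> a 0 by exact: cvg_within_filter.
  have c3 : (fun h : K => (h^-1 *: ((k \o shift 0) (h *: (1 : K)) - k 0)) * a h) @ 0^' -->
    'D_1 k 0 * a 0 by exact: cvgM c1 c2.
  apply: cvg_trans c3; apply: near_eq_cvg; near=> s.
  by rewrite fctE /= !addr0 [s *: 1]mulr1 k0 mul0r !subr0 /GRing.scale /= mulrA.
apply: DeriveDef; first by apply/cvg_ex; exists ('D_1 k 0 * a 0).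
exact: cvg_lim h.
Unshelve. all: by end_near. Qed.

(** Differentiates tr A with A only bounded. Write B A = Y as A = Y - (B - 1) A. Since B is 1 at 0,
    the correction tends to 0, so A is continuous at 0; then (B - 1) A, a factor vanishing at 0
    times a continuous one, has derivative dB A(0). *)
Lemma mxtrace_derive d (h : K -> K) (A B Y : K -> 'M[K]_d) dh dB dY (C : K) :
  (\forall s \near 0, B s *m A s = Y s /\ h s = \tr (A s)) ->
  (\forall s \near 0, forall i j, `|A s i j| <= C) -> B 0 = 1%:M ->
  is_derive (0 : K) (1 : K) h dh -> is_derive (0 : K) (1 : K) B dB ->
  is_derive (0 : K) (1 : K) Y dY -> dh = \tr dY - \tr (dB *m A 0).
Proof.
move=> nBA nA B0 dh' dB' dY'.
pose k i j s := B s i j - (i == j)%:R.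
have k0 i j : k i j 0 = 0 by rewrite /k B0 mxE subrr.
have dk i j : is_derive (0 : K) (1 : K) (k i j) (dB i j).
  rewrite -[dB i j]subr0.
  apply: (@is_deriveB _ _ _ (fun s => B s i j) (cst ((i == j)%:R : K))).
  by have /is_derive_mxP/(_ i j) := dB'.
have ck i j : {for 0, continuous (k i j)}.
  by apply/differentiable_continuous/derivable1_diffP; case: (dk i j).
have AE : \forall s \near 0, forall i j,
    A s i j = Y s i j - \sum_l k i l s * A s l j.
  apply: filterS nBA => s [<- _] i j; rewrite mxE -sumrB (bigD1 i) //= big1 => [|l li].
    by rewrite /k eqxx addr0 /=; ring.
  by rewrite /k eq_sym (negPf li) /=; ring.
have cA i j : {for 0, continuous (fun s => A s i j)}.
  have A0 := nbhs_singleton AE.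
  change ((fun s => A s i j) @ 0 --> A 0 i j).
  have cY : (fun s => Y s i j) @ 0 --> Y 0 i j.
    apply/differentiable_continuous/derivable1_diffP.
    by have /is_derive_mxP/(_ i j)[] := dY'.
  have cS : (fun s => \sum_l k i l s * A s l j) @ 0 --> (\sum_(l < d) 0 : K).
    apply: (cvg_big add_continuous) => l _.
    apply: (@continuous_mul_bounded _ _ C) => //.
    by apply: filterS nA => s; apply.
  have -> : A 0 i j = Y 0 i j - \sum_(l < d) 0.
    by rewrite A0; congr (_ - _); apply: eq_bigr => l _; rewrite k0 mul0r.
  have c3 : (fun s => Y s i j - \sum_l k i l s * A s l j) @ 0 -->
    (Y 0 i j - \sum_(l < d) 0) by exact: cvgB cY cS.
  apply: cvg_trans c3; apply: near_eq_cvg.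
  by apply: filterS AE => s ->.
pose q s := \sum_i \sum_l (k i l s * A s l i).
have dq : is_derive (0 : K) (1 : K) q (\tr (dB *m A 0)).
  have -> : q = \sum_i \sum_l (fun s => k i l s * A s l i).
    by apply/funext => s; rewrite /q fct_sumE; apply: eq_bigr => i _; rewrite fct_sumE.
  have -> : \tr (dB *m A 0) = \sum_i \sum_l dB i l * A 0 l i.
    by apply: eq_bigr => i _; rewrite mxE.
  by apply: is_derive_sum => i; apply: is_derive_sum => l; exact: is_derive_mul_vanish.
have hE : \forall s \near 0, (fun s => \tr (Y s)) s - q s = h s.
  apply: filterS2 nBA AE => s [_ ->] AEs.
  by rewrite /q /mxtrace -sumrB; apply: eq_bigr => i _; rewrite AEs.
have h2 := near_eq_is_derive hE (is_deriveB (is_derive_mxtrace dY') dq).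
exact: is_derive_uniq dh' h2.
Qed.

Section Evolution.
Variables (U : set E) (F N : E -> V) (H : E -> K) (A : E -> 'M[K]_n.+1).
Hypothesis hP : mcf_patch U F N H A.
Let oU := patch_open hP.
Let sF := patch_F hP.
Let sN := patch_N hP.
Let sH := patch_H hP.
Implicit Types (u v w : 'rV[K]_n) (xi : E).

Let dF z (Uz : U z) : differentiable F z := smooth_on_diff sF Uz.
Let dN z (Uz : U z) : differentiable N z := smooth_on_diff sN Uz.
Let dH z (Uz : U z) : differentiable H z := smooth_on_diff sH Uz.
Let ddF z xi (Uz : U z) : differentiable ('D_xi F) z :=
  smooth_on_diff (smooth_on_derive xi sF) Uz.
Let ddN z xi (Uz : U z) : differentiable ('D_xi N) z :=
  smooth_on_diff (smooth_on_derive xi sN) Uz.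
Let ddH z xi (Uz : U z) : differentiable ('D_xi H) z :=
  smooth_on_diff (smooth_on_derive xi sH) Uz.

Lemma patch_normal_derive z xi : U z -> dot (N z) ('D_xi N z) = 0.
Proof.
move=> Uz.
have hN := is_derive_differentiable xi (dN Uz).
have h := is_deriveB (is_derive_dot hN hN) (is_derive_cst (1 : K) z xi).
have : dot ('D_xi N z) (N z) + dot (N z) ('D_xi N z) - 0 = 0.
  apply: is_derive_vanish oU Uz _ h => y Uy.
  by rewrite !fctE (patch_unit hP) // subrr.
rewrite subr0 dotC -mulr2n => /eqP; rewrite mulrn_eq0 => /eqP //.
Qed.

Lemma patch_normal_derive2 z xi v : U z ->
  dot ('D_xi N z) ('D_(sp v) F z) + dot (N z) ('D_xi ('D_(sp v) F) z) = 0.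
Proof.
move=> Uz; have hN := is_derive_differentiable xi (dN Uz).
have hF := is_derive_differentiable xi (ddF (sp v) Uz).
apply: is_derive_vanish oU Uz _ (is_derive_dot hN hF) => y Uy.
exact: (patch_normal hP).
Qed.

Lemma patch_normal_derive3 z xi eta : U z ->
  dot ('D_xi N z) ('D_eta N z) + dot (N z) ('D_xi ('D_eta N) z) = 0.
Proof.
move=> Uz; have hN := is_derive_differentiable xi (dN Uz).
have hF := is_derive_differentiable xi (ddN eta Uz).
apply: is_derive_vanish oU Uz _ (is_derive_dot hN hF) => y Uy.
exact: patch_normal_derive.
Qed.

Lemma patch_schwarzF z xi eta : U z -> 'D_xi ('D_eta F) z = 'D_eta ('D_xi F) z.
Proof. by move=> Uz; rewrite (schwarz _ _ oU sF Uz). Qed.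

Lemma patch_schwarzN z xi eta : U z -> 'D_xi ('D_eta N) z = 'D_eta ('D_xi N) z.
Proof. by move=> Uz; rewrite (schwarz _ _ oU sN Uz). Qed.

Lemma patch_ff_sym z u v : U z ->
  dot ('D_(sp u) N z) ('D_(sp v) F z) = dot ('D_(sp v) N z) ('D_(sp u) F z).
Proof.
move=> Uz; have h1 := patch_normal_derive2 (sp u) v Uz.
have h2 := patch_normal_derive2 (sp v) u Uz.
apply: (addIr (dot (N z) ('D_(sp u) ('D_(sp v) F) z))).
exact: etrans h1 (esym (etrans (congr1 (fun x => _ + dot (N z) x)
  (patch_schwarzF (sp u) (sp v) Uz)) h2)).
Qed.

Lemma patch_ff_dot z u v : U z ->
  dot (N z) ('D_(sp u) ('D_(sp v) F) z) = - dot ('D_(sp u) N z) ('D_(sp v) F z).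
Proof.
by move=> Uz; apply/eqP; rewrite -addr_eq0 addrC patch_normal_derive2.
Qed.

(** The derivative along xi of the symmetry of the second fundamental form; for spatial xi it plays
    the role of the Codazzi equation. *)
Lemma patch_codazzi z xi u v : U z ->
  dot ('D_xi ('D_(sp u) N) z) ('D_(sp v) F z) +
  dot ('D_(sp u) N z) ('D_xi ('D_(sp v) F) z) =
  dot ('D_xi ('D_(sp v) N) z) ('D_(sp u) F z) +
  dot ('D_(sp v) N z) ('D_xi ('D_(sp u) F) z).
Proof.
move=> Uz; apply/subr0_eq.
have h a b := is_derive_dot (is_derive_differentiable xi (ddN (sp a) Uz))
  (is_derive_differentiable xi (ddF (sp b) Uz)).
apply: is_derive_vanish oU Uz _ (is_deriveB (h u v) (h v u)) => y Uy.
exact: etrans (congr1 (fun t => t - _) (patch_ff_sym u v Uy)) (subrr _).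
Qed.

Lemma patch_flow_derive z xi : U z ->
  'D_xi ('D_dt F) z = - ('D_xi H z *: N z + H z *: 'D_xi N z).
Proof.
move=> Uz; apply/subr0_eq; rewrite opprK.
have h1 := is_derive_differentiable xi (ddF dt Uz).
have h2 := is_derive_scale (is_derive_differentiable xi (dH Uz))
  (is_derive_differentiable xi (dN Uz)).
apply: is_derive_vanish oU Uz _ (is_deriveD h1 h2) => y Uy.
by rewrite !fctE (patch_flow hP) // scaleNr addNr.
Qed.

(** The normal moves by the gradient of H: differentiate <N, D_v F> = 0 in time, exchange the
    derivatives of F and insert the flow equation. *)
Lemma patch_normal_evolution z v : U z ->
  dot ('D_dt N z) ('D_(sp v) F z) = 'D_(sp v) H z.
Proof.
move=> Uz; have := patch_normal_derive2 dt v Uz.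
rewrite patch_schwarzF // patch_flow_derive // dotNr dotDr !dotZr.
rewrite (patch_unit hP) // patch_normal_derive // mulr0 addr0 mulr1.
by move/subr0_eq.
Qed.

Lemma patch_normal_evolution2 z u v : U z ->
  dot ('D_(sp u) ('D_dt N) z) ('D_(sp v) F z) +
  dot ('D_dt N z) ('D_(sp u) ('D_(sp v) F) z) = 'D_(sp u) ('D_(sp v) H) z.
Proof.
move=> Uz; apply/subr0_eq.
have h1 := is_derive_dot (is_derive_differentiable (sp u) (ddN dt Uz))
  (is_derive_differentiable (sp u) (ddF (sp v) Uz)).
have h2 := is_derive_differentiable (sp u) (ddH (sp v) Uz).
apply: is_derive_vanish oU Uz _ (is_deriveB h1 h2) => y Uy.
by rewrite !fctE patch_normal_evolution // subrr.
Qed.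

Section AtPoint.
Variable z : E.
Hypothesis Uz : U z.
Let P := tframe F z.
Let nu := N z.

Let PE v : v *m P = 'D_(sp v) F z. Proof. exact: mul_tframe (dF Uz). Qed.
Let nu1 : dot nu nu = 1. Proof. exact: (patch_unit hP). Qed.
Let Pnu v : dot (v *m P) nu = 0.
Proof. by rewrite PE dotC; exact: (patch_normal hP). Qed.
Let Pinj v : v *m P = 0 -> v = 0.
Proof. by rewrite PE; exact: (patch_immersion hP). Qed.

Lemma patch_shape_sym : (A z)^T = A z.
Proof.
have PA v : v *m P *m A z = 'D_(sp v) N z by rewrite PE (patch_shape hP).
apply: (shape_operator_sym nu1 Pnu Pinj) => [|v|v w].
- exact: (patch_shape_normal hP).
- by rewrite PA dotC patch_normal_derive.
- by rewrite !PA !PE; exact: patch_ff_sym.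
Qed.

(** H = tr A is expressed by second derivatives of N and F alone, without differentiating A. The
    coordinate directions [a i] stay fixed while the point moves along xi. *)
Lemma patch_trace_derive m (T : 'M[K]_(m, n.+1)) (a : 'I_m -> 'rV[K]_n) xi :
  shape_bounded U A -> T^T *m T = tproj nu -> (forall i, 'D_(sp (a i)) F z = row i T) ->
  'D_xi H z = \sum_i (dot ('D_xi ('D_(sp (a i)) N) z) (row i T) -
    dot ('D_xi ('D_(sp (a i)) F) z) ('D_(sp (a i)) N z)).
Proof.
move=> [C hC] TT aT.
pose c s : E := z + s *: xi.
have c0 : c 0 = z by rewrite /c scale0r addr0.
have dc (W : normedModType K) (f : E -> W) : differentiable f z ->
    is_derive (0 : K) (1 : K) (fun s => f (c s)) ('D_xi f z).
  rewrite -[in differentiable _ _]c0 -[in 'D_xi _ _]c0 => df.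
  by apply: is_derive_curve => //; exact: is_derive_line.
have nU : \forall s \near 0, U (c s).
  by apply: (@continuous_line _ _ z xi 0); rewrite -/(c 0) c0; exact: open_nbhs_nbhs.
pose X s := \matrix_i 'D_(sp (a i)) F (c s).
pose Y s := \matrix_i 'D_(sp (a i)) N (c s).
(* At s = 0 this is the tangential plus the normal projection, hence the identity; the normal term
   drops out of [B s *m A (c s)] because A kills N. *)
pose B s := T^T *m X s + nu^T *m N (c s).
have X0 : X 0 = T by apply/row_matrixP => i; rewrite rowK c0 aT.
have BA : \forall s \near 0, B s *m A (c s) = T^T *m Y s /\ H (c s) = \tr (A (c s)).
  apply: filterS nU => s Us; split; last exact: (patch_trace hP).
  rewrite mulmxDl -!mulmxA (patch_shape_normal hP) // mulmx0 addr0; congr (_ *m _).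
  by apply/row_matrixP => i; rewrite row_mul !rowK (patch_shape hP).
have nA : \forall s \near 0, forall i j, `|A (c s) i j| <= C.
  by apply: filterS nU => s; exact: hC.
have B0 : B 0 = 1%:M by rewrite /B X0 TT c0 subrK.
have hT := is_derive_cst T^T (0 : K) (1 : K).
have hnu := is_derive_cst nu^T (0 : K) (1 : K).
have dX : is_derive (0 : K) (1 : K) X (\matrix_i 'D_xi ('D_(sp (a i)) F) z).
  by apply: is_derive_row => i; exact: dc (ddF (sp (a i)) Uz).
have dY : is_derive (0 : K) (1 : K) Y (\matrix_i 'D_xi ('D_(sp (a i)) N) z).
  by apply: is_derive_row => i; exact: dc (ddN (sp (a i)) Uz).
have dB := is_deriveD (is_derive_mulmx hT dX) (is_derive_mulmx hnu (dc _ _ (dN Uz))).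
have dTY := is_derive_mulmx hT dY.
apply: etrans (mxtrace_derive BA nA B0 (dc _ _ (dH Uz)) dB dTY) _.
rewrite c0; apply: etrans (frame_trace_derive (patch_shape_normal hP Uz)
  patch_shape_sym T _ (X 0) _ (Y 0) _ (N z)) _.
apply: eq_bigr => i _; apply: (f_equal2 (fun x y : K => x - y)).
  exact: (f_equal2 dot (rowK _ _) (erefl (row i T))).
apply: (f_equal2 dot (rowK _ _)).
exact: etrans (congr1 (mulmx^~ (A z)) (esym (aT i))) (patch_shape hP (a i) Uz).
Qed.

(** [b i] cancels the tangential part of the acceleration, so the curve with velocity [a i] and
    acceleration [b i] is geodesic at z to second order. *)
Lemma patch_normal_frame m (a : 'I_m -> 'rV[K]_n) :
  exists b : 'I_m -> 'rV[K]_n, forall i,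
    'D_(sp (a i)) ('D_(sp (a i)) F) z + 'D_(sp (b i)) F z =
    dot (N z) ('D_(sp (a i)) ('D_(sp (a i)) F) z) *: N z.
Proof.
have h i : exists b, 'D_(sp (a i)) ('D_(sp (a i)) F) z + 'D_(sp b) F z =
    dot (N z) ('D_(sp (a i)) ('D_(sp (a i)) F) z) *: N z.
  set x := 'D_(sp (a i)) _ z; rewrite -/nu.
  have [|v Ev] := rowspace_normal nu1 Pnu Pinj (u := dot nu x *: nu - x).
    by rewrite dotBl dotZl nu1 mulr1 dotC subrr.
  by exists v; rewrite -PE -Ev addrC subrK.
by exists (fun i => projT1 (cid (h i))) => i; case: cid.
Qed.

Section Frame.
Variables (m : nat) (T : 'M[K]_(m, n.+1)) (a b : 'I_m -> 'rV[K]_n).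
Hypotheses (TT : T^T *m T = tproj nu)
  (aT : forall i, 'D_(sp (a i)) F z = row i T)
  (hb : forall i, 'D_(sp (a i)) ('D_(sp (a i)) F) z + 'D_(sp (b i)) F z =
    dot (N z) ('D_(sp (a i)) ('D_(sp (a i)) F) z) *: N z).

Let aTN i : 'D_(sp (a i)) N z = row i T *m A z.
Proof. by rewrite -(patch_shape hP (a i) Uz) (aT i). Qed.

(** Under [TT], [aT] and [hb] this is the Laplace-Beltrami operator of the time slice at z; the
    [b i] account for the Christoffel terms. *)
Definition frame_laplacian (W : normedModType K) (f : E -> W) : W :=
  \sum_i ('D_(sp (a i)) ('D_(sp (a i)) f) z + 'D_(sp (b i)) f z).

(** Each summand is - A(T_i, T_i) N, so the Laplacian of the position is the mean curvature vector -
    H N. *)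
Lemma patch_laplacianF : frame_laplacian F = 'D_dt F z.
Proof.
have e i : 'D_(sp (a i)) ('D_(sp (a i)) F) z + 'D_(sp (b i)) F z =
    (- dot (row i T *m A z) (row i T)) *: N z.
  apply: etrans (hb i) (congr1 ( *:%R^~ (N z)) _).
  apply: etrans (patch_ff_dot (a i) (a i) Uz) _.
  by congr (- dot _ _); [exact: aTN|exact: aT].
apply: etrans (eq_bigr _ (fun i _ => e i)) _.
rewrite -scaler_suml sumrN (frame_trace (patch_shape_normal hP Uz) TT).
by rewrite -(patch_trace hP Uz) (patch_flow hP).
Qed.

Let normal_orth i v :
  dot ('D_(sp v) N z) ('D_(sp (a i)) ('D_(sp (a i)) F) z) +
  dot ('D_(sp v) N z) ('D_(sp (b i)) F z) = 0.
Proof.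
rewrite -dotDr; apply: etrans (congr1 (dot _) (hb i)) _.
by rewrite dotZr (etrans (dotC _ _) (patch_normal_derive _ Uz)) mulr0.
Qed.

Let normal_orth_dt i :
  dot ('D_dt N z) ('D_(sp (a i)) ('D_(sp (a i)) F) z) +
  dot ('D_dt N z) ('D_(sp (b i)) F z) = 0.
Proof.
rewrite -dotDr; apply: etrans (congr1 (dot _) (hb i)) _.
by rewrite dotZr (etrans (dotC _ _) (patch_normal_derive _ Uz)) mulr0.
Qed.

(** Tested against tangent vectors, the Laplacian of N becomes grad H by the Codazzi equation and
    cancels ['D_dt N]; the normal component comes from differentiating <N, N> = 1 twice. *)
Lemma patch_laplacianN : shape_bounded U A ->
  frame_laplacian N - 'D_dt N z = - (\sum_i \sum_j A z i j ^+ 2) *: N z.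
Proof.
move=> hB; apply/subr0_eq; apply: (orthogonal_eq0 nu1 Pnu Pinj) => [v|].
- rewrite !dotBl dotZl PE (patch_normal hP) // mulr0 subr0.
  rewrite patch_normal_evolution // /frame_laplacian dot_suml.
  rewrite (patch_trace_derive _ hB TT aT) -sumrB; apply: big1 => i _.
  rewrite dotDl.
  have aux (p q r s t t' : K) : p + q = r + s -> t = t' -> s + t' = 0 -> p + t - (r - q) = 0.
    by move=> *; lra.
  have c := patch_codazzi (sp (a i)) (a i) v Uz.
  have e := aux _ _ _ _ _ _ c (patch_ff_sym (b i) v Uz) (normal_orth i v).
  apply: etrans (congr1 (fun t => _ - t) _) e; congr (_ - _).
    apply: etrans (congr1 (dot _) (esym (aT i))) (congr1 (dot^~ _) _).
    exact: patch_schwarzN.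
  by apply: etrans (dotC _ _) (congr1 (dot _) _); exact: patch_schwarzF.
- rewrite !dotBl dotZl (patch_unit hP) // mulr1 opprK dotC dot_sumr.
  rewrite [dot ('D_dt N z) _]dotC patch_normal_derive // subr0.
  rewrite -(frame_trace2 (patch_shape_normal hP Uz) patch_shape_sym TT).
  rewrite -big_split; apply: big1 => i _ /=.
  have aux (p q r : K) : q = 0 -> r + p = 0 -> p + q + r = 0 by move=> *; lra.
  rewrite dotDr; apply: (aux _ _ _ (patch_normal_derive (sp (b i)) Uz)).
  apply: etrans _ (patch_normal_derive3 (sp (a i)) (sp (a i)) Uz).
  by congr (dot _ _ + _); rewrite aTN.
Qed.

(** [patch_trace_derive] in the time direction is compared, one frame vector at a time, with the
    derivative of <d_t N, D_v F> = D_v H. The excess is H |A T_i|^2, which sums to |A|^2 H. *)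
Lemma patch_laplacianH : shape_bounded U A ->
  'D_dt H z - frame_laplacian H = (\sum_i \sum_j A z i j ^+ 2) * H z.
Proof.
move=> hB; rewrite (patch_trace_derive _ hB TT aT) -sumrB.
rewrite -(frame_trace2 (patch_shape_normal hP Uz) patch_shape_sym TT) mulr_suml.
apply: eq_bigr => i _.
have aux (p q r s t h1 h2 w x y : K) : p + q = h1 -> q + s = 0 -> s = h2 -> t = p ->
    r = - x -> x = y -> t - r - (h1 + h2) = y.
  by move=> *; lra.
apply: (aux _ _ _ _ _ _ _ 0 _ _ (patch_normal_evolution2 (a i) (a i) Uz) (normal_orth_dt i)
  (patch_normal_evolution (b i) Uz)).
- apply: etrans (congr1 (dot _) (esym (aT i))) (congr1 (dot^~ _) _).
  exact: patch_schwarzN.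
- apply: etrans (congr1 (dot^~ _) _) _.
    exact: etrans (patch_schwarzF _ _ Uz) (patch_flow_derive (sp (a i)) Uz).
  exact: dotNl.
- by rewrite dotDl !dotZl patch_normal_derive // mulr0 add0r aTN mulrC.
Qed.

End Frame.
End AtPoint.
End Evolution.
End Patch.

(** * Bounds for quadratic forms by the Frobenius norm *)

Section QuadraticForm.
Context {K : realType} {d : nat}.

Lemma frobenius_bound (A : 'M[K]_d) (v : 'rV[K]_d) (L : K) : 0 < L ->
  \sum_i \sum_j A i j ^+ 2 <= L ^+ 2 -> `|dot (v *m A) v| <= L * dot v v.
Proof.
move=> L0 AL; set B := dot (v *m A) v; set a := dot v v.
have a0 : 0 <= a := dot_ge0 v.
have BE : B = \sum_i \sum_j A i j * (v 0 i * v 0 j).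
  rewrite /B dotE exchange_big /=; apply: eq_bigr => j _.
  by rewrite mxE mulr_suml; apply: eq_bigr => i _; ring.
have aE : a ^+ 2 = \sum_i \sum_j (v 0 i * v 0 j) ^+ 2.
  rewrite /a expr2 {1}dotE mulr_suml; apply: eq_bigr => i _.
  by rewrite dotE mulr_sumr; apply: eq_bigr => j _; ring.
(* Cauchy-Schwarz for A against the tensor square of v, by expanding a sum of squares; s = 1 and s =
   -1 give the two signs. *)
have sq (s : K) : s ^+ 2 = 1 -> s * (a * L * B) <= a * L * (a * L).
  move=> s1.
  have : 0 <= \sum_i \sum_j (a * A i j - s * L * (v 0 i * v 0 j)) ^+ 2.
    by apply: sumr_ge0 => i _; apply: sumr_ge0 => j _; exact: sqr_ge0.
  have -> : \sum_i \sum_j (a * A i j - s * L * (v 0 i * v 0 j)) ^+ 2 =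
      a ^+ 2 * (\sum_i \sum_j A i j ^+ 2) - 2 * (s * (a * L * B)) + L ^+ 2 * a ^+ 2.
    rewrite [in X in _ + X]aE BE !mulr_sumr -sumrB -big_split; apply: eq_bigr => i _ /=.
    rewrite !mulr_sumr -sumrB -big_split; apply: eq_bigr => j _ /=.
    by rewrite [L ^+ 2](_ : _ = s ^+ 2 * L ^+ 2); [ring|rewrite s1 mul1r].
  have : a ^+ 2 * (\sum_i \sum_j A i j ^+ 2) <= a ^+ 2 * L ^+ 2.
    by rewrite ler_wpM2l // sqr_ge0.
  have aux (x X t y : K) : x <= X -> 0 <= x - 2 * t + y -> y = X -> t <= X.
    by move=> *; lra.
  move=> h1 h2; rewrite (_ : a * L * (a * L) = a ^+ 2 * L ^+ 2); last by ring.
  by apply: aux h1 h2 _; rewrite mulrC.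
have [a00|an0] := eqVneq a 0.
  by rewrite /B (dot_eq0 a00) dot0r normr0 a00 mulr0.
have aL : 0 < a * L by rewrite mulr_gt0 // lt_neqAle eq_sym an0.
rewrite ler_norml -(ler_pM2l aL) -[X in _ && X](ler_pM2l aL) [L * a]mulrC.
have h1 := sq 1 (expr1n _ _); have h2 := sq (-1) (sqrr_sign _ 1).
by apply/andP; split; lra.
Qed.

(** With B = Phi - A, the bound on A gives 0 <= B <= (5/4) Phi, hence B^2 <= (5/4) Phi B. *)
Lemma psd_bound (A : 'M[K]_d) (q w : 'rV[K]_d) (Phi : K) : 0 < Phi -> A^T = A ->
  \sum_i \sum_j A i j ^+ 2 <= (Phi / 4) ^+ 2 -> w = Phi *: q - q *m A ->
  dot w w <= 5 / 4 * Phi * dot w q.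
Proof.
move=> P0 As AP wE.
have L0 : 0 < Phi / 4 by rewrite divr_gt0.
(* No diagonalization: B - s B^2 = (1 - s B) B (1 - s B) + s B (1 - s B) B. The first term is tested
   on q through v = q - s w, where B >= 0 is used; the second on w, where 1 - s B >= 0 is used. *)
pose s := 4 / (5 * Phi).
have s0 : 0 < s by rewrite divr_gt0 // mulr_gt0.
pose v := q - s *: w.
have h1 := frobenius_bound v L0 AP; have h2 := frobenius_bound w L0 AP.
have qAE : q *m A = Phi *: q - w by rewrite wE opprB addrC subrK.
have wq : dot (w *m A) q = Phi * dot w q - dot w w.
  by rewrite -{1}As -dot_mulmx qAE dotBr dotZr.
have qA : dot (q *m A) w = Phi * dot w q - dot w w.
  by rewrite qAE dotBl dotZl (dotC q).
have qq : dot (q *m A) q = Phi * dot q q - dot w q by rewrite qAE dotBl dotZl.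
have vv : dot v v = dot q q - 2 * s * dot w q + s ^+ 2 * dot w w.
  by rewrite /v !(dotBl, dotBr, dotZl, dotZr) (dotC q w); ring.
have vA : dot (v *m A) v = dot (q *m A) q - 2 * s * (Phi * dot w q - dot w w) +
    s ^+ 2 * dot (w *m A) w.
  rewrite /v mulmxBl -scalemxAl !(dotBl, dotBr, dotZl, dotZr) qA wq; ring.
have v0 := dot_ge0 v; have w0 := dot_ge0 w.
move: h1 h2; rewrite vA vv qq in v0 *.
move: v0 w0; move: (dot q q) (dot w q) (dot w w) (dot (w *m A) w) => a b c e v0 c0.
rewrite !ler_norml => /andP[_ h1] /andP[h2 _].
have sP : s * Phi = 4 / 5 by rewrite /s; field; rewrite lt0r_neq0.
have h3 : s ^+ 2 * e >= s ^+ 2 * (- (Phi / 4 * c)) by rewrite ler_wpM2l // sqr_ge0.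
have h4 : 0 <= b - s * c.
  have e1 : s ^+ 2 * (- (Phi / 4 * c)) = - (s * c / 5) by rewrite expr2; transitivity (- (s * Phi) * s * c / 4); [ring|by rewrite sP; field].
  have e2 : Phi * (a - 2 * s * b + s ^+ 2 * c) = Phi * a - 8 / 5 * b + 4 / 5 * (s * c).
    transitivity (Phi * a - 2 * (s * Phi) * b + (s * Phi) * s * c); [ring|by rewrite sP; field].
  have e3 : 2 * s * (Phi * b - c) = 8 / 5 * b - 2 * (s * c).
    transitivity (2 * (s * Phi) * b - 2 * (s * c)); [ring|by rewrite sP; field].
  have v1 : 0 <= Phi * (a - 2 * s * b + s ^+ 2 * c) by rewrite mulr_ge0 // ltW.
  rewrite e1 in h3; rewrite e3 in h1; move: h1 v1.
  have -> : Phi / 4 * (a - 2 * s * b + s ^+ 2 * c) = Phi * (a - 2 * s * b + s ^+ 2 * c) / 4 by field.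
  rewrite e2; lra.
have : 0 <= 5 / 4 * Phi * (b - s * c) by rewrite !mulr_ge0 // ltW.
have -> : 5 / 4 * Phi * (b - s * c) = 5 / 4 * Phi * b - 5 / 4 * (s * Phi) * c by ring.
rewrite sP; lra.
Qed.

End QuadraticForm.

(** * Reflection along the chord of a sphere *)

Section Reflection.
Context {K : realType} {d : nat}.
Variables (e nu : 'rV[K]_d) (Phi : K).
Hypotheses (e0 : 0 < dot e e) (nu1 : dot nu nu = 1)
  (enu : dot e nu = Phi / 2 * dot e e).

Definition reflect_along : 'M[K]_d := 1%:M - (2 / dot e e) *: (e^T *m e).

Lemma mul_reflect u : u *m reflect_along = u - (2 / dot e e * dot u e) *: e.
Proof. by rewrite mulmxBr mulmx1 -scalemxAr mul_rVE scalerA. Qed.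

(** For the sphere of curvature Phi with normal nu at x and with chord e = x - y, the right side is
    the normal at y: the normals at the two ends of a chord are mirror images. *)
Lemma reflect_normal : nu *m reflect_along = nu - Phi *: e.
Proof.
by rewrite mul_reflect dotC enu; congr (_ - _ *: _); field; rewrite lt0r_neq0.
Qed.

Lemma reflect_sym : reflect_along^T = reflect_along.
Proof. by rewrite linearB /= linearZ /= trmx_mul trmxK trmx1. Qed.

Lemma reflect_self : e *m reflect_along = - e.
Proof.
rewrite mul_reflect divfK ?lt0r_neq0 // scaler_nat mulr2n opprD addrA subrr.
by rewrite sub0r.
Qed.

Lemma reflect_sqr : reflect_along *m reflect_along = 1%:M.
Proof.
rewrite {1}/reflect_along mulmxBl mul1mx -scalemxAl -mulmxA reflect_self mulmxN.
by rewrite scalerN opprK subrK.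
Qed.

Lemma reflect_reflect (u : 'rV[K]_d) : u *m reflect_along *m reflect_along = u.
Proof. by rewrite -mulmxA reflect_sqr mulmx1. Qed.

Lemma dot_reflect (u v : 'rV[K]_d) : dot (u *m reflect_along) (v *m reflect_along) = dot u v.
Proof. by rewrite dot_mulmx reflect_sym reflect_reflect. Qed.

(** The reflected rows of the projection form a Parseval frame of the hyperplane orthogonal to the
    reflected normal. *)
Lemma reflect_frame :
  ((1%:M - nu^T *m nu) *m reflect_along)^T *m
  ((1%:M - nu^T *m nu) *m reflect_along) =
  1%:M - (nu - Phi *: e)^T *m (nu - Phi *: e).
Proof.
set Pi := 1%:M - _.
have PiT : Pi^T = Pi by rewrite linearB /= trmx_mul trmxK trmx1.
have PiPi : Pi *m Pi = Pi.
  rewrite {1}/Pi mulmxBl mul1mx -mulmxA (_ : nu *m Pi = 0) ?mulmx0 ?subr0 //.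
  by rewrite mulmxBr mulmx1 mul_rVE nu1 scale1r subrr.
rewrite trmx_mul PiT reflect_sym -!mulmxA (mulmxA Pi Pi) PiPi.
rewrite -reflect_normal trmx_mul reflect_sym /Pi.
move: reflect_along reflect_sqr => S SS.
by rewrite mulmxBl mul1mx mulmxBr SS !mulmxA.
Qed.

End Reflection.

(** * The differential inequality at a contact, as pure algebra *)

Section ContactAlgebra.
Context {K : realType} {d : nat}.
Implicit Types e nu x y : 'rV[K]_d.

(** For Phi > 0 it equals Phi / 2 times (|y - c|^2 - Phi^-2) with c = x - nu / Phi. It is
    nonnegative exactly when y lies outside the open ball of radius 1 / Phi that touches at x from
    the side opposite to nu. *)
Definition ball_gap (Phi : K) x y nu : K :=
  Phi / 2 * dot (x - y) (x - y) - dot (x - y) nu.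

Lemma jet2_ball_gap (Phi : K -> K) (X Y N : K -> 'rV[K]_d) p0 p1 p2 x0 x1 x2
    y0 y1 y2 n0 n1 n2 : jet2 Phi p0 p1 p2 -> jet2 X x0 x1 x2 ->
  jet2 Y y0 y1 y2 -> jet2 N n0 n1 n2 ->
  let e := x0 - y0 in let D := x1 - y1 in let W := x2 - y2 in
  jet2 (fun s => ball_gap (Phi s) (X s) (Y s) (N s)) (ball_gap p0 x0 y0 n0)
    (p1 / 2 * dot e e + p0 * dot e D - (dot D n0 + dot e n1))
    (p2 / 2 * dot e e + 2 * p1 * dot e D + p0 * (dot D D + dot e W) -
     (dot W n0 + 2 * dot D n1 + dot e n2)).
Proof.
move=> hP hX hY hN e D W.
have hE := jet2B hX hY.
have h := jet2B (jet2M (jet2M hP (jet2_cst (2^-1 : K))) (jet2_dot hE hE)) (jet2_dot hE hN).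
apply: jet2_eq h _ _ _ => //; rewrite -/e -/D -/W (dotC D e) ?(dotC W e).
  by field.
by field.
Qed.

Lemma is_derive_ball_gap (Phi : K -> K) (X Y N : K -> 'rV[K]_d) (s : K) p1 x1 y1 n1 :
  is_derive s (1 : K) Phi p1 -> is_derive s (1 : K) X x1 ->
  is_derive s (1 : K) Y y1 -> is_derive s (1 : K) N n1 ->
  let e := X s - Y s in let D := x1 - y1 in
  is_derive s (1 : K) (fun s => ball_gap (Phi s) (X s) (Y s) (N s))
    (p1 / 2 * dot e e + Phi s * dot e D - (dot D (N s) + dot e n1)).
Proof.
move=> hP hX hY hN e D.
have hE : is_derive s (1 : K) (fun s => X s - Y s) D := is_deriveB hX hY.
have h := is_deriveB (is_deriveM (is_deriveM hP (is_derive_cst (2^-1 : K) s 1))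
  (is_derive_dot hE hE)) (is_derive_dot hE hN).
apply: is_derive_eq h _; rewrite /GRing.scale /= !fctE -/e (dotC D e).
by field.
Qed.

(* P, Pt, g, P2 stand for Phi and its time, first and second frame derivatives;
   X, Y, N for the two touching sheets and the normal of the first. *)
Lemma contact_algebra (e nu : 'rV[K]_d) (A : 'M[K]_d) (P Pt : K) (g P2 : 'I_d -> K)
    (X2 Y2 N2 : 'I_d -> 'rV[K]_d) (Ft Gt Nt : 'rV[K]_d) :
  let Pi : 'M[K]_d := 1%:M - nu^T *m nu in
  let D i := row i Pi - row i (Pi *m reflect_along e) in
  let S2 := \sum_i \sum_j A i j ^+ 2 in
  0 < P -> 0 < dot e e -> dot nu nu = 1 -> dot e nu = P / 2 * dot e e ->
  nu *m A = 0 -> A^T = A -> S2 <= (P / 4) ^+ 2 ->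
  \sum_i X2 i = Ft -> \sum_i Y2 i = Gt -> \sum_i N2 i - Nt = - S2 *: nu ->
  (forall i, g i / 2 * dot e e + P * dot e (row i Pi) -
    (dot (row i Pi) nu + dot e (row i Pi *m A)) = 0) ->
  (forall i, 0 <= P2 i / 2 * dot e e + 2 * g i * dot e (D i) +
    P * (dot (D i) (D i) + dot e (X2 i - Y2 i)) -
    (dot (X2 i - Y2 i) nu + 2 * dot (D i) (row i Pi *m A) + dot e (N2 i))) ->
  Pt / 2 * dot e e + P * dot e (Ft - Gt) - (dot (Ft - Gt) nu + dot e Nt) <= 0 ->
  Pt - \sum_i P2 i - S2 * P + 8 / 5 * (\sum_i g i ^+ 2) / P <= 0.
Proof.
move=> Pi D S2 P0 e0 nu1 enu nuA As SP EX EY EN hg h2 ht.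
have een : dot e e != 0 by rewrite lt0r_neq0.
pose k i := dot (row i Pi) e.
have Pinu i : dot (row i Pi) nu = 0.
  by rewrite rowE /Pi mulmxBr mulmx1 mul_rVE dotBl dotZl nu1 mulr1 subrr.
(* Under mirrored motions the two points move relative to each other only along the chord. *)
have DE i : D i = (2 / dot e e * k i) *: e.
  by rewrite /D row_mul mul_reflect opprB addrC subrK.
have hgk i : dot e (row i Pi *m A) = g i / 2 * dot e e + P * k i.
  by apply/esym/subr0_eq; rewrite -[RHS](hg i) Pinu /k (dotC e (row i Pi)) add0r.
(* The reflection pays off here: after inserting [hgk], the terms P k_i^2 coming from |D_i|^2 and
   from <D_i, A T_i> cancel, and only the mixed term with the gradient of Phi survives. *)
have h3 i : 0 <= P2 i / 2 * dot e e + 2 * (g i * k i) +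
    dot (X2 i - Y2 i) (P *: e - nu) - dot e (N2 i).
  move: (h2 i); rewrite DE; move: (X2 i - Y2 i) => W.
  rewrite !(dotZl, dotZr, dotBr) hgk (dotC e W).
  move: een; move: (dot e e) (k i) (dot W e) => a kk b a0.
  rewrite (_ : 2 * g i * _ = 4 * (g i * kk)); last by field.
  rewrite (_ : 2 / a * kk * (2 / a * kk * a) = 4 * kk ^+ 2 / a); last by field.
  rewrite (_ : 2 * (2 / a * kk * (g i / 2 * a + P * kk)) =
    2 * (g i * kk) + 4 * P * kk ^+ 2 / a); last by field.
  rewrite (_ : P * (4 * kk ^+ 2 / a + b) = 4 * P * kk ^+ 2 / a + P * b); last by field.
  by move: (_ / a) => c; lra.
have h4 : 0 <= \sum_i (P2 i / 2 * dot e e + 2 * (g i * k i) +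
    dot (X2 i - Y2 i) (P *: e - nu) - dot e (N2 i)).
  by apply: sumr_ge0 => i _; exact: h3.
have h5 : 0 <= (\sum_i P2 i - Pt + S2 * P) / 2 * dot e e + 2 * \sum_i g i * k i.
  move: h4; rewrite sumrB !big_split /= -!mulr_suml -mulr_sumr.
  rewrite -dot_suml -dot_sumr sumrB EX EY.
  have -> : \sum_i N2 i = Nt - S2 *: nu by rewrite -scaleNr -EN addrC subrK.
  rewrite !(dotBr, dotZr) enu; move: ht; rewrite (dotC e (Ft - Gt)).
  move: (dot (Ft - Gt) e) (dot (Ft - Gt) nu) (dot e Nt) (\sum_i P2 i) => a b c p.
  move: (\sum_i g i * k i) (dot e e) => q ee; nra.
(* q is the tangential part of the chord. Together the first-order conditions say (|e|^2 / 2) grad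
   Phi = - (Phi - A) q, so [psd_bound] makes the mixed term <grad Phi, q> negative enough to yield
   the gradient term. *)
pose q := e *m Pi; pose G : 'rV[K]_d := \row_i g i; pose w := P *: q - q *m A.
have PiT : Pi^T = Pi by rewrite linearB /= trmx_mul trmxK trmx1.
have PiA : Pi *m A = A by rewrite mulmxBl mul1mx -mulmxA nuA mulmx0 subr0.
have APi : A *m Pi = A by rewrite -{1}As -{1}PiT -trmx_mul PiA.
have dot_row (u : 'rV[K]_d) i : dot u (row i Pi) = (u *m Pi) 0 i.
  by rewrite dotE mxE; apply: eq_bigr => j _; rewrite mxE -{1}PiT mxE.
have kE i : k i = q 0 i by rewrite /k dotC dot_row.
have GE : dot e e / 2 *: G = - w.
  have subE (u v : 'rV[K]_d) i : (u - v) 0 i = u 0 i - v 0 i by rewrite !mxE.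
  have scaleE c (u : 'rV[K]_d) i : (c *: u) 0 i = c * u 0 i by rewrite mxE.
  have oppE (u : 'rV[K]_d) i : (- u) 0 i = - u 0 i by rewrite mxE.
  apply/rowP => i; rewrite scaleE oppE /w subE scaleE /G mxE /q.
  have -> : (e *m Pi *m A) 0 i = dot e (row i Pi *m A).
    by rewrite dot_mulmx As dot_row -!mulmxA PiA APi.
  by rewrite hgk kE; field.
have GG : \sum_i g i ^+ 2 = dot G G.
  by rewrite dotE; apply: eq_bigr => i _; rewrite !mxE expr2.
have Gk : \sum_i g i * k i = dot G q.
  by rewrite dotE; apply: eq_bigr => i _; rewrite kE [G 0 i]mxE.
have := psd_bound P0 As SP (erefl w).
have -> : w = - (dot e e / 2 *: G) by rewrite GE opprK.
rewrite !(dotNl, dotNr, dotZl, dotZr) GG => h6.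
rewrite Gk in h5; move: h5 h6 e0.
move: (dot G G) (dot G q) (dot e e) (\sum_i P2 i) => a b ee p h5 h6 e0.
have h7 : ee / 2 * a <= - (5 / 4 * P * b).
  have ee2 : 0 < ee / 2 by rewrite divr_gt0.
  by rewrite -(ler_pM2l ee2); move: h6; congr (_ <= _); ring.
have h8 : 8 / 5 * a / P * (ee / 2) <= - 2 * b.
  rewrite (_ : _ * _ = 8 / 5 * (ee / 2 * a) / P); last by field; rewrite lt0r_neq0.
  by rewrite ler_pdivrMr //; lra.
have ee2 : 0 < ee / 2 by rewrite divr_gt0.
by rewrite -(pmulr_lle0 _ ee2) mulrDl; lra.
Qed.

End ContactAlgebra.

(** * Second variation at a two-point contact *)

Section TwoPoint.
Context {K : realType} {n : nat}.
Local Notation E := ('rV[K]_n * K)%type.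
Local Notation V := 'rV[K]_n.+1.
Local Notation sp v := ((v, 0) : E).
Local Notation dt := ((0, 1) : E).
Local Notation quad z a b := (fun s : K => z + s *: sp a + (s ^+ 2 / 2) *: sp b).

Lemma quad_near (U : set E) z (a b : 'rV[K]_n) : open U -> U z ->
  \forall s \near 0, U (quad z a b s).
Proof.
move=> oU Uz.
have c : {for 0, continuous (quad z a b)}.
  apply/differentiable_continuous/derivable1_diffP.
  by case: (is_derive_quad z (sp a) (sp b) 0).
by apply: c; rewrite scale0r expr0n mul0r scale0r !addr0; exact: open_nbhs_nbhs.
Qed.

Lemma line_near (U : set E) z (v : E) : open U -> U z ->
  \forall s \near (0 : K), U (z + s *: v).
Proof.
move=> oU Uz.
apply: (@continuous_line _ _ z v 0); rewrite scale0r addr0.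
exact: open_nbhs_nbhs.
Qed.

Lemma quad_time z (a b : 'rV[K]_n) s : (quad z a b s).2 = z.2.
Proof. by rewrite /= !scaler0 !addr0. Qed.

Variables (U U' : set E) (F N F' N' : E -> V) (H H' : E -> K)
  (A A' : E -> 'M[K]_n.+1).
Hypotheses (hP : mcf_patch U F N H A) (hP' : mcf_patch U' F' N' H' A')
  (hB : shape_bounded U A).
Variables (Phi : E -> K) (z z' : E) (a b : 'I_n.+1 -> 'rV[K]_n)
  (g P2 : 'I_n.+1 -> K) (Pt : K).
Hypotheses (Uz : U z) (Uz' : U' z') (zz' : z.2 = z'.2)
  (aT : forall i, 'D_(sp (a i)) F z = row i (tproj (N z)))
  (hb : forall i, 'D_(sp (a i)) ('D_(sp (a i)) F) z + 'D_(sp (b i)) F z =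
    dot (N z) ('D_(sp (a i)) ('D_(sp (a i)) F) z) *: N z)
  (Phi2 : forall i, jet2 (fun s => Phi (quad z (a i) (b i) s)) (Phi z) (g i) (P2 i))
  (Phit : is_derive (0 : K) (1 : K) (fun s => Phi (z + s *: dt)) Pt)
  (gap_ge0 : forall y y', U y -> U' y' -> y.2 = y'.2 -> y.2 <= z.2 ->
    0 <= ball_gap (Phi y) (F y) (F' y') (N y))
  (gap_eq0 : ball_gap (Phi z) (F z) (F' z') (N z) = 0)
  (FF' : F z <> F' z') (Phi0 : 0 < Phi z)
  (AP : \sum_i \sum_j A z i j ^+ 2 <= (Phi z / 4) ^+ 2).

Let e := F z - F' z'.
Let nu := N z.

Let e0 : 0 < dot e e.
Proof.
rewrite lt_neqAle dot_ge0 andbT eq_sym; apply/eqP => /dot_eq0 /eqP.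
by rewrite subr_eq0 => /eqP.
Qed.

Let nu1 : dot nu nu = 1. Proof. exact: (patch_unit hP). Qed.

Let enu : dot e nu = Phi z / 2 * dot e e.
Proof. by apply/esym/subr0_eq; exact: gap_eq0. Qed.

Let jetF a' b' : jet2 (fun s => F (quad z a' b' s)) (F z) ('D_(sp a') F z)
  ('D_(sp a') ('D_(sp a') F) z + 'D_(sp b') F z).
Proof. exact: jet2_curve (patch_open hP) (patch_F hP) Uz. Qed.

Let jetN a' b' : jet2 (fun s => N (quad z a' b' s)) (N z) ('D_(sp a') N z)
  ('D_(sp a') ('D_(sp a') N) z + 'D_(sp b') N z).
Proof. exact: jet2_curve (patch_open hP) (patch_N hP) Uz. Qed.

Let jetF' a' b' : jet2 (fun s => F' (quad z' a' b' s)) (F' z') ('D_(sp a') F' z')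
  ('D_(sp a') ('D_(sp a') F') z' + 'D_(sp b') F' z').
Proof. exact: jet2_curve (patch_open hP') (patch_F hP') Uz'. Qed.

Let nu' := nu - Phi z *: e.

(* Criticality of the gap in the second point: the sphere through F z and F' z'
   that is tangent to the first sheet at F z is tangent to the second at F' z'. *)
Let nu'_tangent v : dot nu' ('D_(sp v) F' z') = 0.
Proof.
have h := jet2_ball_gap (jet2_cst (Phi z)) (jet2_cst (F z)) (jetF' v 0) (jet2_cst nu).
rewrite gap_eq0 in h; have [|h1 _] := jet2_min h.
  apply: filterS (quad_near v 0 (patch_open hP') Uz') => s Us.
  by apply: gap_ge0 => //; rewrite quad_time.
move: ('D_(sp v) F' z') h1 => w; rewrite -/e /nu' !sub0r dotNr dotNl dot0r.
by rewrite [dot nu' w]dotBl dotZl (dotC w) => h1; lra.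
Qed.

Let S := reflect_along e.

Let nu'E : nu' = nu *m S.
Proof. by rewrite /nu' (reflect_normal e0 enu). Qed.

(** The two unit normals agree up to sign. The sign stays open, since only the projection along the
    normal is used at the second point. *)
Let nu'_normal : exists2 k : K, k ^+ 2 = 1 & nu' = k *: N' z'.
Proof.
have dF' : differentiable F' z' := smooth_on_diff (patch_F hP') Uz'.
have h : nu' = dot nu' (N' z') *: N' z'.
  apply: (normal_colinear (P := tframe F' z')) => [|v|v|v].
  - exact: (patch_unit hP').
  - by rewrite (mul_tframe v dF') dotC; exact: (patch_normal hP').
  - by rewrite (mul_tframe v dF'); exact: (patch_immersion hP').
  - by rewrite (mul_tframe v dF'); exact: nu'_tangent.
exists (dot nu' (N' z')) => //.
have : dot nu' nu' = 1 by rewrite nu'E (dot_reflect e0).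
by rewrite {1 2}h dotZl dotZr (patch_unit hP') // mulr1 -expr2.
Qed.

Let T' := tproj nu *m S.

Let T'_frame : T'^T *m T' = tproj (N' z').
Proof.
rewrite (reflect_frame e0 nu1 enu) -/nu'; have [k k1 ->] := nu'_normal.
by rewrite /tproj [(k *: N' z')^T]linearZ /= -scalemxAl -scalemxAr scalerA -expr2 k1 scale1r.
Qed.

Let T'_tangent i : dot (row i T') (N' z') = 0.
Proof.
have [k k1 Ek] := nu'_normal.
have -> : N' z' = k *: nu' by rewrite Ek scalerA -expr2 k1 scale1r.
rewrite dotZr nu'E /T' row_mul (dot_reflect e0) rowE (dot_tproj nu1) mulr0 //.
Qed.

(** Three kinds of test motions feed [contact_algebra]: the first point alone for the first-order
    conditions, both points along mirrored second-order geodesics for the second-order ones, and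
    both points along their charts into the past for the time derivative. *)
Lemma two_point_contact :
  Pt - \sum_i P2 i - (\sum_i \sum_j A z i j ^+ 2) * Phi z +
    8 / 5 * (\sum_i g i ^+ 2) / Phi z <= 0.
Proof.
have dF' : differentiable F' z' := smooth_on_diff (patch_F hP') Uz'.
have [a' aT'] : exists a' : 'I_n.+1 -> 'rV[K]_n, forall i,
    'D_(sp (a' i)) F' z' = row i T'.
  have [|v|v|a' h] := tangent_frame (P := tframe F' z') (nu := N' z') _ _ _ T'_tangent.
  - exact: (patch_unit hP').
  - by rewrite (mul_tframe v dF') dotC; exact: (patch_normal hP').
  - by rewrite (mul_tframe v dF'); exact: (patch_immersion hP').
  by exists a' => i; rewrite -h (mul_tframe _ dF').
have [b' hb'] := patch_normal_frame hP' Uz' a'.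
have PiT := tproj_gram nu1.
have LF := patch_laplacianF hP Uz PiT aT hb.
have LN := patch_laplacianN hP Uz PiT aT hb hB.
have LF' := patch_laplacianF hP' Uz' T'_frame aT' hb'.
have aN i : 'D_(sp (a i)) N z = row i (tproj nu) *m A z.
  by rewrite -(patch_shape hP (a i) Uz) (aT i).
apply: (contact_algebra Phi0 e0 nu1 enu _ _ AP LF LF' LN) => [||i|i|].
- exact: (patch_shape_normal hP).
- exact: (patch_shape_sym hP).
- have h := jet2_ball_gap (Phi2 i) (jetF (a i) (b i)) (jet2_cst (F' z')) (jetN (a i) (b i)).
  rewrite gap_eq0 in h; have [|h1 _] := jet2_min h.
    apply: filterS (quad_near (a i) (b i) (patch_open hP) Uz) => s Us.
    by apply: gap_ge0 => //; rewrite quad_time.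
  by move: h1; rewrite subr0 (aT i) (aN i).
- have h := jet2_ball_gap (Phi2 i) (jetF (a i) (b i)) (jetF' (a' i) (b' i)) (jetN (a i) (b i)).
  rewrite gap_eq0 in h; have [|_] := jet2_min h.
    apply: filterS2 (quad_near (a i) (b i) (patch_open hP) Uz)
      (quad_near (a' i) (b' i) (patch_open hP') Uz') => s Us Us'.
    by apply: gap_ge0 => //; rewrite !quad_time.
  by rewrite (aT i) (aT' i) (aN i).
- have dl (W : normedModType K) (f : E -> W) y (df : differentiable f y) :
      is_derive (0 : K) (1 : K) (fun s => f (y + s *: dt)) ('D_dt f y).
    have y0 : y + (0 : K) *: dt = y by rewrite scale0r addr0.
    rewrite -[in 'D_dt _ _]y0; apply: is_derive_curve; last by rewrite y0.
    exact: is_derive_line.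
  have h := is_derive_ball_gap Phit (dl _ F z (smooth_on_diff (patch_F hP) Uz))
    (dl _ F' z' dF') (dl _ N z (smooth_on_diff (patch_N hP) Uz)).
  rewrite !scale0r !addr0 in h; apply: is_derive_left_le0 h _ _.
    by rewrite !scale0r !addr0.
  apply: filterS2 (line_near dt (patch_open hP) Uz) (line_near dt (patch_open hP') Uz').
  move=> s Us Us' s0; apply: gap_ge0 => //=; first by rewrite zz'.
  by rewrite gerDl [s *: _]mulr1.
Qed.

End TwoPoint.

(** * Uniqueness of jets and the evolution of the cutoff *)

Section JetUnique.
Context {K : realType}.

Lemma jet2_uniq (W : normedModType K) (f g : K -> W) f0 f1 f2 g0 g1 g2 :
  jet2 f f0 f1 f2 -> jet2 g g0 g1 g2 -> (\forall s \near 0, f s = g s) ->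
  f1 = g1 /\ f2 = g2.
Proof.
move=> [df [_ <- nf hf]] [dg [_ <- ng hg]] fg.
have E : \forall s \near 0, df s = dg s.
  have fg2 : \forall s \near 0, \forall u \near s, f u = g u by exact: near_join.
  apply: filterS3 nf ng fg2 => s h1 h2 h3.
  exact: is_derive_uniq h1 (near_eq_is_derive (filterS (fun _ => esym) h3) h2).
split; first exact: nbhs_singleton E.
exact: is_derive_uniq hf (near_eq_is_derive (filterS (fun _ => esym) E) hg).
Qed.

Lemma is_derive_neq0 (f : K -> K) (s df : K) : is_derive s (1 : K) f df ->
  f s != 0 -> \forall u \near s, f u != 0.
Proof.
move=> [d _] f0.
have cf : {for s, continuous f} by apply/differentiable_continuous/derivable1_diffP.
exact: (cf _ (open_nbhs_nbhs (conj (@open_neq _ 0) f0))).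
Qed.

Lemma jet2X4 (f : K -> K) (f0 f1 f2 : K) : jet2 f f0 f1 f2 ->
  jet2 (fun s => f s ^+ 4) (f0 ^+ 4) (4 * f0 ^+ 3 * f1)
    (4 * f0 ^+ 3 * f2 + 12 * f0 ^+ 2 * f1 ^+ 2).
Proof.
move=> h; have h2 := jet2M h h; have h4 := jet2M h2 h2.
have -> : (fun s => f s ^+ 4) = (fun s => f s * f s * (f s * f s)).
  by apply/funext => s; ring.
by apply: jet2_eq h4 _ _ _; ring.
Qed.

Lemma is_deriveX4 (f : K -> K) (s f1 : K) : is_derive s (1 : K) f f1 ->
  is_derive s (1 : K) (fun s => f s ^+ 4) (4 * f s ^+ 3 * f1).
Proof.
move=> h; have h2 := is_deriveM h h; have h4 := is_deriveM h2 h2.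
have -> : (fun s => f s ^+ 4) = f * f * (f * f).
  by apply/funext => u; rewrite !fctE; ring.
by apply: is_derive_eq h4 _; rewrite /GRing.scale /= !fctE; ring.
Qed.

End JetUnique.

Section CutoffAlgebra.
Context {K : realType}.

(* The exponent 4 of the cutoff makes the quadratic form
   8/5 X^2 + 8 X Y + 12 Y^2 in X = phi grad Phi, Y = Phi grad phi positive. *)
Lemma cutoff_algebra d (m S2 P p pt Pt H Ht k : K) (g P2 H2 p1 p2 : 'I_d -> K) :
  0 < P -> 0 < p -> 0 < k -> m * H = P * p ^+ 4 ->
  (forall i, m * H2 i = P2 i * p ^+ 4 + 8 * g i * p ^+ 3 * p1 i +
    P * (4 * p ^+ 3 * p2 i + 12 * p ^+ 2 * p1 i ^+ 2)) ->
  m * Ht = Pt * p ^+ 4 + P * (4 * p ^+ 3 * pt) ->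
  Ht - \sum_i H2 i = S2 * H -> pt - \sum_i p2 i = - k ->
  Pt - \sum_i P2 i - S2 * P + 8 / 5 * (\sum_i g i ^+ 2) / P <= 0 -> False.
Proof.
move=> P0 p0 k0 EH EH2 EHt EL Ep C.
(* The heat operator applied to m H = P p^4; the evolution equation of H removes the |A|^2 term, and
   the drift - k of the cutoff leaves the positive term 4 P p^3 k. *)
have E : p ^+ 4 * (Pt - \sum_i P2 i - S2 * P) =
    4 * P * p ^+ 3 * k + \sum_i (8 * g i * p ^+ 3 * p1 i + 12 * P * p ^+ 2 * p1 i ^+ 2).
  have e1 : m * (\sum_i H2 i) = p ^+ 4 * (\sum_i P2 i) + 4 * P * p ^+ 3 * (\sum_i p2 i) +
      \sum_i (8 * g i * p ^+ 3 * p1 i + 12 * P * p ^+ 2 * p1 i ^+ 2).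
    rewrite !mulr_sumr -!big_split; apply: eq_bigr => i _ /=; rewrite EH2; ring.
  have e2 : m * (Ht - \sum_i H2 i) = S2 * (P * p ^+ 4) by rewrite EL -EH; ring.
  move: e2; rewrite mulrBr e1 EHt; move: Ep; move: (\sum_i p2 i) (\sum_i P2 i) (\sum_i (8 * g i * p ^+ 3 * p1 i + _)).
  move=> a b c Ea; have -> : pt = a - k by lra.
  by move=> e; apply/subr0_eq; rewrite -[RHS](subrr (S2 * (P * p ^+ 4))) -{1}e; ring.
have G : 0 <= \sum_i (8 / 5 * p ^+ 4 * g i ^+ 2 / P +
    (8 * g i * p ^+ 3 * p1 i + 12 * P * p ^+ 2 * p1 i ^+ 2)).
  apply: sumr_ge0 => i _.
  (* Completing the square, with 12 = (8/5) (5/2)^2 + 2. *)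
  have -> : 8 / 5 * p ^+ 4 * g i ^+ 2 / P +
      (8 * g i * p ^+ 3 * p1 i + 12 * P * p ^+ 2 * p1 i ^+ 2) =
      p ^+ 2 / P * (8 / 5 * (p * g i + 5 / 2 * (P * p1 i)) ^+ 2 + 2 * (P * p1 i) ^+ 2).
    by field; rewrite lt0r_neq0.
  apply: mulr_ge0; first by rewrite divr_ge0 ?sqr_ge0 // ltW.
  by rewrite addr_ge0 // mulr_ge0 ?sqr_ge0.
have : p ^+ 4 * (Pt - \sum_i P2 i - S2 * P + 8 / 5 * (\sum_i g i ^+ 2) / P) <= 0.
  by rewrite pmulr_rle0 // exprn_gt0.
rewrite mulrDr E; move: G; rewrite big_split /= -mulr_suml -mulr_sumr.
have : 0 < 4 * P * p ^+ 3 * k by rewrite !mulr_gt0 // exprn_gt0.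
have -> : p ^+ 4 * (8 / 5 * (\sum_i g i ^+ 2) / P) = 8 / 5 * p ^+ 4 * (\sum_i g i ^+ 2) / P by ring.
by move: (\sum_i (_ + _)) (_ / P) => a b; lra.
Qed.

End CutoffAlgebra.

Section NoContact.
Context {K : realType} {n : nat}.
Local Notation E := ('rV[K]_n * K)%type.
Local Notation V := 'rV[K]_n.+1.
Local Notation sp v := ((v, 0) : E).
Local Notation dt := ((0, 1) : E).
Local Notation quad z a b := (fun s : K => z + s *: sp a + (s ^+ 2 / 2) *: sp b).

(** Along the flow |x|^2 satisfies (d_t - Laplacian) |x|^2 = - 2 n, so the term 3 n t leaves a
    strictly negative drift when n > 0. The constant 7/8 is below 1, so that for t >= - r^2 the
    closed condition [0 <= cutoff] implies lying in the open ball of radius sqrt (1 + 3 n) r. It is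
    also large enough that the cutoff is at least 5/8 on the ball of radius r / 2, where 2 / (5/8)^4
    < 16. *)
Definition cutoff (r : K) (x : V) (t : K) : K :=
  7 / 8 - (3 * n%:R * t + dot x x) / r ^+ 2.

Lemma trace_tproj (nu : V) : dot nu nu = 1 -> \tr (tproj nu) = n%:R :> K.
Proof.
move=> nu1; rewrite /tproj linearB /= mxtrace1 mxtrace_mulC.
by rewrite mulmx_trE mxtrace_scalar nu1 -natr1 addrK.
Qed.

Variables (U U' : set E) (F N F' N' : E -> V) (H H' : E -> K)
  (A A' : E -> 'M[K]_n.+1).
Hypotheses (hP : mcf_patch U F N H A) (hP' : mcf_patch U' F' N' H' A')
  (hB : shape_bounded U A).
Variables (r m : K) (z z' : E).
Let phi y := cutoff r (F y) y.2.
Let Phi y := 2 * m * H y / phi y ^+ 4.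
Hypotheses (n0 : (0 < n)%N) (r0 : 0 < r) (m0 : 0 < m)
  (Uz : U z) (Uz' : U' z') (zz' : z.2 = z'.2)
  (phi0 : 0 < phi z) (H0 : 0 < H z)
  (gap_ge0 : forall y y', U y -> U' y' -> y.2 = y'.2 -> y.2 <= z.2 ->
    0 <= ball_gap (Phi y) (F y) (F' y') (N y))
  (gap_eq0 : ball_gap (Phi z) (F z) (F' z') (N z) = 0)
  (FF' : F z <> F' z')
  (AP : \sum_i \sum_j A z i j ^+ 2 <= (Phi z / 4) ^+ 2).

Lemma no_contact : False.
Proof.
have nu1 : dot (N z) (N z) = 1 := patch_unit hP Uz.
have dF : differentiable F z := smooth_on_diff (patch_F hP) Uz.
have [a aT] : exists a : 'I_n.+1 -> 'rV[K]_n, forall i,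
    'D_(sp (a i)) F z = row i (tproj (N z)).
  have [|v|v|v|a h] := tangent_frame (P := tframe F z) (nu := N z) _ _ _ (T := tproj (N z)).
  - exact: nu1.
  - by rewrite (mul_tframe v dF) dotC; exact: (patch_normal hP).
  - by rewrite (mul_tframe v dF); exact: (patch_immersion hP).
  - by rewrite rowE; exact: dot_tproj.
  by exists a => i; rewrite -h (mul_tframe _ dF).
have [b hb] := patch_normal_frame hP Uz a.
have PiT := tproj_gram nu1.
have P0 : 0 < Phi z by rewrite divr_gt0 ?exprn_gt0 // !mulr_gt0.
have phin : phi z != 0 by rewrite lt0r_neq0.
pose p1 i := - (2 * dot (row i (tproj (N z))) (F z)) / r ^+ 2.
pose p2 i := - (2 * dot (row i (tproj (N z))) (row i (tproj (N z))) +
  2 * dot ('D_(sp (a i)) ('D_(sp (a i)) F) z + 'D_(sp (b i)) F z) (F z)) / r ^+ 2.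
have jphi i : jet2 (fun s => phi (quad z (a i) (b i) s)) (phi z) (p1 i) (p2 i).
  have hF := jet2_curve (sp (a i)) (sp (b i)) (patch_open hP) (patch_F hP) Uz.
  have h := jet2B (jet2_cst (7 / 8 : K)) (jet2M (jet2D (jet2_cst (3 * n%:R * z.2 : K))
    (jet2_dot hF hF)) (jet2_cst ((r ^+ 2)^-1 : K))).
  have -> : (fun s => phi (quad z (a i) (b i) s)) = (fun s => 7 / 8 -
      (3 * n%:R * z.2 + dot (F (quad z (a i) (b i) s)) (F (quad z (a i) (b i) s))) * (r ^+ 2)^-1).
    by apply/funext => s; rewrite /phi /cutoff quad_time.
  apply: jet2_eq h _ _ _ => //; rewrite (aT i) (dotC (F z)).
    by rewrite /p1; ring.
  by rewrite (dotC (F z)) /p2; ring.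
have jH i := jet2_curve (sp (a i)) (sp (b i)) (patch_open hP) (patch_H hP) Uz.
have phi4n : phi z ^+ 4 != 0 by rewrite expf_neq0.
(* The quotient-rule values of the derivatives of Phi are kept abstract: what is needed follows from
   2 m H = Phi phi^4 by uniqueness of jets. *)
have [g [P2 jPhi]] : exists g P2 : 'I_n.+1 -> K, forall i,
    jet2 (fun s => Phi (quad z (a i) (b i) s)) (Phi z) (g i) (P2 i).
  eexists; eexists => i; exact: jet2M (jet2M (jet2_cst (2 * m : K)) (jH i))
    (jet2V phi4n (jet2X4 (jphi i))).
have dl (W : normedModType K) (f : E -> W) (df : differentiable f z) :
    is_derive (0 : K) (1 : K) (fun s => f (z + s *: dt)) ('D_dt f z).
  have y0 : z + (0 : K) *: dt = z by rewrite scale0r addr0.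
  rewrite -[in 'D_dt _ _]y0; apply: is_derive_curve; last by rewrite y0.
  exact: is_derive_line.
pose pt := - (3 * n%:R + 2 * dot ('D_dt F z) (F z)) / r ^+ 2.
have dphi : is_derive (0 : K) (1 : K) (fun s => phi (z + s *: dt)) pt.
  have hF := dl _ F dF.
  have h := is_deriveB (is_derive_cst (7 / 8 : K) (0 : K) 1) (is_deriveM (is_deriveD
    (is_derive_line (3 * n%:R * z.2 : K) (3 * n%:R : K) 0) (is_derive_dot hF hF))
    (is_derive_cst ((r ^+ 2)^-1 : K) (0 : K) 1)).
  rewrite (_ : (fun s => _) = (fun s : K => 7 / 8 - (3 * n%:R * z.2 + s *: (3 * n%:R) +
      dot (F (z + s *: dt)) (F (z + s *: dt))) * (r ^+ 2)^-1)); last first.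
    apply/funext => s; rewrite /phi /cutoff.
    have -> : (z + s *: dt).2 = z.2 + s by rewrite /= [X in _ + X]mulr1.
    by rewrite mulrDr [_ * s]mulrC.
  have y0 : z + (0 : K) *: dt = z by rewrite scale0r addr0.
  apply: is_derive_eq h _; rewrite !fctE y0 (dotC (F z)) /GRing.scale /= /pt.
  by ring.
have dH := dl _ H (smooth_on_diff (patch_H hP) Uz).
have [Pt dPhi] : exists Pt, is_derive (0 : K) (1 : K) (fun s => Phi (z + s *: dt)) Pt.
  have z0 : z + (0 : K) *: dt = z by rewrite scale0r addr0.
  have p4 : phi (z + (0 : K) *: dt) ^+ 4 != 0 by rewrite z0.
  have h := is_deriveM (is_deriveM (is_derive_cst (2 * m : K) (0 : K) 1) dH)
    (@is_deriveVK _ (fun s => phi (z + s *: dt) ^+ 4) 0 _ p4 (is_deriveX4 dphi)).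
  by eexists; exact: h.
have PhiE y : phi y != 0 -> 2 * m * H y = Phi y * phi y ^+ 4.
  by move=> py; rewrite /Phi divfK // expf_neq0.
apply: (@cutoff_algebra _ n.+1 (2 * m) (\sum_i \sum_j A z i j ^+ 2) (Phi z) (phi z) pt Pt
  (H z) ('D_dt H z) (n%:R / r ^+ 2) g P2
  (fun i => 'D_(sp (a i)) ('D_(sp (a i)) H) z + 'D_(sp (b i)) H z) p1 p2) => //.
- by rewrite divr_gt0 ?ltr0n // exprn_gt0.
- exact: PhiE.
- move=> i.
  have j1 := jet2M (jPhi i) (jet2X4 (jphi i)).
  have j2 := jet2M (jet2_cst (2 * m : K)) (jH i).
  have nz : \forall s \near 0, phi (quad z (a i) (b i) s) != 0.
    have [df [f0 _ nf _]] := jphi i.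
    by apply: is_derive_neq0 (nbhs_singleton nf) _; rewrite f0.
  have [_] := jet2_uniq j2 j1 (filterS (fun _ => @PhiE _) nz).
  rewrite !mul0r !add0r => ->.
  move: (Phi z) (phi z) (g i) (P2 i) (p1 i) (p2 i) => *; ring.
- have z0 : z + (0 : K) *: dt = z by rewrite scale0r addr0.
  have d1 := is_deriveM dPhi (is_deriveX4 dphi).
  have d2 := is_deriveM (is_derive_cst (2 * m : K) (0 : K) 1) dH.
  have nz : \forall s \near 0, phi (z + s *: dt) != 0.
    by apply: is_derive_neq0 dphi _; rewrite z0.
  have := is_derive_uniq d2 (near_eq_is_derive (filterS (fun _ h => esym (@PhiE _ h)) nz) d1).
  rewrite !fctE z0 /GRing.scale /= mulr0 addr0 => ->.
  move: (Phi z) (phi z) => *; ring.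
- have LH := patch_laplacianH hP Uz PiT aT hb hB.
  by rewrite -LH /frame_laplacian.
- have LF := patch_laplacianF hP Uz PiT aT hb.
  have -> : \sum_i p2 i = - (2 * (\sum_i dot (row i (tproj (N z))) (row i (tproj (N z)))) +
      2 * dot (frame_laplacian z a b F) (F z)) / r ^+ 2.
    by rewrite /frame_laplacian dot_suml !mulr_sumr -big_split -sumrN mulr_suml.
  rewrite LF.
  have -> : \sum_i dot (row i (tproj (N z))) (row i (tproj (N z))) = n%:R.
    by have := trace_tproj nu1; rewrite -PiT mxtrace_tr_mul PiT.
  by rewrite /pt; field; rewrite lt0r_neq0.
- exact: (two_point_contact hP hP' hB (Phi := Phi) Uz Uz' zz' aT hb jPhi dPhi gap_ge0 gap_eq0 FF' P0 AP).
Qed.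

End NoContact.

(** * Limits of matrices and Cauchy-Schwarz estimates *)

Section MatrixLimits.
Context {K : realType} {T : topologicalType}.

Lemma cvg_mulmx_entry m n p (B : 'M[K]_(m, n)) (X : T -> 'M[K]_(n, p)) (x : T) :
  (forall k j, (fun y => X y k j) @ x --> X x k j) ->
  forall i j, (fun y => (B *m X y) i j) @ x --> (B *m X x) i j.
Proof.
move=> cX i j.
have -> : (fun y => (B *m X y) i j) = (fun y => \sum_k B i k * X y k j).
  by apply/funext => y; rewrite mxE.
rewrite mxE; apply: (cvg_big add_continuous) => k _.
apply: cvgM; [exact: cvg_cst|exact: cX].
Qed.

Lemma near_sumsq_lt m n (X : T -> 'M[K]_(m, n)) (x : T) (L : K) :
  (forall i j, (fun y => X y i j) @ x --> X x i j) ->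
  \sum_i \sum_j X x i j ^+ 2 < L ->
  \forall y \near x, \sum_i \sum_j X y i j ^+ 2 < L.
Proof.
move=> cX XL.
have c : (fun y => \sum_i \sum_j X y i j ^+ 2) @ x --> \sum_i \sum_j X x i j ^+ 2.
  apply: (cvg_big add_continuous) => i _; apply: (cvg_big add_continuous) => j _.
  by rewrite expr2; under eq_fun do rewrite expr2; apply: cvgM; exact: cX.
exact: c _ (lt_nbhsl XL).
Qed.

End MatrixLimits.

Section Frobenius.
Context {K : realType} {d : nat}.

Lemma dot_young (u v : 'rV[K]_d) (k : K) : 0 < k ->
  2 * dot u v <= k * dot u u + dot v v / k.
Proof.
move=> k0; have := dot_ge0 (k *: u - v).
rewrite !(dotBl, dotBr, dotZl, dotZr) (dotC v u).
move: (dot u u) (dot u v) (dot v v) => a b c h.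
rewrite -(ler_pM2l k0) mulrDr [k * (c / k)]mulrC divfK ?lt0r_neq0 //; lra.
Qed.

Lemma is_derive_dotl (f : K -> 'rV[K]_d) (u df : 'rV[K]_d) (s : K) :
  is_derive s (1 : K) f df -> is_derive s (1 : K) (fun s => dot (f s) u) (dot df u).
Proof.
move=> h; apply: is_derive_eq (is_derive_dot h (is_derive_cst u s (1 : K))) _.
by rewrite dot0r addr0.
Qed.

Lemma is_derive_dotr (f : K -> 'rV[K]_d) (u df : 'rV[K]_d) (s : K) :
  is_derive s (1 : K) f df -> is_derive s (1 : K) (fun s => dot u (f s)) (dot u df).
Proof.
move=> h; apply: is_derive_eq (is_derive_dot (is_derive_cst u s (1 : K)) h) _.
by rewrite dot0l add0r.
Qed.

Lemma dot_mulmx_le k (u : 'rV[K]_d) (C : 'M[K]_(d, k)) :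
  dot (u *m C) (u *m C) <= (\sum_i \sum_j C i j ^+ 2) * dot u u.
Proof.
rewrite dotE exchange_big mulr_suml; apply: ler_sum => j _ /=.
have cs : forall c : 'rV[K]_d, dot u c ^+ 2 <= dot c c * dot u u.
  move=> c; have := dot_ge0 (dot u u *: c - dot u c *: u).
  rewrite !(dotBl, dotBr, dotZl, dotZr) (dotC c u).
  have := dot_ge0 u; rewrite le_eqVlt => /orP[/eqP u0|u0].
    by move=> _; rewrite (dot_eq0 (esym u0)) !dot0l expr0n mulr0.
  by move: (dot u u) (dot u c) (dot c c) u0 => a b e a0; nra.
have := cs (col j C)^T; rewrite expr2 [in X in _ <= X * _]dotE => h.
have -> : (u *m C) 0 j = dot u (col j C)^T.
  by rewrite dotE mxE; apply: eq_bigr => i _; rewrite !mxE.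
by apply: le_trans h _; rewrite ler_wpM2r ?dot_ge0 //; apply: ler_sum => i _;
  rewrite !mxE expr2.
Qed.

End Frobenius.

(** * Chord and height estimates near one point of a chart *)

Section Local.
Context {K : realType} {n : nat}.
Local Notation E := ('rV[K]_n * K)%type.
Local Notation V := 'rV[K]_n.+1.
Local Notation sp v := ((v, 0) : E).

Variables (U : set E) (F N : E -> V) (z0 : E).
Hypotheses (oU : open U) (sF : smooth_on U F) (sN : smooth_on U N) (Uz0 : U z0)
  (immersed : forall v, 'D_(sp v) F z0 = 0 -> v = 0)
  (nu1 : dot (N z0) (N z0) = 1)
  (nuF : forall v, dot (N z0) ('D_(sp v) F z0) = 0).

Let P0 := tframe F z0.
Let P0E v : v *m P0 = 'D_(sp v) F z0.
Proof. exact: mul_tframe (smooth_on_diff sF Uz0). Qed.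

(** Recovers chart coordinates from an ambient tangent vector. Projecting first makes it vanish on
    the normal, as a shape operator must. *)
Definition tframe_inv : 'M[K]_(n.+1, n) := tproj (N z0) *m pinvmx P0.

Definition local_shape : 'M[K]_n.+1 := tframe_inv *m tframe N z0.

Lemma tframe_invK (v : 'rV_n) : 'D_(sp v) F z0 *m tframe_inv = v.
Proof.
rewrite -P0E /tframe_inv mulmxA mul_tproj P0E dotC nuF scale0r subr0 -P0E.
have rf : row_free P0 by apply: inj_row_free => w; rewrite P0E; exact: immersed.
by rewrite -mulmxA mulmxVp // mulmx1.
Qed.

Lemma local_shapeP (v : 'rV_n) : 'D_(sp v) F z0 *m local_shape = 'D_(sp v) N z0.
Proof. by rewrite mulmxA tframe_invK mul_tframe //; exact: smooth_on_diff sN Uz0. Qed.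

Lemma local_shape_normal : N z0 *m local_shape = 0.
Proof. by rewrite !mulmxA mul_tproj nu1 scale1r subrr !mul0mx. Qed.

Let tframe_cont (f : E -> V) : smooth_on U f ->
  forall k j, (fun y => tframe f y k j) @ z0 --> tframe f z0 k j.
Proof.
move=> sf k j.
have -> : (fun y => tframe f y k j) = (fun y => 'D_(sp (delta_mx 0 k)) f y 0 j).
  by apply/funext => y; rewrite mxE.
rewrite mxE; apply: differentiable_continuous; apply: differentiable_mx_entry.
exact: smooth_on_diff (smooth_on_derive _ sf) Uz0.
Qed.

Lemma local_near (eta h : K) : 0 < eta -> \sum_i \sum_j local_shape i j ^+ 2 < h ->
  exists2 e : K, 0 < e & forall y, ball z0 e y -> [/\ U y,
    \sum_i \sum_j (tframe_inv *m (tframe F y - P0)) i j ^+ 2 < eta &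
    \sum_i \sum_j (tframe_inv *m tframe N y) i j ^+ 2 < h].
Proof.
move=> eta0 hh.
have n1 : \forall y \near z0, U y := open_nbhs_nbhs (conj oU Uz0).
have n2 := near_sumsq_lt (cvg_mulmx_entry (B := tframe_inv) (tframe_cont sN)) hh.
have subE (A B : 'M[K]_(n, n.+1)) k j : (A - B) k j = A k j - B k j by rewrite !mxE.
have c3 k j : (fun y => (tframe F y - P0) k j) @ z0 --> (tframe F z0 - P0) k j.
  have -> : (fun y => (tframe F y - P0) k j) = (fun y => tframe F y k j - P0 k j).
    by apply/funext => y; rewrite subE.
  rewrite subE.
  by apply: cvgB; [exact: tframe_cont|exact: cvg_cst].
have n3 : \forall y \near z0,
    \sum_i \sum_j (tframe_inv *m (tframe F y - P0)) i j ^+ 2 < eta.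
  apply: (near_sumsq_lt (cvg_mulmx_entry (B := tframe_inv) c3)).
  rewrite subrr mulmx0 big1 // => i _; rewrite big1 // => j _.
  by rewrite mxE expr0n.
have /nbhs_ballP[e /= e0 he] : nbhs z0 (fun y => [/\ U y,
    \sum_i \sum_j (tframe_inv *m (tframe F y - P0)) i j ^+ 2 < eta &
    \sum_i \sum_j (tframe_inv *m tframe N y) i j ^+ 2 < h]).
  by apply: filterS3 n1 n3 n2.
by exists e.
Qed.

Let segment_ball (e : K) (z z' : E) (s : K) : ball z0 e z -> ball z0 e z' -> z.2 = z'.2 ->
  0 <= s <= 1 -> ball z0 e (z + s *: sp (z'.1 - z.1)).
Proof.
rewrite -!ball_normE /= => hz hz' zz /andP[s0 s1].
have -> : z0 - (z + s *: sp (z'.1 - z.1)) = (1 - s) *: (z0 - z) + s *: (z0 - z').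
  case: z z' zz {hz hz'} => [p t] [q t'] /= <-; case: z0 => p0 t0.
  congr pair => /=.
    by apply/rowP => i; rewrite !mxE; ring.
  rewrite /GRing.scale /= mulr0 addr0; ring.
apply: le_lt_trans (ler_normD _ _) _; rewrite !normrZ ger0_norm ?subr_ge0 //.
rewrite (ger0_norm s0); move: (`|_|) (`|_|) hz hz' => a b ha hb.
have [->|s0'] := eqVneq s 0; first by rewrite subr0 mul1r mul0r addr0.
have : 0 < s by rewrite lt_neqAle eq_sym s0'.
nra.
Qed.

Let perturb_bound (eta a b c : K) : c <= eta ^+ 2 * a -> 2 * b <= 2 * eta * a ->
  a + b + (b + c) <= (1 + eta) ^+ 2 * a.
Proof. by rewrite !expr2 => h1 h2; lra. Qed.

Let rayleigh_bound (h eta a s : K) (X Y : V) : 0 < h -> 0 <= a -> 0 <= s -> s <= 1 ->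
  dot X X <= (1 + eta) ^+ 2 * a -> dot Y Y <= (h * (1 + eta)) ^+ 2 * a ->
  dot X Y * s <= h * (1 + eta) ^+ 2 * a.
Proof.
move=> h0 a0 s0 s1 XX YY; have h2 := dot_young X Y h0.
have YY3 : dot Y Y / h <= h * ((1 + eta) ^+ 2 * a).
  rewrite ler_pdivrMr //; apply: le_trans YY _.
  by rewrite (_ : _ * a = h * ((1 + eta) ^+ 2 * a) * h) //; ring.
have hX : h * dot X X <= h * ((1 + eta) ^+ 2 * a) by rewrite ler_wpM2l // ltW.
have R0 : 0 <= h * (1 + eta) ^+ 2 * a by rewrite mulr_ge0 // mulr_ge0 ?sqr_ge0 // ltW.
have XY : dot X Y <= h * (1 + eta) ^+ 2 * a by lra.
apply: (le_trans (y := s * (h * (1 + eta) ^+ 2 * a))).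
  by rewrite mulrC ler_wpM2l.
by rewrite ler_piMl.
Qed.

Let le_scale (x S T a : K) : x <= S * a -> S < T -> 0 <= a -> x <= T * a.
Proof. by move=> h /ltW ST a0; apply: le_trans h _; rewrite ler_wpM2r. Qed.

(** Near z0, chords of a time slice are comparable to the tangent vector u. Their height over the
    tangent plane is controlled by the curvature bound h through two mean value steps: the height is
    the integrated slope, and the slope against [N z] comes from the turning of N. The factor 1/2 of
    a Taylor expansion is given away. *)
Lemma local_estimates (eta h : K) : 0 < eta < 1 -> 0 < h ->
  \sum_i \sum_j local_shape i j ^+ 2 <= h ^+ 2 ->
  exists2 e : K, 0 < e & ball z0 e `<=` U /\
    forall z z' : E, ball z0 e z -> ball z0 e z' -> z.2 = z'.2 ->
    let u := 'D_(sp (z'.1 - z.1)) F z0 in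
    (1 - eta) ^+ 2 * dot u u <= dot (F z' - F z) (F z' - F z) /\
    ((forall y v, ball z0 e y -> y.2 = z.2 -> dot (N y) ('D_(sp v) F y) = 0) ->
      dot (F z - F z') (N z) <= h * (1 + eta) ^+ 2 * dot u u).
Proof.
move=> /andP[eta0 eta1] h0 Ah.
have eta20 : 0 < eta ^+ 2 by rewrite exprn_gt0.
have Ah2 : \sum_i \sum_j local_shape i j ^+ 2 < (h * (1 + eta)) ^+ 2.
  apply: le_lt_trans Ah _; rewrite ltr_pXn2r ?nnegrE ?mulr_ge0 ?addr_ge0 // ?ltW //.
  by rewrite ltr_pMr // ltrDl.
have [e e0 he] := local_near eta20 Ah2.
exists e => //; split=> [y /he[]//|z z' bz bz' zz u].
set v := z'.1 - z.1.
have z'E : z' = z + 1 *: sp v.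
  rewrite scale1r; case: z z' zz @v {bz bz' u} => [p t] [q t'] /= <-.
  by congr pair; rewrite /= ?addr0 // addrC subrK.
have seg (s : K) : 0 <= s <= 1 -> ball z0 e (z + s *: sp v) by exact: segment_ball.
have dd (f : E -> V) (s : K) : smooth_on U f -> 0 <= s <= 1 ->
    is_derive s (1 : K) (fun s => f (z + s *: sp v)) ('D_(sp v) f (z + s *: sp v)).
  move=> sf /seg/he[Uy _ _]; apply: is_derive_curve; first exact: is_derive_line.
  exact: smooth_on_diff sf Uy.
have vu : u *m tframe_inv = v by exact: tframe_invK.
(* The relative deviation of the differential at y from the one at z0, small by [local_near]. *)
pose B y := tframe_inv *m (tframe F y - P0).
have FB y : ball z0 e y -> 'D_(sp v) F y = u + u *m B y.
  move=> /he[Uy _ _]; rewrite /B mulmxA vu mulmxBr P0E addrC subrK.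
  by rewrite mul_tframe //; exact: smooth_on_diff sF Uy.
have uB y : ball z0 e y -> dot (u *m B y) (u *m B y) <= eta ^+ 2 * dot u u.
  move=> /he[_ By _]; apply: le_trans (dot_mulmx_le _ _) _.
  by rewrite ler_wpM2r ?dot_ge0 // ltW.
have uuB y : ball z0 e y -> `|2 * dot u (u *m B y)| <= 2 * eta * dot u u.
  move=> By; have h1 := dot_young u (u *m B y) eta0.
  have h2 := dot_young u (- (u *m B y)) eta0.
  have h3 : dot (u *m B y) (u *m B y) / eta <= eta * dot u u.
    by rewrite ler_pdivrMr // mulrC mulrA -expr2; exact: uB.
  move: h1 h2 h3; rewrite dotNl !dotNr opprK ler_norml.
  move: (dot u u) (dot u _) (_ / eta) => a b c; lra.
split.
  have [|s /andP[s0 s1] E1] := @MVT0 _ (fun s => dot (F (z + s *: sp v)) u)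
      (fun s => dot ('D_(sp v) F (z + s *: sp v)) u) 1 ltr01.
    by move=> s sI; apply: is_derive_dotl; exact: dd.
  have bs : ball z0 e (z + s *: sp v) by apply: seg; rewrite !ltW.
  move: (uuB _ bs); rewrite ler_norml.
  move: E1; rewrite -z'E scale0r addr0 mulr1 -dotBl FB //; move: (F z' - F z) => w.
  rewrite dotDl (dotC (u *m _) u); move: (dot u (u *m _)) => b Ew /andP[b1 _].
  have h1 : (1 - eta) * dot u u <= dot w u by rewrite Ew; lra.
  have h2 := dot_ge0 (w - (1 - eta) *: u).
  rewrite !(dotBl, dotBr, dotZl, dotZr) (dotC u w) in h2.
  have h3 : (1 - eta) * ((1 - eta) * dot u u) <= (1 - eta) * dot w u.
    by rewrite ler_wpM2l // subr_ge0 ltW.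
  move: h2 h3; rewrite expr2; move: (dot u u) (dot w u) (dot w w) => *; lra.
move=> Fnormal.
have [|s /andP[s0 s1] E1] := @MVT0 _ (fun s => dot (F z - F (z + s *: sp v)) (N z))
    (fun s => - dot ('D_(sp v) F (z + s *: sp v)) (N z)) 1 ltr01.
  move=> s sI; rewrite -dotNl; apply: is_derive_dotl.
  by rewrite -[X in is_derive _ _ _ X]sub0r; apply: is_deriveB; exact: dd.
have bs : ball z0 e (z + s *: sp v) by apply: seg; rewrite !ltW.
move: E1; rewrite -z'E scale0r addr0 subrr dot0l subr0 mulr1 => ->.
set X := 'D_(sp v) F _.
have XN : dot X (N (z + s *: sp v)) = 0.
  by rewrite dotC Fnormal //= [s *: _]mulr0 addr0.
(* X is tangent at parameter s, so its product with N vanishes there; what remains at parameter 0 is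
   the change of N along the segment. *)
have [|t /andP[t0 ts] E2] := @MVT0 _ (fun t => dot X (N (z + t *: sp v)))
    (fun t => dot X ('D_(sp v) N (z + t *: sp v))) s s0.
  move=> t /andP[t0 ts]; apply: is_derive_dotr.
  by apply: dd => //; rewrite t0 (le_trans ts) // ltW.
have bt : ball z0 e (z + t *: sp v) by apply: seg; rewrite ltW //= ltW // (lt_trans ts).
move: E2; rewrite scale0r addr0 XN sub0r => ->.
have [Ut _ Nt] := he _ bt.
have YE : 'D_(sp v) N (z + t *: sp v) = u *m (tframe_inv *m tframe N (z + t *: sp v)).
  by rewrite mulmxA vu mul_tframe //; exact: smooth_on_diff sN Ut.
have YY := dot_mulmx_le u (tframe_inv *m tframe N (z + t *: sp v)).
have XX : dot X X <= (1 + eta) ^+ 2 * dot u u.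
  have h1 := uB _ bs; have := uuB _ bs; rewrite ler_norml => /andP[_ h2].
  rewrite /X FB // !(dotDl, dotDr) [dot (_ *m _) u]dotC.
  exact: perturb_bound h1 h2.
rewrite YE; apply: rayleigh_bound h0 (dot_ge0 u) (ltW s0) (ltW s1) XX _.
exact: le_scale YY Nt (dot_ge0 u).
Qed.

End Local.

(** * Euclidean norm against sup norm, and first-order expansions *)

Section Norms.
Context {K : realType} {d : nat}.

Lemma enorm_sqr (x : 'rV[K]_d) : enorm x ^+ 2 = dot x x.
Proof. by rewrite sqr_sqrtr // dot_ge0. Qed.

Lemma mx_entry_le (x : 'rV[K]_d) i : `|x 0 i| <= `|x|.
Proof.
rewrite [leRHS]/Num.Def.normr /= mx_normrE.
exact: (le_bigmax _ (fun j => `|x j.1 j.2|) (0, i)).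
Qed.

Lemma norm_sqr_le_dot (x : 'rV[K]_d) : `|x| ^+ 2 <= dot x x.
Proof.
suff h : `|x| <= enorm x by rewrite -enorm_sqr ler_pXn2r ?nnegrE // sqrtr_ge0.
rewrite [leLHS]/Num.Def.normr /= mx_normrE bigmax_le ?sqrtr_ge0 // => -[i j] _ /=.
rewrite ord1 -sqrtr_sqr ler_wsqrtr // dotE (bigD1 j) //= -expr2 lerDl.
by apply: sumr_ge0 => k _; rewrite -expr2 sqr_ge0.
Qed.

Lemma dot_le_norm_sqr (x : 'rV[K]_d) : dot x x <= d%:R * `|x| ^+ 2.
Proof.
rewrite dotE -[d in d%:R]card_ord -sum1_card natr_sum mulr_suml.
apply: ler_sum => i _; rewrite mul1r -expr2 -real_normK ?num_real //.
by rewrite ler_pXn2r ?nnegrE // mx_entry_le.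
Qed.

End Norms.

Lemma mulmx_norm_le (K : realType) d k (A : 'M[K]_(d, k)) :
  exists2 c : K, 0 < c & forall x : 'rV[K]_d, `|x *m A| <= c * `|x|.
Proof.
pose S := \sum_i \sum_j A i j ^+ 2.
have S0 : 0 <= S by apply: sumr_ge0 => i _; apply: sumr_ge0 => j _; exact: sqr_ge0.
exists (Num.sqrt (S * d%:R) + 1); first by rewrite ltr_wpDl ?sqrtr_ge0.
move=> x; apply: (le_trans (y := Num.sqrt (S * d%:R) * `|x|)); last first.
  by rewrite ler_wpM2r // lerDl.
rewrite -(ler_pXn2r (ltn0Sn 1)) ?nnegrE ?mulr_ge0 ?sqrtr_ge0 //.
rewrite exprMn sqr_sqrtr ?mulr_ge0 //.
apply: le_trans (norm_sqr_le_dot _) (le_trans (dot_mulmx_le _ _) _).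
by rewrite -/S -mulrA ler_wpM2l // dot_le_norm_sqr.
Qed.

Section Differentials.
Context {K : realType}.

Lemma differentiable_near (E W : normedModType K) (f : E -> W) (x : E) (e : K) :
  differentiable f x -> 0 < e ->
  \forall y \near x, `|f y - f x - 'D_(y - x) f x| <= e * `|y - x|.
Proof.
move=> df e0; have /eqaddoP/(_ e e0) := diff_locally df.
rewrite /= => h.
have c : {for x, continuous (fun y : E => y - x)}.
  by apply: continuousB; [exact: cvg_id|exact: cst_continuous].
have n0 : \forall h \near 0, `|f (h + x) - f x - 'd f x h| <= e * `|h|.
  by move: h; apply: filterS => h; rewrite !fctE opprD addrA.
have n1 : nbhs (x - x) (fun h => `|f (h + x) - f x - 'd f x h| <= e * `|h|).
  by rewrite subrr.
have n2 : \forall y \near x, `|f (y - x + x) - f x - 'd f x (y - x)| <= e * `|y - x|.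
  exact: c _ n1.
by apply: filterS n2 => y; rewrite subrK -deriveE.
Qed.

Lemma is_derive_lipschitz (W : normedModType K) (c : K -> W) (w : W) :
  is_derive (0 : K) (1 : K) c w ->
  \forall s \near 0, `|c s - c 0| <= (`|w| + 1) * `|s|.
Proof.
move=> [dc <-]; have dc' : differentiable c 0 by apply/derivable1_diffP.
have := differentiable_near dc' ltr01; apply: filterS => s.
rewrite subr0 mul1r => h.
have -> : c s - c 0 = (c s - c 0 - 'D_s c 0) + 'D_s c 0 by rewrite subrK.
rewrite (le_trans (ler_normD _ _)) // mulrDl mul1r addrC lerD //.
have -> : 'D_s c 0 = s *: 'D_1 c 0 by rewrite -deriveZl // [s *: _]mulr1.
by rewrite normrZ mulrC.
Qed.

Lemma is_derive_littleo (W : normedModType K) (f : K -> W) :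
  (forall e : K, 0 < e -> \forall s \near 0, `|f s - f 0| <= e * `|s|) ->
  is_derive (0 : K) (1 : K) f 0.
Proof.
move=> h.
have l : (fun h : K => h^-1 *: ((f \o shift 0) (h *: (1 : K)) - f 0)) @ 0^' --> (0 : W).
  apply/cvgrPdist_le => e e0; rewrite near_withinE; apply: filterS (h e e0).
  move=> s hs sn; rewrite sub0r normrN normrZ normfV /= addr0 [s *: 1]mulr1.
  by rewrite ler_pdivrMl ?normr_gt0 // mulrC.
apply: DeriveDef; first by apply/cvg_ex; exists 0.
exact: cvg_lim l.
Qed.

End Differentials.

(** * From charts of the flow to smooth patches; identification of [second_ff] *)

Section Chart.
Context {K : realType} {n : nat}.
Local Notation E := ('rV[K]_n * K)%type.
Local Notation V := 'rV[K]_n.+1.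
Local Notation sp v := ((v, 0) : E).
Local Notation dt := ((0, 1) : E).

Variables (a b : K) (M : K -> set V) (nu : K -> V -> V).
Hypothesis M_normal : forall t x, a <= t <= b -> M t x -> unit_normal (M t) x (nu t x).
Variables (U : set E) (F N : E -> V).
Let Uab := U `&` [set z | a <= z.2 <= b].
Hypotheses (oU : open U) (sF : smooth_on U F) (sN : smooth_on U N)
  (immersed : forall z, Uab z -> forall v, 'D_(sp v) F z = 0 -> v = 0)
  (homeo : forall P, open P -> P `<=` U -> exists2 O, open O &
     (fun z => (F z, z.2)) @` (P `&` Uab) = track a b M `&` O)
  (NE : forall z, Uab z -> nu z.2 (F z) = N z).

Let scale_bound (k x d v : K) : 0 < k -> x <= d * v -> k * x <= d * k * v.
Proof. by move=> k0 xd; rewrite [d * k]mulrC -mulrA ler_wpM2l // ltW. Qed.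

Lemma same_time_sub (y z : E) : y.2 = z.2 -> y - z = sp (y.1 - z.1).
Proof. by case: y z => [p t] [q t'] /= ->; congr pair; rewrite /= subrr. Qed.

Lemma chart_mem z : Uab z -> M z.2 (F z).
Proof.
move=> Uz; have [Q _ EG] := homeo oU (@subset_refl _ U).
have : ((fun z => (F z, z.2)) @` (U `&` Uab)) (F z, z.2).
  by exists z => //; split=> //; case: Uz.
by rewrite EG => -[[]].
Qed.

(** Embeddedness: every point of the track close to (F z, z.2) has a preimage in P, so no other
    sheet comes near. *)
Lemma chart_inv (P : set E) z : open P -> P `<=` U -> P z -> Uab z ->
  exists O : set (V * K), [/\ open O, O (F z, z.2) &
    forall x t, O (x, t) -> a <= t <= b -> M t x ->
      exists z', [/\ P z', Uab z', F z' = x & z'.2 = t]].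
Proof.
move=> oP PU Pz Uz; have [Q oQ EG] := homeo oP PU.
have : ((fun z => (F z, z.2)) @` (P `&` Uab)) (F z, z.2) by exists z.
rewrite EG => -[_ Qz]; exists Q; split=> // x t Qx tab Mx.
have : (track a b M `&` Q) (x, t) by [].
by rewrite -EG => -[z' [Pz' Uz'] [<- <-]]; exists z'.
Qed.

Lemma chart_curve z v : Uab z ->
  curve_through (M z.2) (F z) (fun s => F (z + s *: sp v)) /\
  is_derive (0 : K) (1 : K) (fun s => F (z + s *: sp v)) ('D_(sp v) F z).
Proof.
move=> Uz; have z0 : z + (0 : K) *: sp v = z by rewrite scale0r addr0.
split.
  split; first by rewrite z0.
  have [Uz1 Uz2] := Uz.
  apply: filterS (line_near (sp v) oU Uz1) => s Us.
  have e : (z + s *: sp v).2 = z.2 by rewrite /= [s *: _]mulr0 addr0.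
  by rewrite -e; apply: chart_mem; split=> //=; rewrite [s *: _]mulr0 addr0.
rewrite -[in 'D_(sp v) _ _]z0; apply: is_derive_curve; first exact: is_derive_line.
by rewrite z0; apply: smooth_on_diff sF _; case: Uz.
Qed.

Lemma chart_normal z v : Uab z -> dot (N z) ('D_(sp v) F z) = 0.
Proof.
move=> Uz; have [c dc] := chart_curve v Uz; rewrite -NE //.
have [_] := M_normal (proj2 Uz) (chart_mem Uz); apply.
by exists (fun s => F (z + s *: sp v)).
Qed.

Lemma chart_unit z : Uab z -> dot (N z) (N z) = 1.
Proof.
move=> Uz; have [e1 _] := M_normal (proj2 Uz) (chart_mem Uz).
by rewrite -enorm_sqr -NE // e1 expr1n.
Qed.

Lemma chart_shape_unique z A : Uab z -> is_second_ff (M z.2) (nu z.2) (F z) A ->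
  A = local_shape F N z.
Proof.
move=> Uz [nA hA]; have Uz1 := proj1 Uz.
have dF := smooth_on_diff sF Uz1; have dN := smooth_on_diff sN Uz1.
apply: (shape_operator_unique (P := tframe F z) (nu := N z)) => [|v|v|||].
- exact: chart_unit.
- by rewrite mul_tframe // dotC chart_normal.
- by rewrite mul_tframe //; exact: immersed.
- apply/row_matrixP => i; rewrite !row_mul !rowE; set v := delta_mx _ _.
  rewrite mul_tframe //.
  rewrite (local_shapeP sF sN Uz1 (immersed Uz) (fun v => chart_normal v Uz)).
  have [c dc] := chart_curve v Uz; have h := hA _ _ c dc.
  have z0 : z + (0 : K) *: sp v = z by rewrite scale0r addr0.
  have h2 : is_derive (0 : K) (1 : K) (fun s => N (z + s *: sp v)) ('D_(sp v) N z).
    rewrite -[in 'D_(sp v) _ _]z0; apply: is_derive_curve; first exact: is_derive_line.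
    by rewrite z0.
  apply: is_derive_uniq h (near_eq_is_derive _ h2).
  apply: filterS (line_near (sp v) oU Uz1) => s Us.
  have e : (z + s *: sp v).2 = z.2 by rewrite /= [s *: _]mulr0 addr0.
  rewrite -NE /=; first by rewrite [s *: _]mulr0 addr0.
  by split=> //; rewrite /= [s *: _]mulr0 addr0; exact: (proj2 Uz).
- by rewrite -NE.
- by apply: local_shape_normal; exact: chart_unit.
Qed.

(** [is_second_ff] tests arbitrary curves in the hypersurface that are differentiable at 0, and
    these need not lift differentiably to the chart. Instead, N - F A has zero spatial differential
    at z, chart displacement is at most a constant times |F y - F z|, and the curve is Lipschitz at
    0; hence nu - x A changes by o(s) along it. *)
Lemma chart_second_ff_exists z : Uab z ->
  is_second_ff (M z.2) (nu z.2) (F z) (local_shape F N z).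
Proof.
move=> Uz; have Uz1 := proj1 Uz.
have dF := smooth_on_diff sF Uz1; have dN := smooth_on_diff sN Uz1.
set A := local_shape F N z.
split; first by rewrite NE //; apply: local_shape_normal; exact: chart_unit.
move=> c w [c0 cM] dc.
have dcA : is_derive (0 : K) (1 : K) (fun s => c s *m A) (w *m A).
  apply: is_derive_eq (is_derive_mulmx dc (is_derive_cst A (0 : K) (1 : K))) _.
  by rewrite mulmx0 addr0.
suff h : is_derive (0 : K) (1 : K) (fun s => nu z.2 (c s) - c s *m A) 0.
  rewrite -[w *m A]add0r (_ : nu z.2 \o c =
    (fun s => nu z.2 (c s) - c s *m A) + (fun s => c s *m A)); first exact: is_deriveD.
  by apply/funext => s; rewrite !fctE subrK.
pose h := 1 + \sum_i \sum_j A i j ^+ 2.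
have S0 : 0 <= \sum_i \sum_j A i j ^+ 2.
  by apply: sumr_ge0 => i _; apply: sumr_ge0 => j _; exact: sqr_ge0.
have h1 : 1 <= h by rewrite lerDl.
have hA : \sum_i \sum_j A i j ^+ 2 <= h ^+ 2.
  have aux (x : K) : 0 <= x -> x <= (1 + x) ^+ 2 by rewrite expr2; nra.
  exact: aux.
have half : 0 < (1 / 2 : K) < 1 by lra.
have [r r0 [rU rest]] := local_estimates oU sF sN Uz1 (immersed Uz)
  (fun v => chart_normal v Uz) half (lt_le_trans ltr01 h1) hA.
pose B := tframe_inv F N z.
pose S := \sum_i \sum_j B i j ^+ 2.
have S1 : 0 <= S by apply: sumr_ge0 => i _; apply: sumr_ge0 => j _; exact: sqr_ge0.
(* The inverse chart is Lipschitz at z on the time slice, by the lower chord bound with eta =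
   1/2. *)
have vle y : ball z r y -> y.2 = z.2 ->
    `|y.1 - z.1| ^+ 2 <= 4 * S * n.+1%:R * `|F y - F z| ^+ 2.
  move=> yr yz; have [+ _] := rest z y (ballxx _ r0) yr (esym yz).
  set u := 'D_(sp (y.1 - z.1)) F z => hu.
  have uB : u *m B = y.1 - z.1 by apply: tframe_invK => // v; [exact: immersed|exact: chart_normal].
  rewrite -uB; apply: le_trans (norm_sqr_le_dot _) (le_trans (dot_mulmx_le _ _) _).
  rewrite -/S (_ : 4 * S * _ * _ = S * (4 * (n.+1%:R * `|F y - F z| ^+ 2))); last by ring.
  rewrite ler_wpM2l //; have := dot_le_norm_sqr (F y - F z).
  move: hu; move: (dot u u) (dot (F y - F z) _) (_ * _ ^+ 2) => p q X.
  rewrite (_ : (1 - 1 / 2) ^+ 2 = 1 / 4 :> K); last by field.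
  lra.
pose C := Num.sqrt (4 * S * n.+1%:R) + 1.
have C0 : 0 < C by rewrite ltr_wpDl ?sqrtr_ge0.
have vle2 y : ball z r y -> y.2 = z.2 -> `|y.1 - z.1| <= C * `|F y - F z|.
  move=> yr yz; apply: (le_trans (y := Num.sqrt (4 * S * n.+1%:R) * `|F y - F z|)).
    rewrite -(ler_pXn2r (ltn0Sn 1)) ?nnegrE ?mulr_ge0 ?sqrtr_ge0 //.
    by rewrite exprMn sqr_sqrtr ?mulr_ge0 // vle.
  by rewrite ler_wpM2r // lerDl.
have [k k0 Ak] := mulmx_norm_le A.
apply: is_derive_littleo => e e0.
(* The product of the three Lipschitz constants is divided out, so that the final bound is
   [e * |s|]. *)
pose del := e / ((1 + k) * (C * (`|w| + 1))).
have w1 : 0 < `|w| + 1 by rewrite ltr_wpDl.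
have k1 : 0 < 1 + k by rewrite addr_gt0.
have den0 : 0 < (1 + k) * (C * (`|w| + 1)) by rewrite mulr_gt0 // mulr_gt0.
have del0 : 0 < del by rewrite divr_gt0.
pose g y := N y - F y *m A.
have n1 := differentiable_near dF del0; have n2 := differentiable_near dN del0.
have [r1 /= r10 hr1] := (nbhs_ballP _ _).1 n1.
have [r2 /= r20 hr2] := (nbhs_ballP _ _).1 n2.
have gle y : ball z r1 y -> ball z r2 y -> y.2 = z.2 ->
    `|g y - g z| <= del * (1 + k) * `|y.1 - z.1|.
  move=> /hr1 h3 /hr2 h4 yz.
  have yE : y - z = sp (y.1 - z.1).
    exact: same_time_sub.
  have nE : `|y - z| = `|y.1 - z.1|.
    by rewrite yE prod_normE /= normr0; apply/max_idPl.
  rewrite nE yE in h3 h4.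
  have sA := local_shapeP sF sN Uz1 (immersed Uz) (fun v => chart_normal v Uz) (y.1 - z.1).
  have -> : g y - g z = (N y - N z - 'D_(sp (y.1 - z.1)) N z) -
      (F y - F z - 'D_(sp (y.1 - z.1)) F z) *m A.
    rewrite /g !mulmxBl sA.
    move: (N y) (N z) ('D_(sp (y.1 - z.1)) N z) (F y *m A) (F z *m A) => *.
    by apply/rowP => i; rewrite !mxE; ring.
  rewrite mulrDr mulr1 mulrDl (le_trans (ler_normB _ _)) // lerD //.
  exact: le_trans (Ak _) (scale_bound k0 h3).
pose P := ball z (Num.min r (Num.min r1 r2)).
have rr0 : 0 < Num.min r (Num.min r1 r2) by rewrite !lt_min r0 r10.
have Pr : P `<=` ball z r by apply: le_ball; rewrite !ge_min lexx.
have Pr1 : P `<=` ball z r1 by apply: le_ball; rewrite !ge_min lexx orbT.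
have Pr2 : P `<=` ball z r2 by apply: le_ball; rewrite !ge_min lexx !orbT.
have [Q [oQ Qz hQ]] := chart_inv (ball_open z _) (subset_trans Pr rU) (ballxx z rr0 : P z) Uz.
have cc : {for 0, continuous c}.
  by apply/differentiable_continuous/derivable1_diffP; case: dc.
have nQ : \forall s \near (0 : K), Q (c s, z.2).
  have cp : (fun s => (c s, z.2)) @ (0 : K) --> (c 0, z.2).
    exact: (cvg_pair cc (cvg_cst z.2)).
  by apply: cp; rewrite c0; exact: open_nbhs_nbhs.
have nL := is_derive_lipschitz dc.
apply: filterS3 nQ cM nL => s Qs Ms Ls.
have [z' [Pz' Uz' Fz' zz']] := hQ _ _ Qs (proj2 Uz) Ms.
rewrite c0 (NE Uz) -Fz' -zz' (NE Uz').
rewrite -/(g z') -/(g z).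
apply: le_trans (gle _ (Pr1 _ Pz') (Pr2 _ Pz') zz') _.
have h5 : `|z'.1 - z.1| <= C * ((`|w| + 1) * `|s|).
  apply: le_trans (vle2 _ (Pr _ Pz') zz') _.
  by rewrite ler_wpM2l ?(ltW C0) // Fz' -c0.
apply: (le_trans (y := del * (1 + k) * (C * ((`|w| + 1) * `|s|)))).
  by rewrite ler_wpM2l // mulr_ge0 ?(ltW del0) ?(ltW k1).
rewrite (_ : _ * _ = del * ((1 + k) * (C * (`|w| + 1))) * `|s|); last by ring.
by rewrite /del divfK // lt0r_neq0.
Qed.

Lemma chart_second_ff z : Uab z ->
  second_ff (M z.2) (nu z.2) (F z) = local_shape F N z.
Proof.
move=> Uz; apply: chart_shape_unique => //; rewrite /second_ff.
by apply: xgetPex; exists (local_shape F N z); exact: chart_second_ff_exists.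
Qed.

Hypothesis flowE : forall z, Uab z ->
  'D_dt F z = - mean_curv (M z.2) (nu z.2) (F z) *: nu z.2 (F z).

(** The mean curvature read off from the flow equation. Unlike [mean_curv], it is visibly smooth,
    and on all of U, even beyond the time interval. *)
Definition chart_speed z : K := - dot ('D_dt F z) (N z).

Lemma chart_speedE z : Uab z -> chart_speed z = mean_curv (M z.2) (nu z.2) (F z).
Proof.
move=> Uz; rewrite /chart_speed flowE // NE // dotZl chart_unit // mulr1 opprK //.
Qed.

Lemma smooth_chart_speed : smooth_on U chart_speed.
Proof. by apply: smooth_onN => //; apply: smooth_on_dot => //; exact: smooth_on_derive. Qed.

Lemma chart_patch (U1 : set E) : open U1 -> U1 `<=` Uab ->
  mcf_patch U1 F N chart_speed (fun z => second_ff (M z.2) (nu z.2) (F z)).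
Proof.
move=> oU1 U1ab; have U1U : U1 `<=` U by move=> z /U1ab[].
split=> //.
- exact: smooth_on_sub sF.
- exact: smooth_on_sub sN.
- exact: smooth_on_sub smooth_chart_speed.
- by move=> z /U1ab; exact: chart_unit.
- by move=> z v /U1ab; exact: chart_normal.
- by move=> z v /U1ab/immersed; apply.
- by move=> z /U1ab Uz; rewrite flowE // chart_speedE // NE.
- move=> z v /U1ab Uz; rewrite chart_second_ff //.
  exact: (local_shapeP sF sN (proj1 Uz) (immersed Uz) (fun v => chart_normal v Uz)).
- by move=> z /U1ab Uz; rewrite chart_second_ff //; apply: local_shape_normal; exact: chart_unit.
- by move=> z /U1ab Uz; rewrite chart_speedE.
Qed.

Lemma normA_bounded (U1 : set E) (C : K) :
  (forall z, U1 z -> normA (M z.2) (nu z.2) (F z) <= C) ->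
  shape_bounded U1 (fun z => second_ff (M z.2) (nu z.2) (F z)).
Proof.
move=> AC; exists C => z Uz i j; apply: le_trans (AC z Uz).
rewrite -sqrtr_sqr ler_wsqrtr // (bigD1 i) //= (bigD1 j) //= -addrA lerDl addr_ge0 //.
  by apply: sumr_ge0 => k _; exact: sqr_ge0.
by apply: sumr_ge0 => k _; apply: sumr_ge0 => l _; exact: sqr_ge0.
Qed.

(** Continuity in chart coordinates descends to the track because the chart is open onto it. *)
Lemma chart_cvg (T : topologicalType) (f : V * K -> T) (g : E -> T) z : Uab z ->
  {for z, continuous g} -> (forall y, Uab y -> f (F y, y.2) = g y) ->
  f @ within (track a b M) (nbhs (F z, z.2)) --> f (F z, z.2).
Proof.
move=> Uz cg fg Q; rewrite fg // => /cg gQ.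
have [P [oP Pz PQ]] : exists P, [/\ open P, P z & P `<=` U `&` (g @^-1` Q)].
  have : nbhs z (U `&` (g @^-1` Q)).
    exact: (filterI (open_nbhs_nbhs (conj oU (proj1 Uz))) gQ).
  by rewrite nbhsE => -[P [oP Pz] PQ]; exists P.
have [D [oD Dz hD]] := chart_inv oP (fun y Py => proj1 (PQ y Py)) Pz Uz.
change (nbhs (F z, z.2) (fun y => track a b M y -> Q (f y))).
apply: filterS (open_nbhs_nbhs (conj oD Dz)) => -[x t] Dxt [/= tab Mx].
have [y [Py Uy <- <-]] := hD _ _ Dxt tab Mx.
by rewrite fg //; exact: (proj2 (PQ y Py)).
Qed.

End Chart.

Lemma open_setX (T1 T2 : topologicalType) (A : set T1) (B : set T2) :
  open A -> open B -> open (A `*` B).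
Proof.
move=> oA oB; rewrite openE => -[x y] [Ax By]; exists (A, B) => //=.
by split; exact: open_nbhs_nbhs.
Qed.

(** * Limits of the quantities in the quotient; compact Euclidean balls *)

Section Limits.
Context {K : realType} {T : Type}.

Lemma cvg_dot d (G : set_system T) (f g : T -> 'rV[K]_d) (f0 g0 : 'rV[K]_d) {FG : Filter G} :
  f @ G --> f0 -> g @ G --> g0 -> (fun x => dot (f x) (g x)) @ G --> dot f0 g0.
Proof.
move=> cf cg.
have -> : (fun x => dot (f x) (g x)) = (fun x => \sum_i f x 0 i * g x 0 i).
  by apply/funext => x; rewrite dotE.
rewrite dotE; apply: (cvg_big add_continuous) => i _.
apply: cvgM.
  exact: (cvg_comp _ _ cf (@coord_continuous _ _ _ 0 i f0)).
exact: (cvg_comp _ _ cg (@coord_continuous _ _ _ 0 i g0)).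
Qed.

Lemma cvg_cutoff n r (G : set_system T) (f : T -> 'rV[K]_n.+1) (t : T -> K)
  (f0 : 'rV[K]_n.+1) (t0 : K) {FG : Filter G} : f @ G --> f0 -> t @ G --> t0 ->
  (fun x => cutoff r (f x) (t x)) @ G --> cutoff r f0 t0.
Proof.
move=> cf ct; apply: cvgB; first exact: cvg_cst.
apply: cvgM; last exact: cvg_cst.
by apply: cvgD; [apply: cvgM => //; exact: cvg_cst|exact: cvg_dot].
Qed.

Lemma cvg_exp4 (G : set_system T) (f : T -> K) (f0 : K) {FG : Filter G} :
  f @ G --> f0 -> (fun x => f x ^+ 4) @ G --> f0 ^+ 4.
Proof.
move=> cf; rewrite (_ : (fun x => _) = (fun x => f x * f x * (f x * f x))).
  by rewrite (_ : f0 ^+ 4 = f0 * f0 * (f0 * f0)); [do 2!apply: cvgM|ring].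
by apply/funext => x; ring.
Qed.

End Limits.

Section CompactBalls.
Context {K : realType} {d : nat}.

Lemma dot_continuous : continuous (fun x : 'rV[K]_d => dot x x : K).
Proof. by move=> x; apply: (@cvg_dot _ _ _ (nbhs x) id id); exact: cvg_id. Qed.

Lemma closed_ball_compact (c : K) : compact [set x : 'rV[K]_d | dot x x <= c].
Proof.
apply: bounded_closed_compact.
  exists (`|c| + 1); split; first exact: num_real.
  move=> B cB x /= xc.
  have h : `|x| ^+ 2 <= `|c| := le_trans (norm_sqr_le_dot x) (le_trans xc (ler_norm c)).
  apply: le_trans (ltW cB); rewrite -(ler_pXn2r (ltn0Sn 1)) ?nnegrE ?addr_ge0 //.
  apply: le_trans h _; have := normr_ge0 c; move: (`|c|) => q q0; rewrite expr2; nra.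
apply: (@preimage_closed _ _ (fun x : 'rV[K]_d => dot x x : K) [set y | y <= c]) => //.
  by move=> x _; exact: dot_continuous.
Qed.

End CompactBalls.

(** * The two-point estimate near the diagonal *)

Section ChartData.
Context {K : realType} {n : nat}.
Local Notation E := ('rV[K]_n * K)%type.
Local Notation V := 'rV[K]_n.+1.
Local Notation sp v := ((v, 0) : E).
Local Notation dt := ((0, 1) : E).

Record chart_data (a b : K) (M : K -> set V) (nu : K -> V -> V) (U : set E)
    (F N : E -> V) : Prop := ChartData {
  chart_open : open U;
  chart_F : smooth_on U F;
  chart_N : smooth_on U N;
  chart_immersed : forall z, (U `&` [set z | a <= z.2 <= b]) z ->
    forall v, 'D_(sp v) F z = 0 -> v = 0;
  chart_homeo : forall P, open P -> P `<=` U -> exists2 O, open O &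
    (fun z => (F z, z.2)) @` (P `&` (U `&` [set z | a <= z.2 <= b])) =
    track a b M `&` O;
  chart_nu : forall z, (U `&` [set z | a <= z.2 <= b]) z -> nu z.2 (F z) = N z;
  chart_flow : forall z, (U `&` [set z | a <= z.2 <= b]) z ->
    'D_dt F z = - mean_curv (M z.2) (nu z.2) (F z) *: nu z.2 (F z) }.

Lemma mcf_chart_data a b (B : set V) M nu t x : embedded_mcf a b B M nu ->
  a <= t <= b -> M t x ->
  exists (U : set E) (F N : E -> V) z, [/\ chart_data a b M nu U F N,
    (U `&` [set z | a <= z.2 <= b]) z, F z = x & z.2 = t].
Proof.
move=> [_ _ _ ch] tab Mx; have [W [J [F [hc [p [Wp Jt Fx]]]]]] := ch t x tab Mx.
case: hc => -[oW oJ sF] [imm [_ homeo] [N sN NE] fl].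
exists (W `*` J), F, N, (p, t); split=> //; split=> //.
exact: open_setX.
Qed.

Section ChartUse.
Variables (a b : K) (M : K -> set V) (nu : K -> V -> V).
Hypothesis M_normal : forall t x, a <= t <= b -> M t x -> unit_normal (M t) x (nu t x).
Variables (U : set E) (F N : E -> V).
Hypothesis hC : chart_data a b M nu U F N.
Let Uab := U `&` [set z | a <= z.2 <= b].

Lemma chart_dataE z : Uab z ->
  [/\ second_ff (M z.2) (nu z.2) (F z) = local_shape F N z,
    chart_speed F N z = mean_curv (M z.2) (nu z.2) (F z),
    M z.2 (F z), nu z.2 (F z) = N z & dot (N z) (N z) = 1].
Proof.
move=> Uz; case: hC => oU sF sN imm homeo NE fl; split.
- exact: (chart_second_ff M_normal oU sF sN imm homeo NE).
- exact: (chart_speedE M_normal oU homeo NE fl).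
- exact: (chart_mem oU homeo).
- exact: NE.
- exact: (chart_unit M_normal oU homeo NE).
Qed.

(** Numerically (17/15)^2 = 289/225 < 3/2 = 2 (3/4): the factor 2 in the conclusion absorbs both the
    distortion of chords and a drop of H to three quarters. *)
Let near_diagonal_bound (Lam h s u X Y : K) : 0 < Lam -> 0 < Lam * h -> 0 <= u ->
  (1 - 1 / 16) ^+ 2 * u <= Y -> X <= Lam * h * (1 + 1 / 16) ^+ 2 * u ->
  3 / 4 * h < s -> X <= 2 * Lam * s * Y.
Proof.
move=> L0 Lh u0 hY hX hs.
have e1 : (1 - 1 / 16) ^+ 2 = 225 / 256 :> K by field.
have e2 : (1 + 1 / 16) ^+ 2 = 289 / 256 :> K by field.
rewrite e1 in hY; rewrite e2 in hX.
have Y0 : 0 <= Y by lra.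
have h1 : 2 * (3 / 4) * (Lam * h) * Y <= 2 * Lam * s * Y.
  have h4 : Lam * (3 / 4 * h) <= Lam * s by rewrite ler_wpM2l // ltW.
  by rewrite ler_wpM2r //; lra.
have h2 : 2 * (3 / 4) * (Lam * h) * (225 / 256 * u) <= 2 * (3 / 4) * (Lam * h) * Y.
  have h5 : Lam * h * (225 / 256 * u) <= Lam * h * Y by rewrite ler_wpM2l // ltW.
  lra.
have h3 : 0 <= Lam * h * u by rewrite mulr_ge0 // ltW.
lra.
Qed.

(** Nearby points of one slice lie in a single chart, where the height over the tangent plane is at
    most slightly more than Lam H |x - y|^2. The neighbourhood D lives in space-time, so it serves
    nearby times as well. *)
Lemma near_diagonal (Lam : K) z : 0 < Lam -> Uab z ->
  0 < mean_curv (M z.2) (nu z.2) (F z) ->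
  normA (M z.2) (nu z.2) (F z) <= Lam * mean_curv (M z.2) (nu z.2) (F z) ->
  exists D : set (V * K), [/\ open D, D (F z, z.2) &
    forall x y t, D (x, t) -> D (y, t) -> a <= t <= b -> M t x -> M t y ->
      0 < mean_curv (M t) (nu t) x /\
      dot (x - y) (nu t x) <=
        2 * Lam * mean_curv (M t) (nu t) x * dot (x - y) (x - y)].
Proof.
move=> L0 Uz H0 AH; case: (hC) => oU sF sN imm homeo NE fl.
have Uz1 := proj1 Uz.
have [shE spE _ _ nu1] := chart_dataE Uz.
have eta : 0 < (1 / 16 : K) < 1 by lra.
set h0 := mean_curv _ _ _ in H0 AH spE.
have h00 : 0 < Lam * h0 by rewrite mulr_gt0.
have Ah : \sum_i \sum_j local_shape F N z i j ^+ 2 <= (Lam * h0) ^+ 2.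
  rewrite -shE -ler_sqrt ?sqr_ge0 // ?sqrtr_sqr ?ger0_norm ?(ltW h00) //.
have chn y v : Uab y -> dot (N y) ('D_(sp v) F y) = 0.
  exact: (chart_normal M_normal oU sF homeo NE).
have [e e0 [eU est]] := local_estimates oU sF sN Uz1 (imm z Uz)
  (fun v => chn z v Uz) eta h00 Ah.
have csp : {for z, continuous (chart_speed F N)}.
  exact: smooth_on_cont (smooth_chart_speed oU sF sN) Uz1.
have nsp : \forall y \near z, 3 / 4 * h0 < chart_speed F N y.
  have hlt : 3 / 4 * h0 < chart_speed F N z by rewrite spE; lra.
  exact: csp _ (lt_nbhsr hlt).
have [e1 /= e10 he1] := (nbhs_ballP _ _).1 nsp.
pose P := ball z (Num.min e e1).
have ee0 : 0 < Num.min e e1 by rewrite lt_min e0.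
have Pe : P `<=` ball z e by apply: le_ball; rewrite ge_min lexx.
have Pe1 : P `<=` ball z e1 by apply: le_ball; rewrite ge_min lexx orbT.
have [D [oD Dz hD]] := chart_inv homeo (ball_open z _) (subset_trans Pe eU) (ballxx z ee0 : P z) Uz.
exists D; split=> // x y t Dx Dy tab Mx My.
have [p [Pp Up Ep pt]] := hD _ _ Dx tab Mx.
have [q [Pq Uq Eq qt]] := hD _ _ Dy tab My.
have [_ spp _ nup _] := chart_dataE Up.
rewrite -Ep -Eq -pt -spp nup; have h3 := he1 p (Pe1 _ Pp).
have [b1 b2] := est p q (Pe _ Pp) (Pe _ Pq) (etrans pt (esym qt)).
split; first by apply: lt_trans h3; rewrite mulr_gt0 // divr_gt0.
have Fn (w : E) v : ball z e w -> w.2 = p.2 -> dot (N w) ('D_(sp v) F w) = 0.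
  by move=> Bw wp; apply: chn; split; [exact: eU|rewrite /= wp pt].
have {}b2 := b2 Fn.
have sym : dot (F q - F p) (F q - F p) = dot (F p - F q) (F p - F q).
  by rewrite -(opprB (F p)) dotNl dotNr opprK.
rewrite sym in b1.
exact: near_diagonal_bound L0 h00 (dot_ge0 _) b1 b2 h3.
Qed.

End ChartUse.
End ChartData.

(** For n = 0 the tangential projection has trace 0, hence vanishes, and so does H. This excludes
    the dimension in which the cutoff would have no drift. *)
Lemma patch_dim_gt0 (K : realType) (n : nat) (U : set ('rV[K]_n * K))
    (F N : 'rV[K]_n * K -> 'rV[K]_n.+1) (H : 'rV[K]_n * K -> K)
    (A : 'rV[K]_n * K -> 'M[K]_n.+1) z :
  mcf_patch U F N H A -> U z -> 0 < H z -> (0 < n)%N.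
Proof.
move=> hP Uz; have nu1 := patch_unit hP Uz; have PiT := tproj_gram nu1.
rewrite (patch_trace hP Uz) lt0n => H0; apply/eqP => n0.
have n0R : n%:R = 0 :> K by rewrite n0.
have := trace_tproj nu1; rewrite -{1}PiT mxtrace_tr_mul n0R => /eqP.
rewrite psumr_eq0 => [/allP r0|i _]; last exact: dot_ge0.
move: H0; rewrite -(frame_trace (patch_shape_normal hP Uz) PiT) big1 ?ltxx // => i _.
have /eqP/dot_eq0 -> := r0 i (mem_index_enum i).
by rewrite dot0r.
Qed.

(** * The maximum principle for pairs of points *)

Section Noncollapsing.
Context {K : realType} {n : nat}.
Local Notation E := ('rV[K]_n * K)%type.
Local Notation V := 'rV[K]_n.+1.
Local Notation sp v := ((v, 0) : E).
Local Notation dt := ((0, 1) : E).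

Variables (R r Lam : K) (M : K -> set V) (nu : K -> V -> V).
Let H x t := mean_curv (M t) (nu t) x.
Let a : K := - r ^+ 2.
Let c0 : K := 1 + 3 * n%:R.
Hypotheses (R_gt0 : 0 < R) (r_gt0 : 0 < r) (Lam_gt0 : 0 < Lam)
  (Rr : Num.sqrt c0 * r <= R)
  (flow : embedded_mcf a 0 (eball0 (3 * R)) M nu)
  (pinching : forall t x, a <= t <= 0 -> (M t `&` eball0 (Num.sqrt c0 * r)) x ->
     R^-1 <= Lam * H x t /\ normA (M t) (nu t) x <= Lam * H x t)
  (initial : forall x y, (M a `&` eball0 (Num.sqrt c0 * r)) x ->
     (M a `&` eball0 (3 * R)) y ->
     0 <= 1 / 2 * Lam * H x a * enorm (x - y) ^+ 2 - dot (x - y) (nu a x)).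

Let M_normal t x : a <= t <= 0 -> M t x -> unit_normal (M t) x (nu t x).
Proof. by case: flow => _ _ h _; exact: h. Qed.

Let c0_ge1 : 1 <= c0. Proof. by rewrite /c0 lerDl mulr_ge0. Qed.
Let r2 : 0 < r ^+ 2. Proof. by rewrite exprn_gt0. Qed.

Let cutoff_le t (x : V) : a <= t -> cutoff r x t <= c0.
Proof.
move=> at_; rewrite /cutoff lerBlDr -lerBlDl ler_pdivlMr //.
have h0 := dot_ge0 x.
have h1 : 3 * n%:R * a <= 3 * n%:R * t by rewrite ler_wpM2l // mulr_ge0.
apply: le_trans (_ : 3 * n%:R * a <= _); last by lra.
rewrite /a /c0 mulrN -mulNr ler_wpM2r ?(ltW r2) //; lra.
Qed.

Let cutoff_dot t (x : V) : a <= t -> 0 <= cutoff r x t -> dot x x < c0 * r ^+ 2.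
Proof.
move=> at_; rewrite /cutoff subr_ge0 ler_pdivrMr // => h.
have h1 : 3 * n%:R * a <= 3 * n%:R * t by rewrite ler_wpM2l // mulr_ge0.
by move: h h1 r2; rewrite /a /c0; move: (n%:R : K) (dot x x) (r ^+ 2) => m d q; lra.
Qed.

Let cutoff_ball t (x : V) : a <= t -> 0 <= cutoff r x t -> eball0 (Num.sqrt c0 * r) x.
Proof.
move=> at_ /(cutoff_dot at_) h; rewrite /eball0 /=.
rewrite -(ltr_pXn2r (ltn0Sn 1)) ?nnegrE ?sqrtr_ge0 ?mulr_ge0 ?sqrtr_ge0 ?(ltW r_gt0) //.
by rewrite enorm_sqr exprMn sqr_sqrtr // (le_trans ler01).
Qed.

Let cutoff_R t (x : V) : a <= t -> 0 <= cutoff r x t -> dot x x <= R ^+ 2.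
Proof.
move=> at_ /(cutoff_ball at_); rewrite /eball0 /= => h.
rewrite -enorm_sqr ler_pXn2r ?nnegrE ?sqrtr_ge0 ?(ltW R_gt0) //.
exact: le_trans (ltW h) Rr.
Qed.

Let pinched t (x : V) : a <= t <= 0 -> M t x -> 0 <= cutoff r x t ->
  [/\ 0 < H x t, R^-1 <= Lam * H x t & normA (M t) (nu t) x <= Lam * H x t].
Proof.
move=> tab Mx phi0; have [|h1 h2] := pinching tab (x := x).
  by split=> //; apply: cutoff_ball phi0; case/andP: tab.
split=> //; have : 0 < Lam * H x t by apply: lt_le_trans h1; rewrite invr_gt0.
by rewrite pmulr_rgt0.
Qed.

(** The quotient bounded by c, cleared of denominators so that it also makes sense on the
    diagonal. *)
Definition pair_bound (c : K) (x y : V) (t : K) :=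
  dot (x - y) (nu t x) * cutoff r x t ^+ 4 <= c * H x t * dot (x - y) (x - y).

(** If m > c', then Phi / 4 = m H / (2 cutoff^4) exceeds Lam H, which bounds |A|. Pairs near the
    diagonal, far pairs and initial pairs all obey the bound with c'. *)
Let c' := 2 * Lam * c0 ^+ 4.

Let bound_of_strong t x y : a <= t <= 0 -> M t x -> 0 <= cutoff r x t ->
  dot (x - y) (nu t x) <= 2 * Lam * H x t * dot (x - y) (x - y) ->
  pair_bound c' x y t.
Proof.
move=> tab Mx phi0 h; have [H0 _ _] := pinched tab Mx phi0.
have p4 : 0 <= cutoff r x t ^+ 4 by rewrite exprn_ge0.
have p4c : cutoff r x t ^+ 4 <= c0 ^+ 4.
  apply: lerXn2r; rewrite ?nnegrE //; first exact: le_trans ler01 c0_ge1.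
  by apply: cutoff_le; case/andP: tab.
rewrite /pair_bound /c'; apply: le_trans (ler_wpM2r p4 h) _.
have X0 : 0 <= 2 * Lam * H x t * dot (x - y) (x - y).
  by rewrite !mulr_ge0 ?dot_ge0 // ltW.
apply: le_trans (ler_wpM2l X0 p4c) _.
by rewrite le_eqVlt; apply/orP; left; apply/eqP; ring.
Qed.

(** |x| <= R and |y| > 2 R give |x - y| >= R. Then <x - y, nu> is at most (2 / R) |x - y|^2 by
    Young's inequality with weight 2 / R, and 1 / R <= Lam H. *)
Let far_bound t x y : a <= t <= 0 -> M t x -> 0 <= cutoff r x t ->
  4 * R ^+ 2 < dot y y -> pair_bound c' x y t.
Proof.
move=> tab Mx phi0 hy; have [H0 hR _] := pinched tab Mx phi0.
apply: bound_of_strong => //.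
have nu1 : dot (nu t x) (nu t x) = 1.
  by have [e1 _] := M_normal tab Mx; rewrite -enorm_sqr e1 expr1n.
have hx : dot x x <= R ^+ 2 by apply: cutoff_R phi0; case/andP: tab.
set e := x - y; have hyE : dot y y + dot (x + e) (x + e) = 2 * dot x x + 2 * dot e e.
  have -> : y = x - e by rewrite /e opprB addrC subrK.
  by rewrite !(dotBl, dotBr, dotDl, dotDr); ring.
have he : R ^+ 2 <= dot e e by have := dot_ge0 (x + e); lra.
have k0 : 0 < 2 / R by rewrite divr_gt0.
have := dot_young e (nu t x) k0; rewrite nu1 div1r invf_div => h.
have h2 : 2 / R * dot e e <= 2 * Lam * H x t * dot e e.
  rewrite ler_wpM2r ?dot_ge0 // -mulrA ler_wpM2l //.
have h3 : R / 2 <= 2 / R * dot e e.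
  apply: (@le_trans _ _ (2 / R * R ^+ 2)); last by rewrite ler_wpM2l // ltW.
  rewrite (_ : 2 / R * R ^+ 2 = 2 * R); last by field; rewrite lt0r_neq0.
  by have R0 := R_gt0; lra.
move: h h2 h3; move: (dot e (nu t x)) (2 / R * _) (2 * Lam * _ * _) (R / 2) => *.
lra.
Qed.

Let chart_at t x : a <= t <= 0 -> M t x ->
  exists (U : set E) (F N : E -> V) z, [/\ chart_data a 0 M nu U F N,
    (U `&` [set z | a <= z.2 <= 0]) z, F z = x & z.2 = t].
Proof. exact: mcf_chart_data flow. Qed.

(** Radius 2 R leaves room on both sides: beyond it [far_bound] applies, and it stays within the
    open ball of radius 3 R, so properness gives compactness. *)
Let T2 := track a 0 M `&` ([set x : V | dot x x <= 4 * R ^+ 2] `*` setT).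

Let T2_compact : compact T2.
Proof.
case: flow => _ proper _ _; apply: proper; first exact: closed_ball_compact.
move=> x /= h; rewrite /eball0 /=.
rewrite -(ltr_pXn2r (ltn0Sn 1)) ?nnegrE ?sqrtr_ge0 ?mulr_ge0 ?(ltW R_gt0) //.
rewrite enorm_sqr; apply: le_lt_trans h _; rewrite exprMn ltr_pM2r ?exprn_gt0 //.
by rewrite expr2; lra.
Qed.

Let no_interior_contact m x y t : c' < m -> a < t < 0 -> M t x -> M t y ->
  0 < cutoff r x t -> x <> y ->
  dot (x - y) (nu t x) * cutoff r x t ^+ 4 = m * H x t * dot (x - y) (x - y) ->
  (forall s x' y', a <= s <= t -> M s x' -> M s y' -> 0 <= cutoff r x' s ->
    pair_bound m x' y' s) -> False.
Proof.
move=> c'm /andP[at_ t0] Mx My phi0 xy Em hm.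
have tab : a <= t <= 0 by rewrite !ltW.
have [H0 hR hA] := pinched tab Mx (ltW phi0).
have [U [F [N [z [hC Uz Ex Et]]]]] := chart_at tab Mx.
have [U' [F' [N' [z' [hC' Uz' Ey Et']]]]] := chart_at tab My.
have c04 : 0 < c0 ^+ 4 by rewrite exprn_gt0 // (lt_le_trans ltr01).
have m0 : 0 < m by apply: lt_trans c'm; rewrite mulr_gt0 // mulr_gt0.
have [_ spz _ nuz _] := chart_dataE M_normal hC Uz.
have oU := chart_open hC; have oU' := chart_open hC'.
have csp : {for z, continuous (chart_speed F N)}.
  exact: smooth_on_cont (smooth_chart_speed oU (chart_F hC) (chart_N hC)) (proj1 Uz).
have n1 : \forall y \near z, U y := open_nbhs_nbhs (conj oU (proj1 Uz)).
have ntime (w : E) : w.2 = t -> \forall y \near w, a < y.2 < 0.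
  move=> wt; have c2 : (fun y : E => y.2) @ w --> w.2 by exact: cvg_snd.
  have na : \forall s \near w.2, a < s by apply: lt_nbhsr; rewrite wt.
  have nb : \forall s \near w.2, s < 0 by apply: lt_nbhsl; rewrite wt.
  have nab : \forall s \near w.2, a < s < 0 by apply: filterS2 na nb => s -> ->.
  exact: c2 _ nab.
have n3 : \forall y \near z, 0 < cutoff r (F y) y.2.
  have cF : F @ z --> F z by exact: smooth_on_cont (chart_F hC) (proj1 Uz).
  have ct : (fun y : E => y.2) @ z --> z.2 by exact: cvg_snd.
  have c := @cvg_cutoff _ _ _ r (nbhs z) F (fun y : E => y.2) _ _ _ cF ct.
  have hp : 0 < cutoff r (F z) z.2 by rewrite Ex Et.
  exact: c _ (lt_nbhsr hp).
have n4 : \forall y \near z, chart_speed F N y < chart_speed F N z + 1.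
  have hs : chart_speed F N z < chart_speed F N z + 1 by rewrite ltrDl.
  exact: csp _ (lt_nbhsl hs).
(* On this ball time stays strictly inside the interval, so the flow equation holds on an open set;
   with the cutoff positive, pinching and the upper bound on H bound the shape operator. *)
have [e [e0 he]] : exists e : K, 0 < e /\ forall w, ball z e w ->
    [/\ U w, a < w.2 < 0, 0 < cutoff r (F w) w.2 &
      chart_speed F N w < chart_speed F N z + 1].
  have [e1 /= e10 h1] := (nbhs_ballP _ _).1 n1.
  have [e2 /= e20 h2] := (nbhs_ballP _ _).1 (ntime z Et).
  have [e3 /= e30 h3] := (nbhs_ballP _ _).1 n3.
  have [e4 /= e40 h4] := (nbhs_ballP _ _).1 n4.
  exists (Num.min (Num.min e1 e2) (Num.min e3 e4)); split.
    by rewrite !lt_min e10 e20 e30.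
  have sub e5 : Num.min (Num.min e1 e2) (Num.min e3 e4) <= e5 ->
      ball z (Num.min (Num.min e1 e2) (Num.min e3 e4)) `<=` ball z e5.
    by move=> h; exact: le_ball.
  by move=> w By; split; [apply: h1|apply: h2|apply: h3|apply: h4]; apply: sub By;
    rewrite !ge_min lexx ?orbT.
have [e' [e'0 he']] : exists e : K, 0 < e /\ forall w, ball z' e w -> U' w /\ a < w.2 < 0.
  have n1' : \forall w \near z', U' w := open_nbhs_nbhs (conj oU' (proj1 Uz')).
  have [e1 /= e10 h1] := (nbhs_ballP _ _).1 n1'.
  have [e2 /= e20 h2] := (nbhs_ballP _ _).1 (ntime z' Et').
  exists (Num.min e1 e2); split; first by rewrite lt_min e10.
  by move=> w By; split; [apply: h1|apply: h2]; apply: le_ball By; rewrite ge_min lexx ?orbT.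
have Bz : ball z e `<=` U `&` [set z | a <= z.2 <= 0].
  by move=> w /he[Uy /andP[/ltW y1 /ltW y2] _ _]; split=> //=; rewrite y1.
have Bz' : ball z' e' `<=` U' `&` [set z | a <= z.2 <= 0].
  by move=> w /he'[Uy /andP[/ltW y1 /ltW y2]]; split=> //=; rewrite y1.
have hP : mcf_patch (ball z e) F N (chart_speed F N)
    (fun z => second_ff (M z.2) (nu z.2) (F z)).
  case: (hC) => ? sF sN imm homeo NE fl.
  exact: (chart_patch M_normal oU sF sN imm homeo NE fl (ball_open z e) Bz).
have hP' : mcf_patch (ball z' e') F' N' (chart_speed F' N')
    (fun z => second_ff (M z.2) (nu z.2) (F' z)).
  case: (hC') => ? sF sN imm homeo NE fl.
  exact: (chart_patch M_normal oU' sF sN imm homeo NE fl (ball_open z' e') Bz').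
have hB : shape_bounded (ball z e) (fun z => second_ff (M z.2) (nu z.2) (F z)).
  apply: (@normA_bounded _ _ M nu F (ball z e) (Lam * (chart_speed F N z + 1))) => w By.
  have [_ _ /ltW phiy spy] := he _ By; have [_ yab] := Bz _ By.
  have [_ sy My' _ _] := chart_dataE M_normal hC (Bz _ By).
  have [_ _ hAy] := pinched yab My' phiy.
  by apply: le_trans hAy _; rewrite /H -sy ler_wpM2l ?(ltW Lam_gt0) // ltW.
have spzH : chart_speed F N z = H x t by rewrite spz Ex Et.
have zB : ball z e z by exact: ballxx.
have zB' : ball z' e' z' by exact: ballxx.
have n0 : (0 < n)%N by apply: (patch_dim_gt0 hP zB); rewrite spzH.
(* The gap for Phi = 2 m H / cutoff^4 is the slack in [pair_bound m], divided by cutoff^4. *)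
have gapE w w' : 0 < cutoff r (F w) w.2 ->
    ball_gap (2 * m * chart_speed F N w / cutoff r (F w) w.2 ^+ 4) (F w) (F' w') (N w) =
    (m * chart_speed F N w * dot (F w - F' w') (F w - F' w') -
      dot (F w - F' w') (N w) * cutoff r (F w) w.2 ^+ 4) / cutoff r (F w) w.2 ^+ 4.
  move=> p0; rewrite /ball_gap.
  move: (chart_speed F N w) (dot _ (N w)) (dot _ (F w - F' w')) (cutoff _ _ _) p0 => q1 q2 q3 q4 q40.
  by field; rewrite lt0r_neq0.
apply: (no_contact hP hP' hB (r := r) (m := m) (z := z) (z' := z')) => //.
- by rewrite Et Et'.
- by rewrite Ex Et.
- by rewrite spzH.
- move=> w w' By By' yy' yz.
  have [_ _ phiy _] := he _ By; have [_ yab] := Bz _ By; have [_ yab'] := Bz' _ By'.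
  have [_ sy My1 nuy _] := chart_dataE M_normal hC (Bz _ By).
  have [_ _ My2 _ _] := chart_dataE M_normal hC' (Bz' _ By').
  rewrite gapE // divr_ge0 ?exprn_ge0 ?(ltW phiy) // subr_ge0 -nuy sy.
  apply: hm (ltW phiy) => //; last by rewrite yy'.
  by rewrite -Et yz andbT; case/andP: yab.
- rewrite gapE ?Ex ?Et //; apply/eqP; rewrite mulf_eq0; apply/orP; left.
  by rewrite subr_eq0 Ey spzH -nuz Ex Et Em.
- by rewrite Ex Ey.
- have S0 : 0 <= \sum_i \sum_j (second_ff (M z.2) (nu z.2) (F z)) i j ^+ 2.
    by apply: sumr_ge0 => i _; apply: sumr_ge0 => j _; exact: sqr_ge0.
  have -> : \sum_i \sum_j (second_ff (M z.2) (nu z.2) (F z)) i j ^+ 2 =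
      normA (M t) (nu t) x ^+ 2 by rewrite /normA -Ex -Et sqr_sqrtr.
  rewrite spzH Ex Et.
  have LH : 0 <= Lam * H x t by rewrite mulr_ge0 // ltW.
  rewrite ler_pXn2r ?nnegrE ?sqrtr_ge0 //; last first.
    by rewrite !divr_ge0 ?mulr_ge0 ?exprn_ge0 // ltW.
  apply: le_trans hA _.
  have p4 : 0 < cutoff r x t ^+ 4 by rewrite exprn_gt0.
  have p4c : cutoff r x t ^+ 4 <= c0 ^+ 4.
    apply: lerXn2r; rewrite ?nnegrE ?(ltW phi0) //; first exact: le_trans ler01 c0_ge1.
    by apply: cutoff_le; exact: ltW.
  rewrite ler_pdivlMr // ler_pdivlMr //.
  have h1 : 2 * Lam * cutoff r x t ^+ 4 <= m.
    by apply: le_trans (ltW c'm); apply: ler_wpM2l p4c; rewrite mulr_ge0 // ltW.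
  have h2 : 2 * Lam * cutoff r x t ^+ 4 * H x t <= m * H x t := ler_wpM2r (ltW H0) h1.
  by lra.
Qed.

Let track_cvg (T : topologicalType) (f : V * K -> T) (g : (E -> V) -> (E -> V) -> E -> T)
    x t : a <= t <= 0 -> M t x ->
  (forall U F N z, chart_data a 0 M nu U F N -> (U `&` [set z | a <= z.2 <= 0]) z ->
    {for z, continuous (g F N)} /\ f (F z, z.2) = g F N z) ->
  f @ within (track a 0 M) (nbhs (x, t)) --> f (x, t).
Proof.
move=> tab Mx fg; have [U [F [N [z [hC Uz <- <-]]]]] := chart_at tab Mx.
have cg := (fg _ _ _ _ hC Uz).1; have fgE y (Uy : (U `&` [set z | a <= z.2 <= 0]) y) := (fg _ _ _ y hC Uy).2.
case: (hC) => oU _ _ _ homeo _ _.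
exact: (chart_cvg (f := f) oU homeo Uz cg fgE).
Qed.

Let nu_cvg x t : a <= t <= 0 -> M t x ->
  (fun w : V * K => nu w.2 w.1) @ within (track a 0 M) (nbhs (x, t)) --> nu t x.
Proof.
move=> tab Mx; apply: (track_cvg (f := fun w => nu w.2 w.1) (g := fun F N => N)) => //.
move=> U F N z hC Uz; split; first exact: smooth_on_cont (chart_N hC) (proj1 Uz).
by have [] := chart_dataE M_normal hC Uz.
Qed.

Let H_cvg x t : a <= t <= 0 -> M t x ->
  (fun w : V * K => H w.1 w.2) @ within (track a 0 M) (nbhs (x, t)) --> H x t.
Proof.
move=> tab Mx; apply: (track_cvg (f := fun w => H w.1 w.2) (g := chart_speed)) => //.
move=> U F N z hC Uz; split; last by have [] := chart_dataE M_normal hC Uz.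
exact: smooth_on_cont (smooth_chart_speed (chart_open hC) (chart_F hC) (chart_N hC)) (proj1 Uz).
Qed.

Let interior_gap t1 x1 y1 : a <= t1 < 0 -> M t1 x1 -> M t1 y1 ->
  0 <= cutoff r x1 t1 -> pair_bound c' x1 y1 t1.
Proof.
move=> /andP[at1 t10] Mx1 My1 phi1; apply: contrapT => nb.
(* G, the union of the squares of these sets, is an open neighbourhood of the relevant part of the
   diagonal; pairs in it already satisfy the bound with c', so removing G keeps every violating pair
   and leaves a compact set. *)
pose S : set (set (V * K)) := [set D | open D /\
  forall x y t, D (x, t) -> D (y, t) -> a <= t <= 0 -> M t x -> M t y ->
    0 < H x t /\ dot (x - y) (nu t x) <= 2 * Lam * H x t * dot (x - y) (x - y)].
pose G := \bigcup_(D in S) (D `*` D).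
have oG : open G by apply: bigcup_open => D [oD _]; exact: open_setX.
pose C := [set zz : (V * K) * (V * K) | zz.1.2 = zz.2.2] `&`
  [set zz : (V * K) * (V * K) | zz.1.2 <= t1] `&`
  [set zz : (V * K) * (V * K) | 0 <= cutoff r zz.1.1 zz.1.2].
have c11 : continuous (fun zz : (V * K) * (V * K) => zz.1.1).
  by move=> zz; apply: (cvg_comp fst fst); [exact: cvg_fst|exact: cvg_fst].
have c12 : continuous (fun zz : (V * K) * (V * K) => zz.1.2).
  by move=> zz; apply: (cvg_comp fst snd); [exact: cvg_fst|exact: cvg_snd].
have c21 : continuous (fun zz : (V * K) * (V * K) => zz.2.1).
  by move=> zz; apply: (cvg_comp snd fst); [exact: cvg_snd|exact: cvg_fst].
have c22 : continuous (fun zz : (V * K) * (V * K) => zz.2.2).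
  by move=> zz; apply: (cvg_comp snd snd); [exact: cvg_snd|exact: cvg_snd].
have ccut : continuous (fun zz : (V * K) * (V * K) => cutoff r zz.1.1 zz.1.2).
  by move=> zz; apply: cvg_cutoff; [exact: c11|exact: c12].
have cC : closed C.
  apply: closedI; first apply: closedI.
  - have -> : [set zz : (V * K) * (V * K) | zz.1.2 = zz.2.2] =
      (fun zz : (V * K) * (V * K) => zz.1.2 - zz.2.2) @^-1` [set 0].
      by apply/seteqP; split=> zz /= => [->|/subr0_eq //]; rewrite subrr.
    apply: preimage_closed; last exact: closed_eq.
    by move=> zz _; apply: cvgB; [exact: c12|exact: c22].
  - apply: (@preimage_closed _ _ (fun zz : (V * K) * (V * K) => zz.1.2) [set s | s <= t1]).
      by move=> zz _; exact: c12.
    exact: closed_le.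
  - apply: (@preimage_closed _ _ (fun zz : (V * K) * (V * K) => cutoff r zz.1.1 zz.1.2) [set s | 0 <= s]).
      by move=> zz _; exact: ccut.
    exact: closed_ge.
(* Simultaneous pairs up to time t1 < 0, so a maximum is never attained at the final time. *)
pose K2 := (T2 `*` T2) `&` (C `&` ~` G).
have K2_compact : compact K2.
  apply: compact_closedI; first exact: compact_setX T2_compact T2_compact.
  by apply: closedI => //; exact: open_closedC.
have K2P zz : K2 zz -> exists x y t, [/\ zz = ((x, t), (y, t)),
    [/\ a <= t <= 0, t <= t1, M t x & M t y], 0 <= cutoff r x t, 0 < H x t &
    0 < dot (x - y) (x - y)].
  case: zz => -[x t] [y s] [[[/= [tab Mx] _] [[_ My] _]] [[[/= ts tt1] phi0] nG]].
  subst s; exists x, y, t; have [H0 hR hA] := pinched tab Mx phi0.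
  split=> //; rewrite lt_neqAle dot_ge0 andbT eq_sym; apply/eqP => /dot_eq0/subr0_eq xy.
  (* A diagonal pair with nonnegative cutoff would lie in G by [near_diagonal]. *)
  apply: nG; rewrite -xy.
  have [U [F [N [z [hC Uz Ex Et]]]]] := chart_at tab Mx.
  have := near_diagonal M_normal hC Lam_gt0 Uz.
  rewrite Ex Et => /(_ H0 hA)[D [oD Dz hD]].
  by exists D.
have K2I t x y : a <= t <= t1 -> M t x -> M t y -> 0 <= cutoff r x t ->
    ~ pair_bound c' x y t -> K2 ((x, t), (y, t)).
  move=> /andP[at_ tt1] Mx My phi0 nbxy.
  have tab : a <= t <= 0 by rewrite at_ (le_trans tt1) // ltW.
  have R2 : R ^+ 2 <= 4 * R ^+ 2 by have := sqr_ge0 R; lra.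
  split; split => /=.
  - split=> //; split=> //=; apply: le_trans R2; exact: cutoff_R phi0.
  - split=> //; split=> //=; rewrite leNgt; apply/negP => hy; apply: nbxy.
    exact: far_bound.
  - by [].
  - move=> [D [oD hD] [/= Dx Dy]]; apply: nbxy; apply: bound_of_strong => //.
    by have [] := hD _ _ _ Dx Dy tab Mx My.
pose f (zz : (V * K) * (V * K)) := dot (zz.1.1 - zz.2.1) (nu zz.1.2 zz.1.1) *
  cutoff r zz.1.1 zz.1.2 ^+ 4 / (H zz.1.1 zz.1.2 * dot (zz.1.1 - zz.2.1) (zz.1.1 - zz.2.1)).
have K2_z1 : K2 ((x1, t1), (y1, t1)) by apply: K2I => //; rewrite at1 lexx.
have cf : {within K2, continuous f}.
  apply/subspace_continuousP => zz K2zz; have [x [y [t [Ezz [tab _ Mx _] _ H0 d0]]]] := K2P _ K2zz.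
  rewrite Ezz in K2zz *; set zz0 := ((x, t), (y, t)).
  have wi (T : topologicalType) (h : (V * K) * (V * K) -> T) : continuous h ->
      h @ within K2 (nbhs zz0) --> h zz0.
    by move=> ch; apply: cvg_within_filter; exact: ch.
  have tr (T : topologicalType) (h : V * K -> T) (l : T) :
      h @ within (track a 0 M) (nbhs (x, t)) --> l ->
      (fun zz : (V * K) * (V * K) => h zz.1) @ within K2 (nbhs zz0) --> l.
    move=> ch Q /ch hQ.
    have cfst : (fun zz : (V * K) * (V * K) => zz.1) @ zz0 --> zz0.1 by exact: cvg_fst.
    have h2 : \forall ww \near zz0, track a 0 M ww.1 -> Q (h ww.1) := cfst _ hQ.
    change (\forall ww \near zz0, K2 ww -> Q (h ww.1)).
    apply: filterS h2 => ww h1 K2w.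
    apply: h1; have [u [v [s [Ew [sab _ Mu _] _ _ _]]]] := K2P _ K2w.
    by rewrite Ew.
  have cxy : (fun zz : (V * K) * (V * K) => zz.1.1 - zz.2.1) @ within K2 (nbhs zz0) --> x - y.
    by apply: cvgB; [exact: (wi _ _ c11)|exact: (wi _ _ c21)].
  have cnu := tr _ (fun w : V * K => nu w.2 w.1) (nu t x) (nu_cvg tab Mx).
  have cH := tr _ (fun w : V * K => H w.1 w.2) (H x t) (H_cvg tab Mx).
  apply: cvgM; first apply: cvgM.
  - exact: (cvg_dot cxy cnu).
  - exact: (cvg_exp4 (wi _ _ ccut)).
  - apply: cvgV; first by rewrite lt0r_neq0 // mulr_gt0.
    exact: (cvgM cH (cvg_dot cxy cxy)).
have [zz /set_mem K2zz fmax] := compact_EVT_max (ex_intro _ _ K2_z1) K2_compact cf.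
have [x [y [t [Ezz [tab tt1 Mx My] phi0 H0 d0]]]] := K2P _ K2zz.
set m := f zz in fmax.
have Em : dot (x - y) (nu t x) * cutoff r x t ^+ 4 = m * H x t * dot (x - y) (x - y).
  by rewrite /m Ezz /f /= -mulrA divfK // lt0r_neq0 // mulr_gt0.
have bound_f t' x' y' : 0 < H x' t' -> 0 < dot (x' - y') (x' - y') -> forall c,
    (dot (x' - y') (nu t' x') * cutoff r x' t' ^+ 4 <= c * H x' t' * dot (x' - y') (x' - y')) =
    (f ((x', t'), (y', t')) <= c).
  by move=> H1 d1 c; rewrite /f /= ler_pdivrMr ?mulr_gt0 // -[c * _ * _]mulrA.
have c'm : c' < m.
  have [x2 [y2 [t2 [[? ? ? _] _ _ H1 d1]]]] := K2P _ K2_z1; subst x2 y2 t2.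
  rewrite ltNge; apply/negP => mc; apply: nb; rewrite /pair_bound bound_f //.
  by apply: le_trans mc; apply: fmax; rewrite inE.
have hm s x' y' : a <= s <= t1 -> M s x' -> M s y' -> 0 <= cutoff r x' s ->
    pair_bound m x' y' s.
  move=> sab Mx' My' phi'; have [hb|hb] := pselect (pair_bound c' x' y' s).
    have sab0 : a <= s <= 0 by case/andP: sab => -> st; rewrite (le_trans st) // ltW.
    have [H1 _ _] := pinched sab0 Mx' phi'.
    apply: le_trans hb _; rewrite ler_wpM2r ?dot_ge0 // ler_wpM2r // ltW //.
  have K2s := K2I _ _ _ sab Mx' My' phi' hb.
  have [x2 [y2 [t2 [[? ? ? _] _ _ H1 d1]]]] := K2P _ K2s; subst x2 y2 t2.
  by rewrite /pair_bound bound_f //; apply: fmax; rewrite inE.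
have c04 : 0 < c0 ^+ 4 by rewrite exprn_gt0 // (lt_le_trans ltr01).
have c'0 : 0 < c' by rewrite mulr_gt0 // mulr_gt0.
have m0 : 0 < m by exact: lt_trans c'm.
clearbody m.
(* Where the cutoff vanishes the left side of [Em] is 0, but m, H and |x - y|^2 are positive. *)
have phi_gt0 : 0 < cutoff r x t.
  rewrite lt_neqAle phi0 andbT; apply/eqP => p0; move: Em; rewrite -p0 expr0n mulr0 => /esym/eqP.
  by rewrite !mulf_eq0 (gt_eqF m0) (gt_eqF H0) (gt_eqF d0).
have xy : x <> y by move=> e; move: d0; rewrite e subrr dot0l ltxx.
have [at_ t0] := andP tab.
(* At the initial time the hypothesis gives m <= (1/2) Lam cutoff^4, which is below c'. *)
have ta : a < t.
  rewrite lt_neqAle at_ andbT; apply/eqP => ea.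
  have xb : eball0 (Num.sqrt c0 * r) x by exact: cutoff_ball phi0.
  have yb : eball0 (3 * R) y by case: flow => MB _ _ _; exact: MB tab _ My.
  have := initial (x := x) (y := y); rewrite ea => h.
  have {}h := h (conj Mx xb) (conj My yb).
  rewrite enorm_sqr subr_ge0 in h.
  have p4 : 0 < cutoff r x t ^+ 4 by rewrite exprn_gt0.
  have p4c : cutoff r x t ^+ 4 <= c0 ^+ 4.
    apply: lerXn2r; rewrite ?nnegrE //; first exact: le_trans ler01 c0_ge1.
    exact: cutoff_le.
  have HD : 0 < H x t * dot (x - y) (x - y) by rewrite mulr_gt0.
  have h1 : m * (H x t * dot (x - y) (x - y)) <=
      1 / 2 * Lam * cutoff r x t ^+ 4 * (H x t * dot (x - y) (x - y)).
    rewrite mulrA -Em; apply: le_trans (ler_wpM2r (ltW p4) h) _.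
    by rewrite le_eqVlt; apply/orP; left; apply/eqP; ring.
  rewrite ler_pM2r // in h1.
  have h2 : Lam * cutoff r x t ^+ 4 <= Lam * c0 ^+ 4 by rewrite ler_wpM2l // ltW.
  have h3 : 0 < Lam * cutoff r x t ^+ 4 by rewrite mulr_gt0.
  move: c'm h1 h2 h3; rewrite /c' -!mulrA; move: (Lam * _) (Lam * c0 ^+ 4) => p q; lra.
apply: (no_interior_contact c'm _ Mx My phi_gt0 xy Em).
  by rewrite ta (le_lt_trans tt1).
move=> s x' y' /andP[as_ st]; apply: hm; rewrite as_ (le_trans st) //.
Qed.

Let left_limit_ge0 (k : K -> K) : {for 0, continuous k} ->
  (\forall s \near 0, s < 0 -> 0 <= k s) -> 0 <= k 0.
Proof.
move=> ck kpos; rewrite leNgt; apply/negP => k0.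
have nk : \forall s \near 0, k s < 0 by exact: ck _ (lt_nbhsl k0).
have [e e0 he] := near_ballK (filterI nk kpos).
have en : - (e / 2) < 0 by rewrite oppr_lt0 divr_gt0.
have /he[h1 /(_ en)] : `|- (e / 2) - 0| < e.
  by rewrite subr0 normrN gtr0_norm ?divr_gt0 // ltr_pdivrMr // ltr_pMr // ltr1n.
by rewrite leNgt h1.
Qed.

(** At t = 0 both points are followed backwards along the time lines of their charts, which reach
    past the final time; the bound at negative times passes to the limit. *)
Let gap t x y : a <= t <= 0 -> M t x -> M t y -> 0 < cutoff r x t ->
  pair_bound c' x y t.
Proof.
move=> tab Mx My phi0; have [at_ t0] := andP tab.
move: t0; rewrite le_eqVlt => /orP[/eqP t0|t0]; last first.
  by apply: interior_gap => //; [rewrite at_|exact: ltW].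
subst t; have a0 : a < 0 by rewrite oppr_lt0.
have [U [F [N [z [hC Uz Ex Et]]]]] := chart_at tab Mx.
have [U' [F' [N' [z' [hC' Uz' Ey Et']]]]] := chart_at tab My.
have oU := chart_open hC; have oU' := chart_open hC'.
have lc (W : normedModType K) (D : set E) (f : E -> W) w : smooth_on D f -> D w ->
    (fun s : K => f (w + s *: dt)) @ (0 : K) --> f w.
  move=> sf Dw; have w0 : w + (0 : K) *: dt = w by rewrite scale0r addr0.
  rewrite -[in X in _ --> X]w0.
  apply: (@continuous_comp _ _ _ (fun s : K => w + s *: dt) f).
    exact: continuous_line.
  by rewrite /= w0; exact: smooth_on_cont sf Dw.
pose w s := z + s *: dt; pose w' s := z' + s *: dt.
have cF := lc _ _ F z (chart_F hC) (proj1 Uz).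
have cN := lc _ _ N z (chart_N hC) (proj1 Uz).
have cF' := lc _ _ F' z' (chart_F hC') (proj1 Uz').
have cS := lc _ _ _ z (smooth_chart_speed oU (chart_F hC) (chart_N hC)) (proj1 Uz).
have cP : (fun s : K => cutoff r (F (w s)) s) @ (0 : K) --> cutoff r (F z) 0.
  by apply: cvg_cutoff => //; exact: cvg_id.
pose k s := c' * chart_speed F N (w s) * dot (F (w s) - F' (w' s)) (F (w s) - F' (w' s)) -
  dot (F (w s) - F' (w' s)) (N (w s)) * cutoff r (F (w s)) s ^+ 4.
have w0 : w 0 = z by rewrite /w scale0r addr0.
have w'0 : w' 0 = z' by rewrite /w' scale0r addr0.
have w2 s : (w s).2 = s by rewrite /w /= Et add0r [_ *: _]mulr1.
have w'2 s : (w' s).2 = s by rewrite /w' /= Et' add0r [_ *: _]mulr1.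
have ck : {for 0, continuous k}.
  have ce : (fun s => F (w s) - F' (w' s)) @ (0 : K) --> F z - F' z' by exact: cvgB.
  change (k @ (0 : K) --> k 0); rewrite /k w0 w'0; apply: cvgB.
    apply: cvgM; last exact: cvg_dot.
    by apply: cvgM => //; exact: cvg_cst.
  by apply: cvgM; [exact: cvg_dot|exact: cvg_exp4].
have [_ spz _ nuz _] := chart_dataE M_normal hC Uz.
rewrite /pair_bound -subr_ge0.
suff : 0 <= k 0 by rewrite /k w0 w'0 spz -nuz Et Ex Ey.
apply: left_limit_ge0 ck _.
have nU : \forall s \near (0 : K), U (w s) by exact: line_near dt oU (proj1 Uz).
have nU' : \forall s \near (0 : K), U' (w' s) by exact: line_near dt oU' (proj1 Uz').
have na : \forall s \near (0 : K), a < s by exact: lt_nbhsr.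
have np : \forall s \near (0 : K), 0 < cutoff r (F (w s)) s.
  have hp : 0 < cutoff r (F z) 0 by rewrite Ex.
  exact: cP _ (lt_nbhsr hp).
have nUU : \forall s \near (0 : K), U (w s) /\ U' (w' s).
  by apply: filterS2 nU nU' => s.
apply: filterS3 nUU na np => s [Us Us'] as_ ps s0.
have sab : a <= s <= 0 by rewrite !ltW.
have Uw : (U `&` [set z | a <= z.2 <= 0]) (w s) by split; [|rewrite /mkset w2].
have Uw' : (U' `&` [set z | a <= z.2 <= 0]) (w' s) by split; [|rewrite /mkset w'2].
have [_ sps Ms nus _] := chart_dataE M_normal hC Uw.
have [_ _ Ms' _ _] := chart_dataE M_normal hC' Uw'.
rewrite w2 in sps Ms nus; rewrite w'2 in Ms'.
rewrite /k subr_ge0 sps -nus.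
by apply: interior_gap => //; [rewrite ltW|exact: ltW].
Qed.

Lemma noncollapsing t x y : a <= t <= 0 -> (M t `&` eball0 (r / 2)) x ->
  (M t `&` eball0 (3 * R)) y ->
  0 <= Lam * (2 + 6 * n%:R) ^+ 4 * H x t * enorm (x - y) ^+ 2 - dot (x - y) (nu t x).
Proof.
move=> tab [Mx xb] [My _]; rewrite enorm_sqr.
have xx : dot x x <= r ^+ 2 / 4.
  rewrite -enorm_sqr (_ : r ^+ 2 / 4 = (r / 2) ^+ 2); last by field.
  by rewrite ler_pXn2r ?nnegrE ?sqrtr_ge0 ?divr_ge0 // ltW.
(* 7/8 - 1/4, since |x|^2 <= r^2 / 4 and t <= 0. *)
have phi5 : 5 / 8 <= cutoff r x t.
  have h1 : (3 * n%:R * t + dot x x) / r ^+ 2 <= 1 / 4.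
    rewrite ler_pdivrMr //; have : 3 * n%:R * t <= 0.
      by rewrite mulr_ge0_le0 // ?mulr_ge0 //; case/andP: tab.
    by move: xx; lra.
  by rewrite /cutoff; lra.
have phi0 : 0 < cutoff r x t by apply: lt_le_trans phi5; rewrite divr_gt0.
have [H0 _ _] := pinched tab Mx (ltW phi0).
have := gap tab Mx My phi0; rewrite /pair_bound /c'.
have -> : 2 + 6 * n%:R = 2 * c0 :> K by rewrite /c0; ring.
have p4 : (5 / 8) ^+ 4 <= cutoff r x t ^+ 4.
  by apply: lerXn2r; rewrite ?nnegrE ?divr_ge0 // ltW.
have X0 : 0 <= Lam * c0 ^+ 4 * H x t * dot (x - y) (x - y).
  rewrite mulr_ge0 ?dot_ge0 // mulr_ge0 ?(ltW H0) // mulr_ge0 ?(ltW Lam_gt0) //.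
  by rewrite exprn_ge0 // (le_trans ler01).
rewrite subr_ge0 (_ : Lam * (2 * c0) ^+ 4 * H x t * dot (x - y) (x - y) =
  16 * (Lam * c0 ^+ 4 * H x t * dot (x - y) (x - y))); last by ring.
rewrite (_ : 2 * Lam * c0 ^+ 4 * H x t * dot (x - y) (x - y) =
  2 * (Lam * c0 ^+ 4 * H x t * dot (x - y) (x - y))); last by ring.
move: X0 p4; move: (Lam * _ * _ * _) (dot _ (nu t x)) (cutoff r x t ^+ 4) => X d p X0 p4 hd.
have [d0|d0] := leP d 0; first by apply: le_trans d0 _; rewrite mulr_ge0.
have h : d * (5 / 8) ^+ 4 <= d * p by rewrite ler_wpM2l // ltW.
(* (2 + 6 n)^4 = 16 c0^4, and 16 * 625 / 4096 > 2 covers the factor 2 in c'. *)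
have e4 : (5 / 8) ^+ 4 = 625 / 4096 :> K by field.
rewrite e4 in h; lra.
Qed.

End Noncollapsing.

Theorem theorem1 (K : realType) (n : nat) (R r Lam : K)
    (M : K -> set 'rV[K]_n.+1) (nu : K -> 'rV[K]_n.+1 -> 'rV[K]_n.+1)
    (H := fun (x : 'rV[K]_n.+1) (t : K) => mean_curv (M t) (nu t) x)
    (R_gt0 : 0 < R) (r_gt0 : 0 < r) (Lam_gt0 : 0 < Lam)
    (Rr : Num.sqrt (1 + 3 * n%:R) * r <= R)
    (flow : embedded_mcf (- r ^+ 2) 0 (eball0 (3 * R)) M nu)
    (pinching : forall t x, - r ^+ 2 <= t <= 0 ->
       (M t `&` eball0 (Num.sqrt (1 + 3 * n%:R) * r)) x ->
       R^-1 <= Lam * H x t /\ normA (M t) (nu t) x <= Lam * H x t)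
    (initial : forall x y,
       (M (- r ^+ 2) `&` eball0 (Num.sqrt (1 + 3 * n%:R) * r)) x ->
       (M (- r ^+ 2) `&` eball0 (3 * R)) y ->
       0 <= 1 / 2 * Lam * H x (- r ^+ 2) * enorm (x - y) ^+ 2
            - dot (x - y) (nu (- r ^+ 2) x)) :
  forall t x y, - r ^+ 2 <= t <= 0 ->
    (M t `&` eball0 (r / 2)) x -> (M t `&` eball0 (3 * R)) y ->
    0 <= Lam * (2 + 6 * n%:R) ^+ 4 * H x t * enorm (x - y) ^+ 2
         - dot (x - y) (nu t x).
Proof.
move=> t x y tab Mx My.
exact: (noncollapsing R_gt0 r_gt0 Lam_gt0 Rr flow pinching initial tab Mx My).
Qed.
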